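(* For $T\to0$, the inflection locus $\mathcal I$ has two branches, with the asymptotics $$(1)\quad \alpha_A\sim\frac{60}{\beta}\left(\frac{T}{T_A}\right)^{3},\qquad \alpha_B\sim\frac{60\,\mu_A}{\beta\,\mu_B}\left(\frac{T}{T_A}\right)^{3}e^{-\frac{T_B-T_A}{T}},$$ $$(2)\quad \alpha_A\sim\frac1\beta\left(\frac{T}{T_A}\right)^{3/2},\qquad \alpha_B\sim\frac{\mu_A}{\beta\,\mu_B}\left(\frac{T}{T_A}\right)^{3/2}e^{-\frac{T_B-T_A}{T}} .$$ Consequently the characteristic directions of $\lambda_\pm$ are not genuinely nonlinear in a neighbourhood of $(T,\alpha_A)=(0,0)$ (every neighbourhood of $(0,0)$ contains points where $\boldsymbol r_\pm\nabla\lambda_\pm=0$).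
   Context: Fixed constants: $R,M,\mu_A,\mu_B>0$, $0<\beta<1$, $0<T_A<T_B\le 2T_A$. The thermodynamic state is described either by $(p,T)$ or by $(T,\alpha_A)$ with $T>0$, $0<\alpha_A<1$, related by $$p=\frac{(1-\alpha_A)(1+\alpha)}{\mu_A\alpha_A\alpha}T^{5/2}e^{-T_A/T},\quad \alpha=\beta\alpha_A+(1-\beta)\alpha_B,\quad \alpha_B=\frac{\mu_A\alpha_Ae^{-(T_B-T_A)/T}}{\mu_A\alpha_Ae^{-(T_B-T_A)/T}+\mu_B(1-\alpha_A)} .$$ Specific volume: $v=\frac{RT}{Mp}(1+\alpha)$; specific enthalpy: $h=\frac{5RT}{2M}(1+\alpha)+\frac RM[\beta T_A\alpha_A+(1-\beta)T_B\alpha_B]$; the specific entropy $S(p,T)$ satisfies $dh=T\,dS+v\,dp$, and $\eta=\frac MRS$. With subscripts denoting partial derivatives in $(p,T)$, set $\lambda=\sqrt{-\eta_T/(v_p\eta_T-v_T\eta_p)}$; the forward/backward Lagrangian characteristic speeds are $\lambda_\pm=\pm\lambda$, with characteristic vector fields $\boldsymbol r_\pm=(\pm1,\ 1/\lambda,\ \mp\eta_p/\eta_T)$ in the variables $(p,u,T)$ ($u$ the flow velocity), so that $$\boldsymbol r_\pm\nabla\lambda_\pm=\frac{\partial\lambda}{\partial p}-\frac{\eta_p}{\eta_T}\frac{\partial\lambda}{\partial T}.$$ The characteristic direction is genuinely nonlinear where $\boldsymbol r_\pm\nabla\lambda_\pm\ne0$. The inflection locus is $\mathcal I=\{(T,\alpha_A):\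 \boldsymbol r_\pm\nabla\lambda_\pm=0,\ T>0,\ 0<\alpha_A<1\}$.
   Formalization: That the locus consists of exactly the two branches is stated for 0<α_A<δ with any fixed δ<1 and T small depending on δ; over all 0<α_A<1 it is false, since for small T two further branches exist with α_A→1. *)

(* Defs.v *)
From Stdlib Require Import Reals ClassicalEpsilon.
From Coquelicot Require Import Coquelicot.
Open Scope R_scope.

Record gas := Gas {
  Rgas : R;
  Mgas : R;
  muA : R;
  muB : R;
  beta : R;
  TA : R;
  TB : R
}.

Definition degB (g : gas) (T aA : R) : R :=
  muA g * aA * exp (- (TB g - TA g) / T)
  / (muA g * aA * exp (- (TB g - TA g) / T) + muB g * (1 - aA)).

Definition deg (g : gas) (T aA : R) : R :=
  beta g * aA + (1 - beta g) * degB g T aA.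

Definition pressure (g : gas) (T aA : R) : R :=
  (1 - aA) * (1 + deg g T aA) / (muA g * aA * deg g T aA)
  * Rpower T (5 / 2) * exp (- TA g / T).

(* Change of state variables from (p, T) to (T, aA).  For T > 0, positive constants and
   beta < 1, the map
   [pressure g T] is a decreasing bijection from (0, 1) onto (0, +oo), so for
   p, T > 0 the chosen value is the unique solution of the equation. *)
Definition degA (g : gas) (p T : R) : R :=
  epsilon (inhabits 0) (fun aA => 0 < aA < 1 /\ pressure g T aA = p).

(* From here on, thermodynamic quantities are functions of (p, T). *)
Definition volume (g : gas) (p T : R) : R :=
  Rgas g * T / (Mgas g * p) * (1 + deg g T (degA g p T)).

Definition enthalpy (g : gas) (p T : R) : R :=
  5 * Rgas g * T / (2 * Mgas g) * (1 + deg g T (degA g p T))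
  + Rgas g / Mgas g
    * (beta g * TA g * degA g p T
       + (1 - beta g) * TB g * degB g T (degA g p T)).

(* dh = T dS + v dp as an identity of differentials on p > 0, T > 0; it
   determines S there up to an additive constant. *)
Definition is_entropy (g : gas) (S : R -> R -> R) : Prop :=
  forall p T : R, 0 < p -> 0 < T ->
  exists h_p h_T S_p S_T : R,
    differentiable_pt_lim (enthalpy g) p T h_p h_T /\
    differentiable_pt_lim S p T S_p S_T /\
    h_p = T * S_p + volume g p T /\
    h_T = T * S_T.

Definition eta (g : gas) (S : R -> R -> R) (p T : R) : R :=
  Mgas g / Rgas g * S p T.

Definition d_p (f : R -> R -> R) (p T : R) : R := Derive (fun x => f x T) p.
Definition d_T (f : R -> R -> R) (p T : R) : R := Derive (fun y => f p y) T.

Definition lambda (g : gas) (S : R -> R -> R) (p T : R) : R :=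
  sqrt (- d_T (eta g S) p T
        / (d_p (volume g) p T * d_T (eta g S) p T
           - d_T (volume g) p T * d_p (eta g S) p T)).

Inductive char_family := forward | backward.

Definition sgn (k : char_family) : R :=
  match k with forward => 1 | backward => -1 end.

Definition char_speed (g : gas) (S : R -> R -> R) (k : char_family) (p u T : R) : R :=
  sgn k * lambda g S p T.

Definition char_field (g : gas) (S : R -> R -> R) (k : char_family) (p u T : R)
  : R * R * R :=
  (sgn k, 1 / lambda g S p T, - sgn k * (d_p (eta g S) p T / d_T (eta g S) p T)).

(* The derivative of the characteristic speed along its own characteristic
   field, in the variables (p, u, T). *)
Definition speed_derivative (g : gas) (S : R -> R -> R) (k : char_family) (p u T : R)
  : R :=
  let '(r_p, r_u, r_T) := char_field g S k p u T in
  r_p * Derive (fun x => char_speed g S k x u T) p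
  + r_u * Derive (fun x => char_speed g S k p x T) u
  + r_T * Derive (fun x => char_speed g S k p u x) T.

(* Nothing depends on the flow velocity u, so a state is identified with its
   thermodynamic part (T, aA) by requiring the condition for every u. *)
Definition inflection_locus (g : gas) (S : R -> R -> R) (k : char_family) (T aA : R)
  : Prop :=
  0 < T /\ 0 < aA < 1 /\
  forall u : R, speed_derivative g S k (pressure g T aA) u T = 0.

Definition genuinely_nonlinear_on (g : gas) (S : R -> R -> R) (k : char_family)
  (U : R * R -> Prop) : Prop :=
  forall T aA u : R, U (T, aA) -> 0 < T -> 0 < aA < 1 ->
  speed_derivative g S k (pressure g T aA) u T <> 0.

(* Main.v *)
(** Write [t = ln T], [y = logit a].  Isentropes satisfy [dy/dt = N/P] with [P > 0], and
    [c = - d ln v / d ln p] along an isentrope equals [Z/Y] with [Y, Z > 0] explicit.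
    Since [lambda^2 = p/(c v)], the inflection condition becomes [F = 0] with
    [F = Y V(Z) - Z V(Y) - Y Z (Y + Z)], [V = P d/dt + N d/dy].

    As [T -> 0] with [a] away from [1], [degB] is of order [e = (muA/muB) exp (-(TB-TA)/T)],
    so [F = F0 + e G] where [F0] is [F] for [degB = 0] and [G] and its [a]-derivatives are
    polynomially bounded in [1/T].  With [n = TA/T] and [A = beta a (1-a)],
    [F0 = - 2 n^2 A P^2 + n^3 A (1 + beta a) (2 - 4 a + (1-beta) a^2) - Y Z (Y + Z)],
    [Y = 5 + n^2 beta a + ...], [Z = 3 + n^2 beta a + ...].
    [F] is strictly concave in [a] on [(0, 1/10)] and negative on [[1/20, delta)], so it has at
    most two zeros; the dominant balances [2 n^3 beta a = 120] and
    [2 n^3 beta a = 2 (n^2 beta a)^3] locate them. *)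
Require Import Defs.
From Stdlib Require Import Reals Lra Psatz Lia ClassicalEpsilon.
From Coquelicot Require Import Coquelicot.
Open Scope R_scope.

(** * Implicit functions *)

(** Two obstacles shape the proof. [degA] is a choice function, so it is differentiated implicitly;
    this is done once, along an arbitrary curve in (p, T) with given logarithmic velocity, and both
    partial derivatives of every quantity are instances. Excluding further zeros needs the second
    a-derivative of F, whose full expansion is out of reach. So each coordinate of a state is
    written exactly as its value at [degB = 0] plus e times a function whose a-derivatives are
    controlled too, a form that survives sums and products and hence passes to F. Concavity comes
    from - Y Z (Y + Z): for small a both Y and Z have slope about n^2 beta, so this term has
    curvature of order at least (n^2 beta)^2, against n^3 beta for the term in n^3. The number 120
    is Y Z (Y + Z) = 5 * 3 * 8 at a = 0. Asymptotics and continuity of the branches are both read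
    off from the sign of F at test points. *)

Lemma is_derive_increment_mult (u w : R -> R) (s du : R) :
  is_derive u s du -> continuous w s ->
  is_derive (fun x => (u x - u s) * w x) s (du * w s).
Proof.
  intros Hu Hw.
  apply is_derive_Reals in Hu; apply is_derive_Reals.
  intros eps Heps.
  set (B := Rabs du + 1).
  assert (HB : 0 < B) by (unfold B; pose proof (Rabs_pos du); lra).
  set (C := Rabs (w s) + 1).
  assert (HC : 0 < C) by (unfold C; pose proof (Rabs_pos (w s)); lra).
  assert (He1 : 0 < Rmin 1 (eps / (2 * C))).
  { apply Rmin_pos; [lra|]. apply Rdiv_lt_0_compat; lra. }
  destruct (Hu _ He1) as [d1 Hd1].
  assert (He2 : 0 < eps / (2 * B)) by (apply Rdiv_lt_0_compat; lra).
  destruct (proj1 (filterlim_locally w (w s)) Hw (mkposreal _ He2)) as [d2 Hd2].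
  assert (Hd : 0 < Rmin d1 d2) by (apply Rmin_pos; apply cond_pos).
  exists (mkposreal _ Hd); intros h Hh0 Hh; simpl in Hh.
  pose proof (Rmin_l d1 d2) as R1; pose proof (Rmin_r d1 d2) as R2.
  specialize (Hd1 h Hh0 ltac:(lra)).
  assert (Hw2 : Rabs (w (s + h) - w s) < eps / (2 * B)).
  { apply (Hd2 (s + h)). unfold ball; simpl; unfold AbsRing_ball, abs, minus, plus, opp; simpl.
    replace (s + h + - s) with h by ring. lra. }
  pose proof (Rmin_l 1 (eps / (2 * C))) as R3; pose proof (Rmin_r 1 (eps / (2 * C))) as R4.
  (* The increment of [u] vanishes at [s], so the quotient is [Q (w (s + h) - w s) + (Q - du) w s]
     up to the limit, and mere continuity of [w] suffices. *)
  set (Q := (u (s + h) - u s) / h) in *.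
  replace (((u (s + h) - u s) * w (s + h) - (u s - u s) * w s) / h - du * w s)
    with (Q * (w (s + h) - w s) + (Q - du) * w s) by (unfold Q; field; exact Hh0).
  assert (HQ : Rabs Q <= B).
  { replace Q with ((Q - du) + du) by ring.
    eapply Rle_trans; [apply Rabs_triang|]. unfold B; lra. }
  eapply Rle_lt_trans; [apply Rabs_triang|]. rewrite !Rabs_mult.
  assert (H1 : Rabs Q * Rabs (w (s + h) - w s) <= B * Rabs (w (s + h) - w s))
    by (apply Rmult_le_compat_r; [apply Rabs_pos|exact HQ]).
  assert (H2 : B * Rabs (w (s + h) - w s) < B * (eps / (2 * B)))
    by (apply Rmult_lt_compat_l; assumption).
  assert (H3 : Rabs (Q - du) * Rabs (w s) <= (eps / (2 * C)) * C).
  { apply Rmult_le_compat; try apply Rabs_pos; [lra|unfold C; lra]. }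
  replace (B * (eps / (2 * B))) with (eps / 2) in H2 by (field; lra).
  replace (eps / (2 * C) * C) with (eps / 2) in H3 by (field; lra).
  lra.
Qed.

Lemma strictly_decreasing (f df : R -> R) (l u : R) :
  (forall x, l < x < u -> is_derive f x (df x)) ->
  (forall x, l < x < u -> df x < 0) ->
  forall x y, l < x -> x < y -> y < u -> f y < f x.
Proof.
  intros Hd Hn x y Hx Hxy Hy.
  destruct (MVT_gen f x y df) as [c [Hc He]].
  - rewrite Rmin_left, Rmax_right by lra. intros z Hz; apply Hd; lra.
  - rewrite Rmin_left, Rmax_right by lra. intros z Hz.
    apply continuity_pt_filterlim. apply (ex_derive_continuous f). exists (df z); apply Hd; lra.
  - rewrite Rmin_left, Rmax_right in Hc by lra.
    specialize (Hn c ltac:(lra)). nra.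
Qed.

(* The difference quotient of [g] is read off [Phi s (g s) - Phi s (g s0)] by the
   mean value theorem; [xi] below selects the intermediate points. *)
Lemma is_derive_implicit (Phi Phia : R -> R -> R) (g : R -> R) (l u s0 dPhi c0 : R) :
  locally s0 (fun s => l < g s < u /\ Phi s (g s) = c0) ->
  locally s0 (fun s => forall a, l < a < u ->
     is_derive (Phi s) a (Phia s a) /\ Phia s a < 0) ->
  is_derive (fun s => Phi s (g s0)) s0 dPhi ->
  (forall a, l < a < u -> continuous (fun s => Phi s a) s0) ->
  (forall xi, xi s0 = g s0 -> continuous xi s0 ->
     continuous (fun s => Phia s (xi s)) s0) ->
  is_derive g s0 (- dPhi / Phia s0 (g s0)).
Proof.
  intros Hg Ha Hs Hc Hcont.
  pose proof (locally_singleton _ _ Hg) as [Hg0 HP0].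
  pose proof (locally_singleton _ _ Ha) as Ha0.
  set (a0 := g s0) in *.
  assert (Hdec : forall s, (forall a, l < a < u ->
     is_derive (Phi s) a (Phia s a) /\ Phia s a < 0) ->
     forall x y, l < x -> x < y -> y < u -> Phi s y < Phi s x).
  { intros s H. apply strictly_decreasing with (df := Phia s); intros; apply H; assumption. }
  (* By strict monotonicity [Phi s0] lies strictly on either side of [c0] at [a0 - e] and [a0 + e];
     this persists for nearby [s] and traps [g s] between them. *)
  assert (Hgc : continuous g s0).
  { apply filterlim_locally. intros eps.
    set (e := Rmin (eps / 2) (Rmin ((a0 - l) / 2) ((u - a0) / 2))).
    assert (He : 0 < e).
    { unfold e. pose proof (cond_pos eps). repeat apply Rmin_pos; lra. }
    assert (He1 : e < eps) by (unfold e; pose proof (cond_pos eps);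
      pose proof (Rmin_l (eps / 2) (Rmin ((a0 - l) / 2) ((u - a0) / 2))); lra).
    assert (He2 : e <= (a0 - l) / 2 /\ e <= (u - a0) / 2).
    { unfold e. split.
      - eapply Rle_trans; [apply Rmin_r|apply Rmin_l].
      - eapply Rle_trans; [apply Rmin_r|apply Rmin_r]. }
    destruct He2 as [He2 He3].
    assert (Hlt : Phi s0 (a0 + e) < c0).
    { rewrite <- HP0. apply (Hdec s0 Ha0); lra. }
    assert (Hgt : c0 < Phi s0 (a0 - e)).
    { rewrite <- HP0. apply (Hdec s0 Ha0); lra. }
    pose proof (Hc (a0 + e) ltac:(lra)) as C1. pose proof (Hc (a0 - e) ltac:(lra)) as C2.
    assert (L1 : locally s0 (fun s => Phi s (a0 + e) < c0)).
    { apply (C1 (fun y => y < c0)). apply (open_lt c0). exact Hlt. }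
    assert (L2 : locally s0 (fun s => c0 < Phi s (a0 - e))).
    { apply (C2 (fun y => c0 < y)). apply (open_gt c0). exact Hgt. }
    generalize (filter_and _ _ (filter_and _ _ L1 L2) (filter_and _ _ Hg Ha)).
    apply filter_imp. intros s [[H1 H2] [[H3 H4] H5]].
    pose proof (Hdec s H5) as Hd.
    assert (g s < a0 + e).
    { destruct (Rlt_le_dec (g s) (a0 + e)) as [?|Hle]; [assumption|].
      destruct Hle as [Hlt'|Heq]; [|rewrite Heq in H1; lra].
      specialize (Hd (a0 + e) (g s) ltac:(lra) Hlt' ltac:(lra)). lra. }
    assert (a0 - e < g s).
    { destruct (Rlt_le_dec (a0 - e) (g s)) as [?|Hle]; [assumption|].
      destruct Hle as [Hlt'|Heq]; [|rewrite <- Heq in H2; lra].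
      specialize (Hd (g s) (a0 - e) ltac:(lra) Hlt' ltac:(lra)). lra. }
    unfold ball; simpl; unfold AbsRing_ball, abs, minus, plus, opp; simpl.
    fold a0. apply Rabs_def1; lra. }
  assert (Hmv : forall s, (l < g s < u /\ Phi s (g s) = c0) -> (forall a, l < a < u ->
     is_derive (Phi s) a (Phia s a) /\ Phia s a < 0) ->
     exists c, Rmin a0 (g s) <= c <= Rmax a0 (g s) /\
       Phi s (g s) - Phi s a0 = Phia s c * (g s - a0)).
  { intros s [H3 H4] H5.
    assert (Hr : forall x, Rmin a0 (g s) <= x <= Rmax a0 (g s) -> l < x < u).
    { intros x. unfold Rmin, Rmax. destruct (Rle_dec a0 (g s)); lra. }
    apply MVT_gen.
    - intros x Hx. apply H5. apply Hr. lra.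
    - intros x Hx. apply continuity_pt_filterlim.
      apply (ex_derive_continuous (Phi s)). exists (Phia s x). apply H5, Hr, Hx. }
  set (xi := fun s => epsilon (inhabits 0) (fun c => Rmin a0 (g s) <= c <= Rmax a0 (g s) /\
       Phi s (g s) - Phi s a0 = Phia s c * (g s - a0))).
  assert (Hxi : locally s0 (fun s => (Rmin a0 (g s) <= xi s <= Rmax a0 (g s) /\
       Phi s (g s) - Phi s a0 = Phia s (xi s) * (g s - a0)) /\ Phia s (xi s) < 0)).
  { generalize (filter_and _ _ Hg Ha). apply filter_imp. intros s [H1 H2].
    assert (H3 := epsilon_spec (inhabits 0) _ (Hmv s H1 H2)). split; [exact H3|].
    apply H2. destruct H3 as [H3 _]. unfold xi. revert H3.
    unfold Rmin, Rmax. destruct (Rle_dec a0 (g s)); lra. }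
  assert (Hxi0 : xi s0 = a0).
  { destruct (locally_singleton _ _ Hxi) as [[H1 _] _]. fold a0 in H1.
    rewrite Rmin_left, Rmax_left in H1 by lra. lra. }
  assert (Hxic : continuous xi s0).
  { apply filterlim_locally. intros eps.
    generalize (filter_and _ _ Hxi (proj1 (filterlim_locally g a0) Hgc eps)).
    apply filter_imp. intros s [[[H1 _] _] H2]. rewrite Hxi0.
    unfold ball in *; simpl in *; unfold AbsRing_ball, abs, minus, plus, opp in *; simpl in *.
    apply Rabs_def2 in H2. revert H1. unfold Rmin, Rmax.
    destruct (Rle_dec a0 (g s)); intros; apply Rabs_def1; lra. }
  (* Near [s0], [g s - a0] is the increment of [Phi s a0] times this weight. The weight is only
     known to be continuous, which is why continuity of [Phia] along curves replaces joint
     continuity. *)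
  assert (Hw : continuous (fun s => - / Phia s (xi s)) s0).
  { apply (continuous_opp (fun s => / Phia s (xi s))). apply continuous_Rinv_comp.
    - apply Hcont; assumption.
    - rewrite Hxi0. pose proof (proj2 (Ha0 a0 Hg0)). lra. }
  pose proof (is_derive_increment_mult _ _ _ _ Hs Hw) as Hd.
  pose proof (is_derive_plus _ _ _ _ _ Hd (is_derive_const a0 s0)) as Hd2.
  match type of Hd2 with is_derive _ _ ?v => replace (- dPhi / Phia s0 a0) with v end.
  2:{ rewrite Hxi0. unfold plus, zero; simpl. unfold Rdiv. ring. }
  eapply is_derive_ext_loc; [|exact Hd2].
  generalize (filter_and _ _ Hxi Hg). apply filter_imp.
  intros s [[[_ H1] H2] [_ H3]]. unfold plus; simpl. fold a0. fold a0 in HP0.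
  apply (Rmult_eq_reg_l (Phia s (xi s))); [|lra].
  replace (Phia s (xi s) * ((Phi s a0 - Phi s0 a0) * - / Phia s (xi s) + a0))
    with (- (Phi s a0 - Phi s0 a0) + Phia s (xi s) * a0) by (field; lra).
  rewrite HP0. rewrite H3 in H1. lra.
Qed.

(** * States and isentropes *)

Definition positive_gas (g : gas) : Prop :=
  0 < Rgas g /\ 0 < Mgas g /\ 0 < muA g /\ 0 < muB g /\ 0 < beta g < 1 /\
  0 < TA g /\ TA g < TB g.

(* [1/deg] and [1/(1 + deg)] enter only through [x_J], [x_d] and [x_ph], so that the
   inflection equation is polynomial in these coordinates. *)
Record state := St {
  x_n : R; x_q : R; x_a : R; x_b : R; x_al : R;
  x_A : R; x_B : R; x_J : R; x_d : R; x_ph : R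
}.

Definition varA (g : gas) (a : R) : R := beta g * (a * (1 - a)).
Definition varB (g : gas) (T a : R) : R :=
  (1 - beta g) * (degB g T a * (1 - degB g T a)).

Definition state_at (g : gas) (T a : R) : state :=
  St (TA g / T) ((TB g - TA g) / T) a (degB g T a) (deg g T a)
     (varA g a) (varB g T a) (varB g T a / deg g T a)
     ((varA g a + varB g T a) / deg g T a) (/ (1 + deg g T a)).

(* Velocity of the state along a curve with [t = d ln T] and [y = d logit a]. *)
Definition velocity (x : state) (t y : R) : state :=
  let da := x_a x * (1 - x_a x) * y in
  let db := x_b x * (1 - x_b x) * (y + x_q x * t) in
  let dal := (x_A x + x_B x) * y + x_q x * x_B x * t in
  let dA := x_A x * ((1 - 2 * x_a x) * y) in
  let dB := x_B x * ((1 - 2 * x_b x) * (y + x_q x * t)) in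
  let lal := x_d x * y + x_q x * x_J x * t in
  let dJ := x_J x * ((1 - 2 * x_b x) * (y + x_q x * t) - lal) in
  let dd := (x_d x - x_J x) * ((1 - 2 * x_a x) * y)
            + x_J x * ((1 - 2 * x_b x) * (y + x_q x * t)) - x_d x * lal in
  St (- x_n x * t) (- x_q x * t) da db dal dA dB dJ dd (- (x_ph x) ^ 2 * dal).

Definition Ef (n : R) : R := n ^ 2 + 3 * n + 15 / 4.
Definition Ef' (n : R) : R := 2 * n + 3.

(** The isentropic direction is normalized polynomially: along [t = P], [y = N] one has d ln p = Y
    and d ln v = - Z. Up to the factor [Kf], Y is also the heat capacity at constant pressure, T
    eta_T = Y / K. *)
Definition Pf (x : state) : R :=
  1 + x_al x + x_d x + (x_n x + 5 / 2) * (x_A x + x_B x) + x_q x * x_B x.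
Definition Nf (x : state) : R :=
  x_n x * (1 + x_al x) - x_q x * x_B x * (x_n x + 5 / 2 + x_q x) - x_q x * x_J x.
Definition Yf (x : state) : R :=
  5 / 2 * (1 + x_al x + x_d x) + (x_n x + 5 / 2) ^ 2 * x_A x
  + (x_n x + x_q x + 5 / 2) ^ 2 * x_B x + x_q x ^ 2 * (x_A x * x_J x * x_ph x).
Definition Zf (x : state) : R :=
  3 / 2 * (1 + x_al x + x_d x) + Ef (x_n x) * x_A x
  + Ef (x_n x + x_q x) * x_B x + x_q x ^ 2 * (x_A x * x_J x).

(** Formal differential of [Yf] at [x] in the direction [v]. Being polynomial in both, it keeps [Ff]
    polynomial in the state, as the perturbation and continuity arguments require. *)
Definition dYf (x v : state) : R :=
  5 / 2 * (x_al v + x_d v)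
  + 2 * (x_n x + 5 / 2) * x_n v * x_A x + (x_n x + 5 / 2) ^ 2 * x_A v
  + 2 * (x_n x + x_q x + 5 / 2) * (x_n v + x_q v) * x_B x
  + (x_n x + x_q x + 5 / 2) ^ 2 * x_B v
  + 2 * x_q x * x_q v * (x_A x * x_J x * x_ph x)
  + x_q x ^ 2 * (x_A v * x_J x * x_ph x + x_A x * x_J v * x_ph x
                 + x_A x * x_J x * x_ph v).
Definition dZf (x v : state) : R :=
  3 / 2 * (x_al v + x_d v)
  + Ef' (x_n x) * x_n v * x_A x + Ef (x_n x) * x_A v
  + Ef' (x_n x + x_q x) * (x_n v + x_q v) * x_B x
  + Ef (x_n x + x_q x) * x_B v
  + 2 * x_q x * x_q v * (x_A x * x_J x)
  + x_q x ^ 2 * (x_A v * x_J x + x_A x * x_J v).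

Definition isentropic (x : state) : state := velocity x (Pf x) (Nf x).

(** Along [isentropic], d ln (lambda^2) = d ln p - d ln v + d ln Y - d ln Z = - F / (Y Z). *)
Definition Ff (x : state) : R :=
  Yf x * dZf x (isentropic x) - Zf x * dYf x (isentropic x)
  - Yf x * Zf x * (Yf x + Zf x).

Definition state_derive (X : R -> state) (s : R) (v : state) : Prop :=
  is_derive (fun r => x_n (X r)) s (x_n v) /\
  is_derive (fun r => x_q (X r)) s (x_q v) /\
  is_derive (fun r => x_a (X r)) s (x_a v) /\
  is_derive (fun r => x_b (X r)) s (x_b v) /\
  is_derive (fun r => x_al (X r)) s (x_al v) /\
  is_derive (fun r => x_A (X r)) s (x_A v) /\
  is_derive (fun r => x_B (X r)) s (x_B v) /\
  is_derive (fun r => x_J (X r)) s (x_J v) /\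
  is_derive (fun r => x_d (X r)) s (x_d v) /\
  is_derive (fun r => x_ph (X r)) s (x_ph v).

Ltac split_state_derive H :=
  destruct H as (Dn & Dq & Da & Db & Dal & DA & DB & DJ & Dd & Dph).

Ltac derive_side :=
  repeat split; trivial; try (eexists; eassumption).

Ltac derive_unique :=
  repeat match goal with
  | H : is_derive ?f ?s ?l |- context [Derive ?h ?s] =>
      replace (Derive h s) with l by (symmetry; apply is_derive_unique; exact H)
  end.

(* [auto_derive] does not see through record projections. *)
Ltac name_components X :=
  set (fn := fun r => x_n (X r)) in *; set (fq := fun r => x_q (X r)) in *;
  set (fal := fun r => x_al (X r)) in *; set (fA := fun r => x_A (X r)) in *;
  set (fB := fun r => x_B (X r)) in *; set (fJ := fun r => x_J (X r)) in *;
  set (fd := fun r => x_d (X r)) in *; set (fph := fun r => x_ph (X r)) in *.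

Lemma is_derive_Yf (X : R -> state) (s : R) (v : state) :
  state_derive X s v -> is_derive (fun r => Yf (X r)) s (dYf (X s) v).
Proof.
  intros H; split_state_derive H. name_components X.
  change (is_derive (fun r =>
    5 / 2 * (1 + fal r + fd r) + (fn r + 5 / 2) ^ 2 * fA r
    + (fn r + fq r + 5 / 2) ^ 2 * fB r + fq r ^ 2 * (fA r * fJ r * fph r)) s
    (dYf (St (fn s) (fq s) 0 0 (fal s) (fA s) (fB s) (fJ s) (fd s) (fph s)) v)).
  auto_derive; [derive_side|]. derive_unique. unfold dYf. simpl. ring.
Qed.

Lemma is_derive_Zf (X : R -> state) (s : R) (v : state) :
  state_derive X s v -> is_derive (fun r => Zf (X r)) s (dZf (X s) v).
Proof.
  intros H; split_state_derive H. name_components X.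
  change (is_derive (fun r =>
    3 / 2 * (1 + fal r + fd r) + (fn r ^ 2 + 3 * fn r + 15 / 4) * fA r
    + ((fn r + fq r) ^ 2 + 3 * (fn r + fq r) + 15 / 4) * fB r
    + fq r ^ 2 * (fA r * fJ r)) s
    (dZf (St (fn s) (fq s) 0 0 (fal s) (fA s) (fB s) (fJ s) (fd s) (fph s)) v)).
  auto_derive; [derive_side|]. derive_unique. unfold dZf, Ef, Ef'. simpl. ring.
Qed.

Ltac positivity :=
  repeat match goal with
  | |- 0 < _ + _ => apply Rplus_lt_0_compat
  | |- 0 < _ * _ => apply Rmult_lt_0_compat
  | |- 0 < _ ^ _ => apply pow_lt
  | |- 0 < _ / _ => apply Rdiv_lt_0_compat
  end; lra.

Lemma degB_bounds (g : gas) (T a : R) :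
  positive_gas g -> 0 < a < 1 -> 0 < degB g T a < 1.
Proof.
  intros (_ & _ & HA & HB & _) Ha. unfold degB.
  set (e := exp _). assert (He : 0 < e) by apply exp_pos.
  assert (H1 : 0 < muA g * a * e) by (repeat apply Rmult_lt_0_compat; lra).
  assert (H2 : 0 < muB g * (1 - a)) by (apply Rmult_lt_0_compat; lra).
  split; [apply Rdiv_lt_0_compat; lra|].
  apply Rlt_div_l; lra.
Qed.

Lemma deg_bounds (g : gas) (T a : R) :
  positive_gas g -> 0 < a < 1 -> 0 < deg g T a < 1.
Proof.
  intros Hg Ha. pose proof (degB_bounds g T a Hg Ha).
  destruct Hg as (_ & _ & _ & _ & Hb & _). unfold deg. nra.
Qed.

Lemma deg_lower (g : gas) (T a : R) :
  positive_gas g -> 0 < a < 1 -> beta g * a < deg g T a.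
Proof.
  intros Hg Ha. pose proof (degB_bounds g T a Hg Ha).
  destruct Hg as (_ & _ & _ & _ & Hb & _). unfold deg. nra.
Qed.

Lemma state_at_positive (g : gas) (T a : R) :
  positive_gas g -> 0 < T -> 0 < a < 1 ->
  let x := state_at g T a in
  0 < x_n x /\ 0 < x_q x /\ 0 < x_al x /\ 0 < x_A x /\ 0 < x_B x /\
  0 < x_J x /\ 0 < x_d x /\ 0 < x_ph x.
Proof.
  intros Hg HT Ha x. pose proof (degB_bounds g T a Hg Ha). pose proof (deg_bounds g T a Hg Ha).
  destruct Hg as (_ & _ & _ & _ & Hb & HA & HAB).
  assert (0 < varA g a) by (unfold varA; positivity).
  assert (0 < varB g T a) by (unfold varB; positivity).
  unfold x; simpl.
  repeat split; try lra; try (apply Rdiv_lt_0_compat; lra); try (apply Rinv_0_lt_compat; lra).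
Qed.

(** The thermodynamic identities fail for independent coordinates; these are the relations that they
    use. *)
Lemma state_at_relations (g : gas) (T a : R) :
  positive_gas g -> 0 < a < 1 ->
  let x := state_at g T a in
  x_B x = x_al x * x_J x /\ x_A x = x_al x * (x_d x - x_J x) /\
  x_ph x = / (1 + x_al x).
Proof.
  intros Hg Ha x. pose proof (deg_bounds g T a Hg Ha). unfold x; simpl.
  repeat split; field; lra.
Qed.

Lemma Pf_Yf_Zf_positive (g : gas) (T a : R) :
  positive_gas g -> 0 < T -> 0 < a < 1 ->
  0 < Pf (state_at g T a) /\ 0 < Yf (state_at g T a) /\ 0 < Zf (state_at g T a).
Proof.
  intros Hg HT Ha. destruct (state_at_positive g T a Hg HT Ha)
    as (Hn & Hq & Hal & HA & HB & HJ & Hd & Hph).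
  set (x := state_at g T a) in *.
  assert (0 < x_n x + 5 / 2) by lra.
  assert (0 < x_n x + x_q x + 5 / 2) by lra.
  assert (0 < Ef (x_n x)) by (unfold Ef; nra).
  assert (0 < Ef (x_n x + x_q x)) by (unfold Ef; nra).
  unfold Pf, Yf, Zf; repeat split;
  positivity.
Qed.

(** * Derivatives along a curve in (T, a) *)

Section Curve.

Context (g : gas) (Hg : positive_gas g) (tau alpha : R -> R) (s t y : R).
Context (HT : 0 < tau s) (Ha : 0 < alpha s < 1).
Context (Dtau : is_derive tau s (tau s * t)).
Context (Dalpha : is_derive alpha s (alpha s * (1 - alpha s) * y)).

(** [degB] is logistic: logit degB = logit a + ln (muA/muB) - (TB - TA)/T, so its logit moves with
    velocity [y + q t], where q = (TB - TA)/T. *)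
Lemma is_derive_degB :
  is_derive (fun r => degB g (tau r) (alpha r)) s
    (degB g (tau s) (alpha s) * (1 - degB g (tau s) (alpha s))
     * (y + (TB g - TA g) / tau s * t)).
Proof.
  pose proof (degB_bounds g (tau s) (alpha s) Hg Ha) as Hb.
  destruct Hg as (_ & _ & HmA & HmB & _).
  set (e := fun r => exp (- (TB g - TA g) / tau r)).
  assert (De : is_derive e s (e s * ((TB g - TA g) / tau s * t))).
  { unfold e. auto_derive; [split; [eexists; eassumption|split; trivial; lra]|].
    derive_unique. unfold Rdiv. field. lra. }
  assert (He : 0 < e s) by apply exp_pos.
  assert (H1 : 0 < muA g * alpha s * e s) by (repeat apply Rmult_lt_0_compat; lra).
  assert (H2 : 0 < muB g * (1 - alpha s)) by (apply Rmult_lt_0_compat; lra).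
  change (is_derive (fun r => muA g * alpha r * e r
    / (muA g * alpha r * e r + muB g * (1 - alpha r))) s
    (muA g * alpha s * e s / (muA g * alpha s * e s + muB g * (1 - alpha s)) *
     (1 - muA g * alpha s * e s / (muA g * alpha s * e s + muB g * (1 - alpha s))) *
     (y + (TB g - TA g) / tau s * t))).
  clearbody e. clear Hb.
  auto_derive; [repeat split; trivial; try (eexists; eassumption); lra|].
  derive_unique. field. split; lra.
Qed.

Lemma is_derive_deg :
  is_derive (fun r => deg g (tau r) (alpha r)) s
    (x_al (velocity (state_at g (tau s) (alpha s)) t y)).
Proof.
  pose proof is_derive_degB as D. simpl. unfold varA, varB.
  set (b := fun r => degB g (tau r) (alpha r)) in *.
  change (is_derive (fun r => beta g * alpha r + (1 - beta g) * b r) s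
    ((beta g * (alpha s * (1 - alpha s)) + (1 - beta g) * (b s * (1 - b s))) * y
     + (TB g - TA g) / tau s * ((1 - beta g) * (b s * (1 - b s))) * t)).
  change (is_derive b s (b s * (1 - b s) * (y + (TB g - TA g) / tau s * t))) in D.
  auto_derive; [derive_side|]. derive_unique. ring.
Qed.

Lemma state_derive_curve :
  state_derive (fun r => state_at g (tau r) (alpha r)) s
    (velocity (state_at g (tau s) (alpha s)) t y).
Proof.
  pose proof is_derive_degB as D1. pose proof is_derive_deg as D2.
  pose proof (deg_bounds g (tau s) (alpha s) Hg Ha) as Hd.
  set (b := fun r => degB g (tau r) (alpha r)) in *.
  set (al := fun r => deg g (tau r) (alpha r)) in *.
  set (A := fun r => varA g (alpha r)).
  set (B := fun r => varB g (tau r) (alpha r)).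
  assert (DA : is_derive A s (A s * ((1 - 2 * alpha s) * y))).
  { unfold A, varA. auto_derive; [derive_side|]. derive_unique. ring. }
  assert (DB : is_derive B s (B s * ((1 - 2 * b s)
      * (y + (TB g - TA g) / tau s * t)))).
  { change (is_derive (fun r => (1 - beta g) * (b r * (1 - b r))) s
      ((1 - beta g) * (b s * (1 - b s)) * ((1 - 2 * b s)
      * (y + (TB g - TA g) / tau s * t)))).
    change (is_derive b s (b s * (1 - b s) * (y + (TB g - TA g) / tau s * t))) in D1.
    auto_derive; [derive_side|]. derive_unique. ring. }
  change (is_derive al s ((A s + B s) * y + (TB g - TA g) / tau s * B s * t)) in D2.
  change (0 < al s < 1) in Hd.
  unfold state_derive. cbn [x_n x_q x_a x_b x_al x_A x_B x_J x_d x_ph velocity state_at].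
  repeat match goal with |- _ /\ _ => split end; try assumption.
  - change (is_derive (fun r => TA g / tau r) s (- (TA g / tau s) * t)).
    auto_derive; [repeat split; [eexists; eassumption|lra]|]. derive_unique. field; lra.
  - change (is_derive (fun r => (TB g - TA g) / tau r) s (- ((TB g - TA g) / tau s) * t)).
    auto_derive; [repeat split; [eexists; eassumption|lra]|]. derive_unique. field; lra.
  - change (is_derive (fun r => B r / al r) s (B s / al s * ((1 - 2 * b s) *
      (y + (TB g - TA g) / tau s * t) - ((A s + B s) / al s * y
      + (TB g - TA g) / tau s * (B s / al s) * t)))).
    auto_derive; [repeat split; try (eexists; eassumption); lra|]. derive_unique. field; lra.
  - change (is_derive (fun r => (A r + B r) / al r) s
      (((A s + B s) / al s - B s / al s) * ((1 - 2 * alpha s) * y)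
       + B s / al s * ((1 - 2 * b s) * (y + (TB g - TA g) / tau s * t))
       - (A s + B s) / al s * ((A s + B s) / al s * y
       + (TB g - TA g) / tau s * (B s / al s) * t))).
    auto_derive; [repeat split; try (eexists; eassumption); lra|]. derive_unique. field; lra.
  - change (is_derive (fun r => / (1 + al r)) s (- (/ (1 + al s)) ^ 2 *
      ((A s + B s) * y + (TB g - TA g) / tau s * B s * t))).
    auto_derive; [repeat split; try (eexists; eassumption); lra|]. derive_unique. field; lra.
Qed.

End Curve.

Lemma continuous_Rplus (f h : R -> R) s :
  continuous f s -> continuous h s -> continuous (fun x => f x + h x) s.
Proof. exact (continuous_plus f h s). Qed.

Lemma continuous_Rminus (f h : R -> R) s :
  continuous f s -> continuous h s -> continuous (fun x => f x - h x) s.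
Proof. exact (continuous_minus f h s). Qed.

Lemma continuous_Rmult (f h : R -> R) s :
  continuous f s -> continuous h s -> continuous (fun x => f x * h x) s.
Proof. exact (continuous_mult f h s). Qed.

Lemma continuous_Rdiv (f h : R -> R) s :
  continuous f s -> continuous h s -> h s <> 0 -> continuous (fun x => f x / h x) s.
Proof.
  intros Hf Hh H0. apply continuous_Rmult; [exact Hf|]. apply continuous_Rinv_comp; assumption.
Qed.

Lemma continuous_Rpow2 (f : R -> R) s : continuous f s -> continuous (fun x => f x ^ 2) s.
Proof.
  intros H. apply (continuous_Rmult f (fun x => f x * 1)); [exact H|].
  apply continuous_Rmult; [exact H|apply continuous_const].
Qed.

Ltac continuity_side :=
  repeat lazymatch goal with
  | H : continuous ?f ?s |- continuous ?f ?s => exact H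
  | |- continuous (fun _ => ?c) _ => apply continuous_const
  | |- continuous (fun x => @?f x + @?h x) _ => apply (continuous_Rplus f h)
  | |- continuous (fun x => @?f x - @?h x) _ => apply (continuous_Rminus f h)
  | |- continuous (fun x => @?f x * @?h x) _ => apply (continuous_Rmult f h)
  | |- continuous (fun x => @?f x / @?h x) _ => apply (continuous_Rdiv f h)
  | |- continuous (fun x => - @?f x) _ => apply (continuous_opp f)
  | |- continuous (fun x => / @?f x) _ => apply (continuous_Rinv_comp f)
  | |- continuous (fun x => @?f x ^ 2) _ => apply (continuous_Rpow2 f)
  | |- continuous (fun x => exp (@?f x)) _ => apply (continuous_exp_comp f)
  end.

Lemma continuous_degB (g : gas) (tau alpha : R -> R) (s : R) :
  positive_gas g -> 0 < tau s -> 0 < alpha s < 1 ->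
  continuous tau s -> continuous alpha s ->
  continuous (fun r => degB g (tau r) (alpha r)) s.
Proof.
  intros Hg HT Ha Ct Ca. destruct Hg as (_ & _ & HmA & HmB & _).
  unfold degB. continuity_side; try lra.
  set (e := exp (- (TB g - TA g) / tau s)). assert (He : 0 < e) by apply exp_pos.
  assert (H1 : 0 < muA g * alpha s * e) by (repeat apply Rmult_lt_0_compat; lra).
  assert (H2 : 0 < muB g * (1 - alpha s)) by (apply Rmult_lt_0_compat; lra).
  lra.
Qed.

(* [d ln p = - K d logit a + G d ln T] *)
Definition Kf (x : state) : R := 1 + x_d x * x_ph x.
Definition Gf (x : state) : R := x_n x + 5 / 2 - x_q x * x_J x * x_ph x.

Lemma Kf_positive (g : gas) (T a : R) :
  positive_gas g -> 0 < T -> 0 < a < 1 -> 0 < Kf (state_at g T a).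
Proof.
  intros Hg HT Ha. destruct (state_at_positive g T a Hg HT Ha)
    as (Hn & Hq & Hal & HA & HB & HJ & Hd & Hph).
  unfold Kf. positivity.
Qed.

(** Supplies the continuity of [Phia] along selected points in [is_derive_implicit]; there [alpha]
    is a choice of intermediate points, so nothing beyond its continuity may be assumed. *)
Lemma continuous_Kf (g : gas) (tau alpha : R -> R) (s : R) :
  positive_gas g -> 0 < tau s -> 0 < alpha s < 1 ->
  continuous tau s -> continuous alpha s ->
  continuous (fun r => Kf (state_at g (tau r) (alpha r))) s.
Proof.
  intros Hg HT Ha Ct Ca. pose proof (continuous_degB g tau alpha s Hg HT Ha Ct Ca) as Cb.
  pose proof (deg_bounds g (tau s) (alpha s) Hg Ha) as Hd.
  assert (Cd : continuous (fun r => deg g (tau r) (alpha r)) s).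
  { unfold deg. continuity_side. }
  unfold Kf, state_at, varA, varB; simpl. continuity_side; lra.
Qed.

(** * Inversion of the pressure law *)

Definition ln_pressure (g : gas) (T a : R) : R :=
  ln (1 - a) - ln a + ln (1 + deg g T a) - ln (deg g T a)
  + 5 / 2 * ln T - TA g / T - ln (muA g).

Lemma pressure_exp (g : gas) (T a : R) :
  positive_gas g -> 0 < T -> 0 < a < 1 -> pressure g T a = exp (ln_pressure g T a).
Proof.
  intros Hg HT Ha. pose proof (deg_bounds g T a Hg Ha).
  destruct Hg as (_ & _ & HmA & _).
  unfold ln_pressure, pressure, Rminus, Rpower.
  rewrite !exp_plus, !exp_Ropp, !exp_ln by lra.
  replace (exp (- TA g / T)) with (/ exp (TA g / T)).
  2:{ rewrite <- exp_Ropp. f_equal. field. lra. }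
  field. repeat split; try lra. apply Rgt_not_eq, exp_pos.
Qed.

Lemma is_derive_ln_pressure (g : gas) (tau alpha : R -> R) (s t y : R) :
  positive_gas g -> 0 < tau s -> 0 < alpha s < 1 ->
  is_derive tau s (tau s * t) ->
  is_derive alpha s (alpha s * (1 - alpha s) * y) ->
  is_derive (fun r => ln_pressure g (tau r) (alpha r)) s
    (Gf (state_at g (tau s) (alpha s)) * t - Kf (state_at g (tau s) (alpha s)) * y).
Proof.
  intros Hg HT Ha Dt Da.
  pose proof (is_derive_deg g Hg tau alpha s t y HT Ha Dt Da) as D.
  pose proof (deg_bounds g (tau s) (alpha s) Hg Ha) as Hd.
  unfold Gf, Kf. simpl in *.
  set (A := varA g (alpha s)) in *. set (B := varB g (tau s) (alpha s)) in *.
  set (al := fun r => deg g (tau r) (alpha r)) in *.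
  change (is_derive (fun r => ln (1 - alpha r) - ln (alpha r) + ln (1 + al r) - ln (al r)
    + 5 / 2 * ln (tau r) - TA g / tau r - ln (muA g)) s
    ((TA g / tau s + 5 / 2 - (TB g - TA g) / tau s * (B / al s) * / (1 + al s)) * t
     - (1 + (A + B) / al s * / (1 + al s)) * y)).
  change (0 < al s < 1) in Hd.
  auto_derive; [repeat split; try (eexists; eassumption); lra|]. derive_unique. field.
  repeat split; lra.
Qed.

(** At fixed T the derivative in a is - K / (a (1 - a)), and K > 0. *)
Lemma ln_pressure_decreasing (g : gas) (T a1 a2 : R) :
  positive_gas g -> 0 < T -> 0 < a1 -> a1 < a2 -> a2 < 1 ->
  ln_pressure g T a2 < ln_pressure g T a1.
Proof.
  intros Hg HT H1 H12 H2.
  apply (strictly_decreasing (ln_pressure g T)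
    (fun a => - (Kf (state_at g T a) / (a * (1 - a)))) 0 1); try assumption.
  - intros a Ha.
    pose proof (is_derive_ln_pressure g (fun _ => T) (fun a => a) a 0 (/ (a * (1 - a))) Hg HT Ha)
      as D.
    assert (0 < a * (1 - a)) by nra.
    replace (- (Kf (state_at g T a) / (a * (1 - a)))) with
      (Gf (state_at g T a) * 0 - Kf (state_at g T a) * / (a * (1 - a))) by (field; lra).
    apply D.
    + rewrite Rmult_0_r. apply (is_derive_const T a).
    + replace (a * (1 - a) * / (a * (1 - a))) with 1 by (field; lra).
      apply (is_derive_id a).
  - intros a Ha. pose proof (Kf_positive g T a Hg HT Ha).
    assert (0 < a * (1 - a)) by nra.
    pose proof (Rdiv_lt_0_compat _ _ H H0). lra.
Qed.

Lemma pressure_surjective (g : gas) (T p : R) :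
  positive_gas g -> 0 < T -> 0 < p -> exists a, 0 < a < 1 /\ pressure g T a = p.
Proof.
  intros Hg HT Hp.
  pose proof Hg as (_ & _ & HmA & _ & Hb & _).
  set (C := Rpower T (5 / 2) * exp (- TA g / T) / muA g).
  assert (HC : 0 < C).
  { unfold C, Rpower. apply Rdiv_lt_0_compat; [|lra]. apply Rmult_lt_0_compat; apply exp_pos. }
  (* With a = 1/(1 + w) the factor (1 - a)/a is just w, which makes it easy to place p between two
     values of the pressure. *)
  assert (HP : forall w, 0 < w -> 0 < / (1 + w) < 1 /\
     pressure g T (/ (1 + w)) = w * (1 + / deg g T (/ (1 + w))) * C).
  { intros w Hw. assert (Ha : 0 < / (1 + w) < 1).
    { split; [apply Rinv_0_lt_compat; lra|]. rewrite <- Rinv_1. apply Rinv_lt_contravar; lra. }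
    split; [exact Ha|]. pose proof (deg_bounds g T _ Hg Ha). unfold pressure, C.
    set (D := deg g T (/ (1 + w))) in *. field. repeat split; lra. }
  (* At [w1] the factor 1 + 1/deg > 1 pushes the pressure above p. *)
  set (w1 := p / C). assert (Hw1 : 0 < w1) by (apply Rdiv_lt_0_compat; lra).
  (* For w <= 1 one has a >= 1/2, so deg >= beta/2 and 1 + 1/deg <= c; then w <= p/(C c) brings the
     pressure down to at most p. *)
  set (c := 1 + 2 / beta g).
  assert (Hc : 1 < c).
  { unfold c. pose proof (Rdiv_lt_0_compat 2 (beta g)). lra. }
  set (w2 := Rmin 1 (p / (C * c))).
  assert (Hw2 : 0 < w2).
  { unfold w2. apply Rmin_pos; [lra|]. apply Rdiv_lt_0_compat; [lra|]. apply Rmult_lt_0_compat; lra. }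
  destruct (HP w1 Hw1) as [Ha1 HP1]. destruct (HP w2 Hw2) as [Ha2 HP2].
  pose proof (deg_bounds g T _ Hg Ha1) as Hd1. pose proof (deg_bounds g T _ Hg Ha2) as Hd2.
  pose proof (deg_lower g T _ Hg Ha2) as Hl2.
  set (a1 := / (1 + w1)) in *. set (a2 := / (1 + w2)) in *.
  assert (Hp1 : p < pressure g T a1).
  { rewrite HP1. replace p with (w1 * 1 * C) at 1 by (unfold w1; field; lra).
    apply Rmult_lt_compat_r; [exact HC|]. apply Rmult_lt_compat_l; [exact Hw1|].
    pose proof (Rinv_0_lt_compat (deg g T a1)). lra. }
  assert (Hp2 : pressure g T a2 <= p).
  { rewrite HP2. replace p with (p / (C * c) * c * C) by (field; split; lra).
    apply Rmult_le_compat_r; [lra|].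
    apply Rmult_le_compat; [lra| |unfold w2; apply Rmin_r|].
    - pose proof (Rinv_0_lt_compat (deg g T a2)). lra.
    - unfold c. apply Rplus_le_compat_l.
      assert (/ 2 <= a2).
      { unfold a2. apply Rinv_le_contravar; [lra|]. pose proof (Rmin_l 1 (p / (C * c))).
        unfold w2. lra. }
      apply Rle_trans with (/ (beta g / 2)).
      + apply Rinv_le_contravar; nra.
      + right. field. lra. }
  rewrite pressure_exp in Hp1, Hp2 by (assumption || lra).
  assert (Hlt : a1 < a2).
  { destruct (Rlt_le_dec a1 a2) as [|[H|H]]; [assumption| |].
    - pose proof (ln_pressure_decreasing g T a2 a1 Hg HT (proj1 Ha2) H (proj2 Ha1)) as H'.
      apply exp_increasing in H'. lra.
    - rewrite H in Hp2. lra. }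
  assert (Hl1 : ln p < ln_pressure g T a1).
  { apply exp_lt_inv. rewrite exp_ln; lra. }
  destruct Hp2 as [Hp2|Hp2].
  2:{ exists a2. split; [lra|]. rewrite pressure_exp by (assumption || lra). exact Hp2. }
  assert (Hl2' : ln_pressure g T a2 < ln p).
  { apply exp_lt_inv. rewrite exp_ln; lra. }
  destruct (Ranalysis5.IVT_interv (fun x => ln p - ln_pressure g T x) a1 a2) as [z [Hz1 Hz2]];
    [|lra|lra|lra|].
  - intros z Hz. apply continuity_pt_minus; [apply continuity_pt_const; intros ? ?; reflexivity|].
    apply continuity_pt_filterlim. apply (ex_derive_continuous (ln_pressure g T)).
    assert (Hz01 : 0 < z < 1) by lra. assert (0 < z * (1 - z)) by nra.
    eexists. apply (is_derive_ln_pressure g (fun _ => T) (fun a => a) z 0 (/ (z * (1 - z))) Hg HT Hz01).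
    + rewrite Rmult_0_r. apply (is_derive_const T z).
    + replace (z * (1 - z) * / (z * (1 - z))) with 1 by (field; lra). apply (is_derive_id z).
  - exists z. split; [lra|]. rewrite pressure_exp by (assumption || lra).
    replace (ln_pressure g T z) with (ln p) by lra. apply exp_ln, Hp.
Qed.

Lemma degA_spec (g : gas) (p T : R) :
  positive_gas g -> 0 < p -> 0 < T ->
  0 < degA g p T < 1 /\ pressure g T (degA g p T) = p.
Proof.
  intros Hg Hp HT. unfold degA. apply epsilon_spec.
  apply pressure_surjective; assumption.
Qed.

Lemma pressure_positive (g : gas) (T a : R) :
  positive_gas g -> 0 < T -> 0 < a < 1 -> 0 < pressure g T a.
Proof. intros; rewrite pressure_exp by assumption; apply exp_pos. Qed.

Lemma degA_pressure (g : gas) (T a : R) :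
  positive_gas g -> 0 < T -> 0 < a < 1 -> degA g (pressure g T a) T = a.
Proof.
  intros Hg HT Ha.
  destruct (degA_spec g (pressure g T a) T Hg (pressure_positive g T a Hg HT Ha) HT) as [H1 H2].
  rewrite !pressure_exp in H2 by assumption. apply exp_inv in H2.
  destruct (Rtotal_order (degA g (exp (ln_pressure g T a)) T) a) as [H|[H|H]];
    rewrite !pressure_exp in * by assumption; try assumption.
  - pose proof (ln_pressure_decreasing g T _ _ Hg HT (proj1 H1) H (proj2 Ha)). lra.
  - pose proof (ln_pressure_decreasing g T _ _ Hg HT (proj1 Ha) H (proj2 H1)). lra.
Qed.

(** With l = d ln p and t = d ln T, the relation l = G t - K y solved for y gives the velocity of
    logit a. Arbitrary curves are allowed so that one statement serves both partial derivatives. *)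
Lemma is_derive_degA (g : gas) (pi tau : R -> R) (s l t : R) :
  positive_gas g -> 0 < pi s -> 0 < tau s ->
  is_derive pi s (pi s * l) -> is_derive tau s (tau s * t) ->
  let a := degA g (pi s) (tau s) in
  is_derive (fun r => degA g (pi r) (tau r)) s
    (a * (1 - a) * ((Gf (state_at g (tau s) a) * t - l) / Kf (state_at g (tau s) a))).
Proof.
  intros Hg Hp HT Dp Dt a.
  assert (Cp : continuous pi s) by (apply (ex_derive_continuous pi); eexists; eassumption).
  assert (Ct : continuous tau s) by (apply (ex_derive_continuous tau); eexists; eassumption).
  assert (Lp : locally s (fun r => 0 < pi r)).
  { apply (Cp (fun y => 0 < y)). apply (open_gt 0). exact Hp. }
  assert (Lt : locally s (fun r => 0 < tau r)).
  { apply (Ct (fun y => 0 < y)). apply (open_gt 0). exact HT. }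
  destruct (degA_spec g (pi s) (tau s) Hg Hp HT) as [Ha Hpa]. fold a in Ha, Hpa.
  assert (Haa : 0 < a * (1 - a)) by nra.
  pose proof (Kf_positive g (tau s) a Hg HT Ha) as HK.
  pose proof (is_derive_implicit
    (fun r x => ln_pressure g (tau r) x - ln (pi r))
    (fun r x => - (Kf (state_at g (tau r) x) / (x * (1 - x))))
    (fun r => degA g (pi r) (tau r)) 0 1 s
    (Gf (state_at g (tau s) a) * t - l) 0) as H.
  cbv beta in H. fold a in H.
  replace (a * (1 - a) * ((Gf (state_at g (tau s) a) * t - l) / Kf (state_at g (tau s) a)))
    with (- (Gf (state_at g (tau s) a) * t - l) / - (Kf (state_at g (tau s) a) / (a * (1 - a))))
    by (field; lra).
  apply H; clear H.
  - generalize (filter_and _ _ Lp Lt). apply filter_imp. intros r [H1 H2].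
    destruct (degA_spec g (pi r) (tau r) Hg H1 H2) as [H3 H4]. split; [exact H3|].
    rewrite pressure_exp in H4 by assumption. rewrite <- H4 at 2. rewrite ln_exp. ring.
  - revert Lt. apply filter_imp. intros r Hr x Hx.
    assert (Hxx : 0 < x * (1 - x)) by nra.
    pose proof (Kf_positive g (tau r) x Hg Hr Hx) as HKx. split.
    + pose proof (is_derive_ln_pressure g (fun _ => tau r) (fun x => x) x 0 (/ (x * (1 - x))) Hg Hr Hx)
      as D. cbv beta in D.
      replace (- (Kf (state_at g (tau r) x) / (x * (1 - x)))) with
        (minus (Gf (state_at g (tau r) x) * 0 - Kf (state_at g (tau r) x) * / (x * (1 - x))) zero)
        by (unfold minus, plus, opp, zero; simpl; field; lra).
      apply (is_derive_minus (ln_pressure g (tau r)) (fun _ => ln (pi r))).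
      * apply D.
        -- rewrite Rmult_0_r. apply (is_derive_const (tau r) x).
        -- replace (x * (1 - x) * / (x * (1 - x))) with 1 by (field; lra). apply (is_derive_id x).
      * apply (is_derive_const (ln (pi r)) x).
    + pose proof (Rdiv_lt_0_compat _ _ HKx Hxx). lra.
  - pose proof (is_derive_ln_pressure g tau (fun _ => a) s t 0 Hg HT Ha Dt) as D. cbv beta in D.
    rewrite Rmult_0_r in D. specialize (D (is_derive_const a s)).
    assert (Dl : is_derive (fun r => ln (pi r)) s l).
    { auto_derive; [split; [eexists; eassumption|split; [exact Hp|trivial]]|].
      derive_unique. field. lra. }
    replace (Gf (state_at g (tau s) a) * t - l)
      with (minus (Gf (state_at g (tau s) a) * t - Kf (state_at g (tau s) a) * 0) l)
      by (unfold minus, plus, opp; simpl; ring).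
    exact (is_derive_minus _ _ _ _ _ D Dl).
  - intros x Hx.
    pose proof (is_derive_ln_pressure g tau (fun _ => x) s t 0 Hg HT Hx Dt) as D. cbv beta in D.
    rewrite Rmult_0_r in D. specialize (D (is_derive_const x s)).
    apply continuous_Rminus.
    + apply (ex_derive_continuous (fun r => ln_pressure g (tau r) x)). eexists; exact D.
    + apply (ex_derive_continuous (fun r => ln (pi r))). auto_derive.
      split; [eexists; eassumption|split; [exact Hp|trivial]].
  - intros xi H0 Cx.
    assert (Hx : 0 < xi s < 1) by (rewrite H0; exact Ha).
    pose proof (continuous_Kf g tau xi s Hg HT Hx Ct Cx) as CK.
    apply (continuous_opp (fun r => Kf (state_at g (tau r) (xi r)) / (xi r * (1 - xi r)))).
    continuity_side. nra.
Qed.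

(** * The inflection equation *)

(** In order: d ln p = Y in the direction (P, N); the determinant v_p eta_T - v_T eta_p up to a
    factor; the T-derivative of the enthalpy at fixed p; its p-derivative at fixed T with v removed;
    d ln v = - Z in the direction (P, N). *)
Lemma coherent_identities (x : state) :
  0 < x_al x ->
  x_B x = x_al x * x_J x /\ x_A x = x_al x * (x_d x - x_J x) /\
  x_ph x = / (1 + x_al x) ->
  Pf x * Gf x - Yf x = Kf x * Nf x /\
  Yf x * (Kf x + (x_A x + x_B x) * x_ph x) - x_ph x * Pf x ^ 2 = Kf x * Zf x /\
  (5 / 2 * (1 + x_al x) + (x_n x + x_q x + 5 / 2) * (x_q x * x_B x)) * Kf x
    + ((x_n x + 5 / 2) * (x_A x + x_B x) + x_q x * x_B x) * Gf x = Yf x /\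
  Pf x = Kf x * (1 + x_al x) + (x_n x + 5 / 2) * (x_A x + x_B x) + x_q x * x_B x /\
  Yf x - Zf x = Pf x + x_ph x * ((x_A x + x_B x) * Nf x + x_q x * x_B x * Pf x).
Proof.
  destruct x as [n q a b al A B J d ph]. simpl. intros Hal (HB & HA & Hph).
  unfold Pf, Gf, Yf, Kf, Nf, Zf, Ef; simpl. subst B A ph.
  repeat split; field; lra.
Qed.

Section StateCurve.

Context (g : gas) (Hg : positive_gas g) (pi tau : R -> R) (s l t : R).
Context (Hp : 0 < pi s) (HT : 0 < tau s).
Context (Dpi : is_derive pi s (pi s * l)) (Dtau : is_derive tau s (tau s * t)).

Let a := degA g (pi s) (tau s).
Let x := state_at g (tau s) a.
Let y := (Gf x * t - l) / Kf x.

Lemma state_derive_degA :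
  state_derive (fun r => state_at g (tau r) (degA g (pi r) (tau r))) s (velocity x t y).
Proof.
  destruct (degA_spec g (pi s) (tau s) Hg Hp HT) as [Ha _].
  exact (state_derive_curve g Hg tau (fun r => degA g (pi r) (tau r)) s t y HT Ha Dtau
    (is_derive_degA g pi tau s l t Hg Hp HT Dpi Dtau)).
Qed.

Lemma is_derive_volume :
  is_derive (fun r => volume g (pi r) (tau r)) s
    (Rgas g * tau s / (Mgas g * pi s)
     * ((1 + x_al x) * (t - l) + x_al (velocity x t y))).
Proof.
  pose proof (proj1 (proj2 (proj2 (proj2 (proj2 state_derive_degA))))) as D.
  pose proof Hg as (HR & HM & _).
  set (al := fun r => x_al (state_at g (tau r) (degA g (pi r) (tau r)))) in D.
  change (is_derive (fun r => Rgas g * tau r / (Mgas g * pi r) * (1 + al r)) s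
   (Rgas g * tau s / (Mgas g * pi s)
     * ((1 + al s) * (t - l) + x_al (velocity x t y)))).
  assert (0 < Mgas g * pi s) by (apply Rmult_lt_0_compat; lra).
  auto_derive; [repeat split; try (eexists; eassumption); lra|]. derive_unique. field. lra.
Qed.

Lemma is_derive_enthalpy :
  is_derive (fun r => enthalpy g (pi r) (tau r)) s
    (Rgas g * tau s / Mgas g
     * ((5 / 2 * (1 + x_al x) + (x_n x + x_q x + 5 / 2) * (x_q x * x_B x)) * t
        + ((x_n x + 5 / 2) * (x_A x + x_B x) + x_q x * x_B x) * y)).
Proof.
  pose proof state_derive_degA as (_ & _ & Da & Db & Dal & _).
  pose proof Hg as (HR & HM & _).
  set (al := fun r => x_al (state_at g (tau r) (degA g (pi r) (tau r)))) in *.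
  set (fa := fun r => x_a (state_at g (tau r) (degA g (pi r) (tau r)))) in *.
  set (fb := fun r => x_b (state_at g (tau r) (degA g (pi r) (tau r)))) in *.
  change (is_derive (fun r => 5 * Rgas g * tau r / (2 * Mgas g) * (1 + al r)
    + Rgas g / Mgas g * (beta g * TA g * fa r + (1 - beta g) * TB g * fb r)) s
    (Rgas g * tau s / Mgas g
     * ((5 / 2 * (1 + al s) + (x_n x + x_q x + 5 / 2) * (x_q x * x_B x)) * t
        + ((x_n x + 5 / 2) * (x_A x + x_B x) + x_q x * x_B x) * y))).
  auto_derive; [repeat split; try (eexists; eassumption); lra|]. derive_unique.
  unfold velocity, x, state_at, varA, varB.
  cbn [x_n x_q x_a x_b x_al x_A x_B x_J x_d x_ph].
  field. lra.
Qed.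

End StateCurve.

(** * Partial derivatives in (p, T) and the characteristic speed *)

Lemma is_derive_ln_id (p : R) : 0 < p -> is_derive (fun r : R => r) p (p * / p).
Proof.
  intros Hp. replace (p * / p) with 1 by (field; lra). apply (is_derive_id p).
Qed.

Lemma is_derive_ln_const (c p : R) : is_derive (fun _ : R => c) p (c * 0).
Proof. rewrite Rmult_0_r. apply (is_derive_const c p). Qed.

Section Derivatives.

Context (g : gas) (S : R -> R -> R) (Hg : positive_gas g) (HS : is_entropy g S).
Context (p T : R) (Hp : 0 < p) (HT : 0 < T).

Let a := degA g p T.
Let x := state_at g T a.

Lemma degA_state_positive :
  (0 < a < 1) /\
  (0 < x_n x /\ 0 < x_q x /\ 0 < x_al x /\ 0 < x_A x /\ 0 < x_B x /\
  0 < x_J x /\ 0 < x_d x /\ 0 < x_ph x) /\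
  (0 < Pf x /\ 0 < Yf x /\ 0 < Zf x) /\ 0 < Kf x /\
  x_ph x = / (1 + x_al x).
Proof.
  destruct (degA_spec g p T Hg Hp HT) as [Ha _]. fold a in Ha.
  split; [exact Ha|]. split; [exact (state_at_positive g T a Hg HT Ha)|].
  split; [exact (Pf_Yf_Zf_positive g T a Hg HT Ha)|].
  split; [exact (Kf_positive g T a Hg HT Ha)|reflexivity].
Qed.

Lemma degA_state_identities :
  Pf x * Gf x - Yf x = Kf x * Nf x /\
  Yf x * (Kf x + (x_A x + x_B x) * x_ph x) - x_ph x * Pf x ^ 2 = Kf x * Zf x /\
  (5 / 2 * (1 + x_al x) + (x_n x + x_q x + 5 / 2) * (x_q x * x_B x)) * Kf x
    + ((x_n x + 5 / 2) * (x_A x + x_B x) + x_q x * x_B x) * Gf x = Yf x /\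
  Pf x = Kf x * (1 + x_al x) + (x_n x + 5 / 2) * (x_A x + x_B x) + x_q x * x_B x /\
  Yf x - Zf x = Pf x + x_ph x * ((x_A x + x_B x) * Nf x + x_q x * x_B x * Pf x).
Proof.
  destruct degA_state_positive as (Ha & (_ & _ & Hal & _) & _).
  apply coherent_identities; [exact Hal|]. exact (state_at_relations g T a Hg Ha).
Qed.

Lemma volume_state : volume g p T = Rgas g * T / (Mgas g * p) * (1 + x_al x).
Proof. reflexivity. Qed.

Lemma d_p_volume :
  d_p (volume g) p T = - (Rgas g * T / (Mgas g * p ^ 2))
    * ((1 + x_al x) + (x_A x + x_B x) / Kf x).
Proof.
  destruct degA_state_positive as (_ & _ & _ & HK & _). pose proof Hg as (HR & HM & _).
  apply is_derive_unique.
  pose proof (is_derive_volume g Hg (fun r => r) (fun _ => T) p (/ p) 0 Hp HT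
    (is_derive_ln_id p Hp) (is_derive_ln_const T p)) as D.
  cbv beta in D. fold a x in D.
  match type of D with is_derive _ _ ?v => match goal with |- is_derive _ _ ?w =>
    replace w with v; [exact D|] end end.
  unfold velocity; cbn [x_al]. field. repeat split; lra.
Qed.

Lemma d_T_volume :
  d_T (volume g) p T = Rgas g / (Mgas g * p) * Pf x / Kf x.
Proof.
  destruct degA_state_positive as (_ & (_ & _ & Hal & _) & (HP & HY & HZ) & HK & Hph). pose proof Hg as (HR & HM & _).
  destruct degA_state_identities as (I1 & I2 & I3 & I4 & I5).
  apply is_derive_unique.
  pose proof (is_derive_volume g Hg (fun _ => p) (fun r => r) T 0 (/ T) Hp HT
    (is_derive_ln_const p T) (is_derive_ln_id T HT)) as D.
  cbv beta in D. fold a x in D.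
  match type of D with is_derive _ _ ?v => match goal with |- is_derive _ _ ?w =>
    replace w with v; [exact D|] end end.
  unfold velocity; cbn [x_al].
  transitivity (Rgas g / (Mgas g * p) * (((1 + x_al x) + x_q x * x_B x) * Kf x
    + (x_A x + x_B x) * Gf x) / Kf x).
  - field. repeat split; lra.
  - f_equal. f_equal. revert I1.
    pose proof (state_at_relations g T a Hg) as Hr. destruct degA_state_positive as (Ha & _).
    specialize (Hr Ha). cbv zeta in Hr. fold x in Hr. destruct Hr as (HB & HA & _).
    rewrite HB, HA. unfold Gf, Pf, Kf. rewrite HB, HA, Hph. intros _. field. lra.
Qed.

Lemma d_T_eta : d_T (eta g S) p T = Yf x / (T * Kf x).
Proof.
  destruct degA_state_positive as (_ & _ & _ & HK & _). pose proof Hg as (HR & HM & _).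
  destruct degA_state_identities as (I1 & I2 & I3 & I4 & I5).
  destruct (HS p T Hp HT) as (hp & hT & Sp & ST & Dh & DS & _ & HT').
  apply differentiable_pt_lim_unique in Dh. apply differentiable_pt_lim_unique in DS.
  destruct Dh as [_ Dh]. destruct DS as [_ DS].
  pose proof (is_derive_enthalpy g Hg (fun _ => p) (fun r => r) T 0 (/ T) Hp HT
    (is_derive_ln_const p T) (is_derive_ln_id T HT)) as D.
  cbv beta in D. fold a x in D. pose proof (eq_trans (eq_sym Dh) (is_derive_unique _ _ _ D)) as D'.
  replace (d_T (eta g S) p T) with (Mgas g / Rgas g * ST)
    by (rewrite <- DS; symmetry; apply Derive_scal).
  replace ST with (hT / T) by (rewrite HT'; field; lra). rewrite D', <- I3.
  field. repeat split; lra.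
Qed.

(** Compared with [d_T_volume] this is the Maxwell relation S_p = - v_T; here it comes from the
    enthalpy and the fourth identity. *)
Lemma d_p_eta : d_p (eta g S) p T = - Pf x / (p * Kf x).
Proof.
  destruct degA_state_positive as (_ & _ & _ & HK & _). pose proof Hg as (HR & HM & _).
  destruct degA_state_identities as (I1 & I2 & I3 & I4 & I5).
  destruct (HS p T Hp HT) as (hp & hT & Sp & ST & Dh & DS & Hp' & _).
  apply differentiable_pt_lim_unique in Dh. apply differentiable_pt_lim_unique in DS.
  destruct Dh as [Dh _]. destruct DS as [DS _].
  pose proof (is_derive_enthalpy g Hg (fun r => r) (fun _ => T) p (/ p) 0 Hp HT
    (is_derive_ln_id p Hp) (is_derive_ln_const T p)) as D.
  cbv beta in D. fold a x in D. pose proof (eq_trans (eq_sym Dh) (is_derive_unique _ _ _ D)) as D'.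
  replace (d_p (eta g S) p T) with (Mgas g / Rgas g * Sp)
    by (rewrite <- DS; symmetry; apply (Derive_scal (fun r => S r T))).
  replace Sp with ((hp - volume g p T) / T) by (rewrite Hp'; field; lra).
  rewrite D', volume_state, I4. field. repeat split; lra.
Qed.

Lemma lambda_state :
  lambda g S p T = sqrt (Mgas g / Rgas g * p ^ 2 * Yf x * x_ph x / (T * Zf x)).
Proof.
  destruct degA_state_positive as (_ & (_ & _ & Hal & _ & _ & _ & _ & Hph0) & (HP & HY & HZ) & HK & Hph).
  pose proof Hg as (HR & HM & _).
  destruct degA_state_identities as (I1 & I2 & I3 & I4 & I5).
  unfold lambda. rewrite d_T_eta, d_p_eta, d_p_volume, d_T_volume. f_equal.
  (* The second identity collapses the determinant under the root to a single product, which also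
     shows its sign. *)
  assert (Hden : Yf x * (Kf x * (1 + x_al x) + (x_A x + x_B x)) - Pf x ^ 2
    = Kf x * Zf x * (1 + x_al x)).
  { rewrite <- I2, Hph. field. lra. }
  assert (0 < Kf x * Zf x * (1 + x_al x)) by (positivity).
  replace (- (Rgas g * T / (Mgas g * p ^ 2)) *
    (1 + x_al x + (x_A x + x_B x) / Kf x) * (Yf x / (T * Kf x)) -
    Rgas g / (Mgas g * p) * Pf x / Kf x * (- Pf x / (p * Kf x)))
  with (- (Rgas g / (Mgas g * p ^ 2 * Kf x ^ 2) * (Kf x * Zf x * (1 + x_al x)))).
  - rewrite Hph. field. repeat split; lra.
  - rewrite <- Hden. field. repeat split; lra.
Qed.

End Derivatives.

(** The characteristic field is, in (p, T), [sgn k / (p Y)] times the isentropic direction. The sign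
    occurs again in the speed, so both families give the same value. *)
Lemma speed_derivative_state (g : gas) (S : R -> R -> R) (k : char_family) (p u T : R) :
  positive_gas g -> is_entropy g S -> 0 < p -> 0 < T ->
  let x := state_at g T (degA g p T) in
  speed_derivative g S k p u T
  = - lambda g S p T * Ff x / (2 * p * Yf x ^ 2 * Zf x).
Proof.
  intros Hg HS Hp HT x.
  destruct (degA_state_positive g Hg p T Hp HT)
    as (_ & (_ & _ & Hal & _ & _ & _ & _ & Hph0) & (HP & HY & HZ) & HK & Hph).
  destruct (degA_state_identities g Hg p T Hp HT) as (I1 & I2 & I3 & I4 & I5).
  fold x in Hal, Hph0, HP, HY, HZ, HK, Hph, I1, I2, I3, I4, I5.
  pose proof Hg as (HR & HM & _).
  set (Q := fun p T => let x := state_at g T (degA g p T) in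
    Mgas g / Rgas g * p ^ 2 * Yf x * x_ph x / (T * Zf x)).
  assert (HQ : 0 < Q p T) by (unfold Q; fold x; positivity).
  assert (Hlam : forall p T, 0 < p -> 0 < T -> lambda g S p T = sqrt (Q p T)).
  { intros; apply lambda_state; assumption. }
  (* Logarithmic derivative of [Q], the square of lambda, in a direction with d ln p = l, d ln T =
     t, d logit a = y. *)
  set (Ql := fun l t y : R => 2 * l - t + dYf x (velocity x t y) / Yf x
     - dZf x (velocity x t y) / Zf x + x_ph (velocity x t y) / x_ph x).
  assert (HD : forall pi tau s l t, pi s = p -> tau s = T ->
     is_derive pi s (p * l) -> is_derive tau s (T * t) ->
     is_derive (fun r => sqrt (Q (pi r) (tau r))) s
       (sqrt (Q p T) / 2 * Ql l t ((Gf x * t - l) / Kf x))).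
  { intros pi tau s l t Ep ET Dp Dt.
    assert (Hp' : 0 < pi s) by lra. assert (HT' : 0 < tau s) by lra.
    rewrite <- Ep in Dp. rewrite <- ET in Dt.
    pose proof (state_derive_degA g Hg pi tau s l t Hp' HT' Dp Dt) as DX.
    assert (Ex : state_at g (tau s) (degA g (pi s) (tau s)) = x) by (rewrite Ep, ET; reflexivity).
    rewrite Ex in DX.
    pose proof (is_derive_Yf _ _ _ DX) as DY. pose proof (is_derive_Zf _ _ _ DX) as DZ.
    pose proof (proj2 (proj2 (proj2 (proj2 (proj2 (proj2 (proj2 (proj2 (proj2 DX))))))))) as Dph.
    cbv beta in DY, DZ. rewrite Ex in DY, DZ.
    set (y := (Gf x * t - l) / Kf x) in *.
    set (fY := fun r => Yf (state_at g (tau r) (degA g (pi r) (tau r)))) in *.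
    set (fZ := fun r => Zf (state_at g (tau r) (degA g (pi r) (tau r)))) in *.
    set (fph := fun r => x_ph (state_at g (tau r) (degA g (pi r) (tau r)))) in *.
    assert (EY : fY s = Yf x) by (unfold fY; rewrite Ex; reflexivity).
    assert (EZ : fZ s = Zf x) by (unfold fZ; rewrite Ex; reflexivity).
    assert (Eph : fph s = x_ph x) by (unfold fph; rewrite Ex; reflexivity).
    set (R0 := fun r => Mgas g / Rgas g * pi r ^ 2 * fY r * fph r / (tau r * fZ r)).
    assert (ER : R0 s = Q p T).
    { unfold R0, Q. rewrite EY, EZ, Eph, Ep, ET. reflexivity. }
    assert (DR : is_derive R0 s (Q p T * Ql l t y)).
    { rewrite <- ER. unfold R0. clearbody fY fZ fph.
      assert (0 < tau s * fZ s) by (rewrite EZ; positivity).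
      auto_derive; [repeat split; try (eexists; eassumption); lra|]. derive_unique.
      unfold Ql. rewrite EY, EZ, Eph. field. repeat split; lra. }
    change (is_derive (fun r => sqrt (R0 r)) s (sqrt (Q p T) / 2 * Ql l t y)).
    clearbody R0. auto_derive; [repeat split; [eexists; eassumption|lra]|]. derive_unique.
    rewrite ER. rewrite <- (sqrt_sqrt (Q p T)) at 1 by lra.
    pose proof (sqrt_lt_R0 _ HQ). field. lra. }
  assert (DP : Derive (fun r => lambda g S r T) p
     = sqrt (Q p T) / 2 * Ql (/ p) 0 ((Gf x * 0 - / p) / Kf x)).
  { rewrite (Derive_ext_loc _ (fun r => sqrt (Q r T))).
    - apply is_derive_unique. apply (HD (fun r => r) (fun _ => T) p (/ p) 0); try reflexivity.
      + apply is_derive_ln_id, Hp.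
      + apply is_derive_ln_const.
    - apply (open_gt 0) in Hp. revert Hp. apply filter_imp. intros r Hr.
      apply Hlam; assumption. }
  assert (DT : Derive (fun r => lambda g S p r) T
     = sqrt (Q p T) / 2 * Ql 0 (/ T) ((Gf x * / T - 0) / Kf x)).
  { rewrite (Derive_ext_loc _ (fun r => sqrt (Q p r))).
    - apply is_derive_unique. apply (HD (fun _ => p) (fun r => r) T 0 (/ T)); try reflexivity.
      + apply is_derive_ln_const.
      + apply is_derive_ln_id, HT.
    - apply (open_gt 0) in HT. revert HT. apply filter_imp. intros r Hr.
      apply Hlam; assumption. }
  unfold speed_derivative, char_field, char_speed.
  apply (f_equal (Rmult (sgn k))) in DP, DT.
  rewrite <- (Derive_scal (fun r => lambda g S r T)) in DP.
  rewrite <- (Derive_scal (fun r => lambda g S p r)) in DT.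
  rewrite Derive_const, DP, DT, (d_p_eta g S Hg HS p T Hp HT),
    (d_T_eta g S Hg HS p T Hp HT), (Hlam p T Hp HT). fold x.
  assert (Hs : sgn k * sgn k = 1) by (destruct k; simpl; ring).
  pose proof (sqrt_lt_R0 _ HQ) as HL. set (L := sqrt (Q p T)) in *.
  transitivity (sgn k * sgn k * (L / 2) * (Ql (/ p) 0 ((Gf x * 0 - / p) / Kf x)
    + T * Pf x / (p * Yf x) * Ql 0 (/ T) ((Gf x * / T - 0) / Kf x))).
  { field. repeat split; lra. }
  rewrite Hs.
  (* Linearity merges the two partial derivatives into one directional derivative, whose direction
     turns out to be (Y, P, N) divided by p Y. *)
  assert (Hlin : forall c l t y l' t' y',
     Ql l t y + c * Ql l' t' y' = Ql (l + c * l') (t + c * t') (y + c * y')).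
  { intros. unfold Ql, dYf, dZf, velocity. cbn [x_n x_q x_a x_b x_al x_A x_B x_J x_d x_ph].
    field. repeat split; lra. }
  rewrite Hlin.
  replace (/ p + T * Pf x / (p * Yf x) * 0) with (/ (p * Yf x) * Yf x) by (field; lra).
  replace (0 + T * Pf x / (p * Yf x) * / T) with (/ (p * Yf x) * Pf x) by (field; lra).
  replace ((Gf x * 0 - / p) / Kf x + T * Pf x / (p * Yf x) * ((Gf x * / T - 0) / Kf x))
    with (/ (p * Yf x) * ((Pf x * Gf x - Yf x) / Kf x)) by (field; repeat split; lra).
  rewrite I1. replace (Kf x * Nf x / Kf x) with (Nf x) by (field; lra).
  assert (Hhom : forall c l t y, Ql (c * l) (c * t) (c * y) = c * Ql l t y).
  { intros. unfold Ql, dYf, dZf, velocity. cbn [x_n x_q x_a x_b x_al x_A x_B x_J x_d x_ph].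
    field. repeat split; lra. }
  rewrite Hhom. unfold Ff, isentropic, Ql.
  (* The fifth identity turns 2 Y - P + d ln ph into Y + Z, the sum that appears in the last term of
     [Ff]. *)
  replace (x_ph (velocity x (Pf x) (Nf x)) / x_ph x)
    with (- (Yf x - Zf x - Pf x)).
  2:{ rewrite I5. unfold velocity; cbn [x_ph]. field. lra. }
  field. repeat split; lra.
Qed.

(** The factor lambda / (2 p Y^2 Z) is positive, and the whole expression is free of u and of the
    family. *)
Lemma inflection_locus_iff (g : gas) (S : R -> R -> R) (k : char_family) (T a : R) :
  positive_gas g -> is_entropy g S -> 0 < T -> 0 < a < 1 ->
  (inflection_locus g S k T a <-> Ff (state_at g T a) = 0).
Proof.
  intros Hg HS HT Ha.
  pose proof (pressure_positive g T a Hg HT Ha) as Hp.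
  assert (E : forall u, speed_derivative g S k (pressure g T a) u T
    = - lambda g S (pressure g T a) T * Ff (state_at g T a)
      / (2 * pressure g T a * Yf (state_at g T a) ^ 2 * Zf (state_at g T a))).
  { intros u. rewrite speed_derivative_state by assumption. cbv zeta.
    rewrite degA_pressure by assumption. reflexivity. }
  assert (Hl : 0 < lambda g S (pressure g T a) T).
  { rewrite lambda_state by assumption. rewrite degA_pressure by assumption.
    apply sqrt_lt_R0.
    destruct (Pf_Yf_Zf_positive g T a Hg HT Ha) as (_ & HY & HZ).
    destruct (state_at_positive g T a Hg HT Ha) as (_ & _ & _ & _ & _ & _ & _ & Hph).
    destruct Hg as (HR & HM & _). positivity. }
  destruct (Pf_Yf_Zf_positive g T a Hg HT Ha) as (_ & HY & HZ).
  set (c := 2 * pressure g T a * Yf (state_at g T a) ^ 2 * Zf (state_at g T a)) in E.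
  assert (Hc : 0 < c) by (unfold c; positivity).
  unfold inflection_locus. split.
  - intros (_ & _ & H). specialize (H 0). rewrite E in H.
    set (F := Ff (state_at g T a)) in *. set (L := lambda g S (pressure g T a) T) in *.
    apply (f_equal (fun z => z * c / L)) in H.
    replace (- L * F / c * c / L) with (- F) in H by (field; lra).
    replace (0 * c / L) with 0 in H by (field; lra). lra.
  - intros H. repeat split; try lra. intros u. rewrite E, H. field. lra.
Qed.

(** * Polynomially bounded families and exponentially small perturbations *)

Ltac split_all := repeat match goal with |- _ /\ _ => split end.

Lemma at_right_lt (r c : R) : r < c -> at_right r (fun T => r < T < c).
Proof.
  intros H. exists (mkposreal (c - r) (proj2 (Rlt_0_minus _ _) H)). intros y Hy Hr.
  split; [exact Hr|]. apply Rabs_def2 in Hy. simpl in Hy. unfold minus, plus, opp in Hy.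
  simpl in Hy. lra.
Qed.

Section Moderate.

Context (dl : R).

(** Uniform in a, together with two a-derivatives. No constant accompanies the power of 1/T, since
    for small T a further power absorbs it; this keeps the closure properties free of constants. *)
Definition moderate (f : R -> R -> R) : Prop :=
  exists (f1 f2 : R -> R -> R) (k : nat), at_right 0 (fun T => forall a, 0 < a < dl ->
    is_derive (f T) a (f1 T a) /\ is_derive (f1 T) a (f2 T a) /\
    Rabs (f T a) <= (/ T) ^ k /\ Rabs (f1 T a) <= (/ T) ^ k /\ Rabs (f2 T a) <= (/ T) ^ k).

Lemma inv_pow_le (T : R) (j k : nat) : 0 < T < 1 / 2 -> (j <= k)%nat -> (/ T) ^ j <= (/ T) ^ k.
Proof.
  intros HT Hjk. apply Rle_pow; [|exact Hjk].
  rewrite <- Rinv_1. apply Rinv_le_contravar; lra.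
Qed.

Lemma inv_pow_ge1 (T : R) (k : nat) : 0 < T < 1 / 2 -> 1 <= (/ T) ^ k.
Proof. intros HT. exact (inv_pow_le T 0 k HT (Nat.le_0_l k)). Qed.

Lemma inv_ge2 (T : R) : 0 < T < 1 / 2 -> 2 <= / T.
Proof.
  intros HT. replace 2 with (/ (1 / 2)) by field. apply Rinv_le_contravar; lra.
Qed.

(** Two spare powers pay for the at most four summands in the second derivative of a product or an
    inverse. *)
Lemma inv_pow_SS (T : R) (k : nat) : 0 < T < 1 / 2 -> 4 * (/ T) ^ k <= (/ T) ^ S (S k).
Proof.
  intros HT. pose proof (inv_pow_ge1 T k HT). pose proof (inv_ge2 T HT).
  assert (4 <= / T * / T) by nra. simpl. rewrite <- Rmult_assoc.
  apply Rmult_le_compat_r; lra.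
Qed.

Lemma moderate_T (c : R -> R) (k : nat) :
  at_right 0 (fun T => Rabs (c T) <= (/ T) ^ k) -> moderate (fun T _ => c T).
Proof.
  intros H. exists (fun _ _ => 0), (fun _ _ => 0), k.
  generalize (filter_and _ _ H (at_right_lt 0 (1 / 2) ltac:(lra))).
  apply filter_imp. intros T [H1 HT] a Ha. pose proof (inv_pow_ge1 T k HT).
  rewrite Rabs_R0. split_all; try lra; apply (is_derive_const (V := R_NormedModule)).
Qed.

Lemma const_le_inv (c : R) : at_right 0 (fun T => Rabs c <= / T).
Proof.
  assert (Hc : 0 < / (Rabs c + 1)) by (apply Rinv_0_lt_compat; pose proof (Rabs_pos c); lra).
  generalize (at_right_lt 0 _ Hc). apply filter_imp. intros T HT.
  apply Rle_trans with (/ / (Rabs c + 1)).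
  - rewrite Rinv_inv. lra.
  - apply Rinv_le_contravar; lra.
Qed.

Lemma moderate_const (c : R) : moderate (fun _ _ => c).
Proof.
  apply (moderate_T (fun _ => c) 1). generalize (const_le_inv c).
  apply filter_imp. intros T H. rewrite pow_1. exact H.
Qed.

Lemma moderate_div_T (c : R) : moderate (fun T _ => c / T).
Proof.
  apply (moderate_T (fun T => c / T) 2).
  generalize (filter_and _ _ (const_le_inv c) (at_right_lt 0 1 ltac:(lra))).
  apply filter_imp. intros T [H HT]. unfold Rdiv. rewrite Rabs_mult.
  assert (0 < / T) by (apply Rinv_0_lt_compat; lra).
  rewrite (Rabs_right (/ T)) by lra. simpl. rewrite Rmult_1_r.
  apply Rmult_le_compat_r; lra.
Qed.

Lemma moderate_a : dl < 1 -> moderate (fun _ a => a).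
Proof.
  intros Hdl.
  exists (fun _ _ => 1), (fun _ _ => 0), 1%nat.
  generalize (at_right_lt 0 (1 / 2) ltac:(lra)). apply filter_imp. intros T HT a Ha.
  pose proof (inv_pow_ge1 T 1 HT). rewrite Rabs_R0, Rabs_R1, Rabs_right by lra.
  split_all; try lra; [apply (is_derive_id a)|apply (is_derive_const (V := R_NormedModule))].
Qed.

Lemma moderate_ext (f h : R -> R -> R) :
  (forall T a, f T a = h T a) -> moderate f -> moderate h.
Proof.
  intros He (f1 & f2 & k & H). exists f1, f2, k. revert H. apply filter_imp.
  intros T H a Ha. destruct (H a Ha) as (H1 & H2 & H3 & H4).
  split; [|split; [exact H2|rewrite <- He; tauto]].
  apply (is_derive_ext (f T)); [intros; apply He|exact H1].
Qed.

Lemma moderate_plus (f h : R -> R -> R) :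
  moderate f -> moderate h -> moderate (fun T a => f T a + h T a).
Proof.
  intros (f1 & f2 & k & Hf) (h1 & h2 & j & Hh).
  exists (fun T a => f1 T a + h1 T a), (fun T a => f2 T a + h2 T a), (S (k + j)).
  generalize (filter_and _ _ (filter_and _ _ Hf Hh) (at_right_lt 0 (1 / 2) ltac:(lra))).
  apply filter_imp. intros T [[Ff Fh] HT] a Ha.
  destruct (Ff a Ha) as (H1 & H2 & H3 & H4 & H5). destruct (Fh a Ha) as (G1 & G2 & G3 & G4 & G5).
  pose proof (inv_pow_le T k (k + j) HT ltac:(lia)). pose proof (inv_pow_le T j (k + j) HT ltac:(lia)).
  pose proof (inv_pow_ge1 T (k + j) HT). pose proof (inv_ge2 T HT).
  assert (2 * (/ T) ^ (k + j) <= (/ T) ^ S (k + j)) by (simpl; nra).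
  split_all.
  - exact (is_derive_plus _ _ _ _ _ H1 G1).
  - exact (is_derive_plus _ _ _ _ _ H2 G2).
  - eapply Rle_trans; [apply Rabs_triang|lra].
  - eapply Rle_trans; [apply Rabs_triang|lra].
  - eapply Rle_trans; [apply Rabs_triang|lra].
Qed.

Lemma moderate_mult (f h : R -> R -> R) :
  moderate f -> moderate h -> moderate (fun T a => f T a * h T a).
Proof.
  intros (f1 & f2 & k & Hf) (h1 & h2 & j & Hh).
  exists (fun T a => f1 T a * h T a + f T a * h1 T a),
    (fun T a => f2 T a * h T a + 2 * (f1 T a * h1 T a) + f T a * h2 T a), (S (S (k + j))).
  generalize (filter_and _ _ (filter_and _ _ Hf Hh) (at_right_lt 0 (1 / 2) ltac:(lra))).
  apply filter_imp. intros T [[Ff Fh] HT] a Ha.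
  destruct (Ff a Ha) as (H1 & H2 & H3 & H4 & H5). destruct (Fh a Ha) as (G1 & G2 & G3 & G4 & G5).
  pose proof (inv_pow_ge1 T (k + j) HT) as Hp1. pose proof (inv_ge2 T HT) as Hp2.
  assert (Hp : 4 * (/ T) ^ (k + j) <= (/ T) ^ S (S (k + j))).
  { apply inv_pow_SS, HT. }
  assert (Hm : forall u v, Rabs u <= (/ T) ^ k -> Rabs v <= (/ T) ^ j ->
     Rabs (u * v) <= (/ T) ^ (k + j)).
  { intros u v Hu Hv. rewrite Rabs_mult, pow_add.
    apply Rmult_le_compat; auto using Rabs_pos. }
  pose proof (Hm _ _ H3 G3). pose proof (Hm _ _ H4 G3). pose proof (Hm _ _ H3 G4).
  pose proof (Hm _ _ H5 G3). pose proof (Hm _ _ H4 G4). pose proof (Hm _ _ H3 G5).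
  split_all.
  - pose proof (is_derive_mult (f T) (h T) a _ _ H1 G1 Rmult_comm) as D. exact D.
  - pose proof (is_derive_mult (f1 T) (h T) a _ _ H2 G1 Rmult_comm) as D1.
    pose proof (is_derive_mult (f T) (h1 T) a _ _ H1 G2 Rmult_comm) as D2.
    pose proof (is_derive_plus _ _ _ _ _ D1 D2) as D.
    match type of D with is_derive _ _ ?v => match goal with |- is_derive _ _ ?w =>
      replace w with v; [exact D|] end end.
    unfold plus, mult; simpl. ring.
  - lra.
  - eapply Rle_trans; [apply Rabs_triang|lra].
  - eapply Rle_trans; [apply Rabs_triang|].
    assert (Rabs (f2 T a * h T a + 2 * (f1 T a * h1 T a)) <= 3 * (/ T) ^ (k + j)).
    { eapply Rle_trans; [apply Rabs_triang|]. rewrite (Rabs_mult 2), (Rabs_right 2) by lra. lra. }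
    lra.
Qed.

Lemma moderate_opp (f : R -> R -> R) : moderate f -> moderate (fun T a => - f T a).
Proof.
  intros Hf. apply (moderate_ext (fun T a => -1 * f T a)); [intros; ring|].
  apply (moderate_mult (fun _ _ => -1)); [apply moderate_const|exact Hf].
Qed.

Lemma moderate_minus (f h : R -> R -> R) :
  moderate f -> moderate h -> moderate (fun T a => f T a - h T a).
Proof. intros Hf Hh. exact (moderate_plus f _ Hf (moderate_opp h Hh)). Qed.

(** A lower bound independent of T and a gives 1/f <= 1/c <= 1/T, so every division costs one power
    of 1/T. *)
Lemma moderate_inv (f : R -> R -> R) (c : R) :
  0 < c -> at_right 0 (fun T => forall a, 0 < a < dl -> c <= f T a) ->
  moderate f -> moderate (fun T a => / f T a).
Proof.
  intros Hc Hlow (f1 & f2 & k & Hf).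
  exists (fun T a => - f1 T a / f T a ^ 2),
    (* The worst term f1^2 / f^3 costs 2k + 3 powers; two more absorb the numerical coefficients. *)
    (fun T a => - f2 T a / f T a ^ 2 + 2 * f1 T a ^ 2 / f T a ^ 3), (k + k + 5)%nat.
  generalize (filter_and _ _ (filter_and _ _ Hf Hlow)
    (filter_and _ _ (const_le_inv (/ c)) (at_right_lt 0 (1 / 2) ltac:(lra)))).
  apply filter_imp. intros T [[Ff Hl] [Hic HT]] a Ha.
  destruct (Ff a Ha) as (H1 & H2 & H3 & H4 & H5). specialize (Hl a Ha).
  pose proof (inv_ge2 T HT) as Hp2.
  assert (Hi : 0 < / f T a <= (/ T) ^ 1).
  { rewrite pow_1. split; [apply Rinv_0_lt_compat; lra|].
    apply Rle_trans with (/ c); [apply Rinv_le_contravar; lra|].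
    eapply Rle_trans; [apply Rle_abs|exact Hic]. }
  assert (Hia : Rabs (/ f T a) <= (/ T) ^ 1) by (rewrite Rabs_right; lra).
  assert (Hm : forall u v i j, Rabs u <= (/ T) ^ i -> Rabs v <= (/ T) ^ j ->
     Rabs (u * v) <= (/ T) ^ (i + j)).
  { intros u v i j Hu Hv. rewrite Rabs_mult, pow_add.
    apply Rmult_le_compat; auto using Rabs_pos. }
  pose proof (Hm _ _ _ _ (Hm _ _ _ _ H4 Hia) Hia) as B1.
  pose proof (Hm _ _ _ _ (Hm _ _ _ _ H5 Hia) Hia) as B2.
  pose proof (Hm _ _ _ _ (Hm _ _ _ _ B1 H4) Hia) as B3.
  pose proof (inv_pow_le T (k + 1 + 1) (k + k + 3) HT ltac:(lia)) as P1.
  pose proof (inv_pow_le T (k + 1 + 1 + k + 1) (k + k + 3) HT ltac:(lia)) as P2.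
  pose proof (inv_pow_le T 1 (k + k + 3) HT ltac:(lia)) as P3.
  pose proof (inv_pow_ge1 T (k + k + 3) HT) as P4.
  assert (Hp : 4 * (/ T) ^ (k + k + 3) <= (/ T) ^ (k + k + 5)).
  { replace (k + k + 5)%nat with (S (S (k + k + 3))) by lia.
    apply inv_pow_SS, HT. }
  split; [|split; [|split; [|split]]].
  - replace (- f1 T a / f T a ^ 2) with (- f1 T a / (f T a) ^ 2) by reflexivity.
    apply is_derive_inv; [exact H1|lra].
  - set (u := f T) in *. set (u1 := f1 T) in *.
    change (is_derive (fun r => - u1 r / u r ^ 2) a (- f2 T a / u a ^ 2 + 2 * u1 a ^ 2 / u a ^ 3)).
    assert (0 < u a * u a) by nra.
    auto_derive; [repeat split; try (eexists; eassumption); simpl; lra|]. derive_unique. field. lra.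
  - lra.
  - replace (- f1 T a / f T a ^ 2) with (- (f1 T a * / f T a * / f T a)) by (field; lra).
    rewrite Rabs_Ropp. lra.
  - replace (- f2 T a / f T a ^ 2 + 2 * f1 T a ^ 2 / f T a ^ 3)
      with (- (f2 T a * / f T a * / f T a)
        + 2 * (f1 T a * / f T a * / f T a * f1 T a * / f T a)) by (field; lra).
    eapply Rle_trans; [apply Rabs_triang|].
    rewrite Rabs_Ropp, (Rabs_mult 2), (Rabs_right 2) by lra. lra.
Qed.

Context (eps : R -> R) (Heps : exists c, at_right 0 (fun T => 0 < eps T <= c)).

Lemma moderate_eps : moderate (fun T _ => eps T).
Proof.
  destruct Heps as [c H]. apply (moderate_T eps 1).
  generalize (filter_and _ _ H (const_le_inv c)). apply filter_imp.
  intros T [H1 H2]. rewrite pow_1, Rabs_right by lra.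
  pose proof (Rle_abs c). lra.
Qed.

(** An exact identity instead of an error bound, so that it may be differentiated in a; moderation
    of [h] then bounds the derivatives of the error as well. *)
Definition near_by (f f0 : R -> R -> R) : Prop :=
  moderate f0 /\ exists h, moderate h /\
  at_right 0 (fun T => forall a, 0 < a < dl -> f T a = f0 T a + eps T * h T a).

Lemma near_by_refl (f : R -> R -> R) : moderate f -> near_by f f.
Proof.
  intros Hf. split; [exact Hf|]. exists (fun _ _ => 0). split; [apply moderate_const|].
  apply filter_forall. intros T a _. ring.
Qed.

Lemma near_by_ext (f f0 f0' : R -> R -> R) :
  (forall T a, f0 T a = f0' T a) -> near_by f f0 -> near_by f f0'.
Proof.
  intros He [Hf [h [Hh H]]]. split; [exact (moderate_ext _ _ He Hf)|].
  exists h. split; [exact Hh|]. revert H. apply filter_imp. intros T H a Ha.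
  rewrite <- He. exact (H a Ha).
Qed.

Lemma near_by_const (c : R) : near_by (fun _ _ => c) (fun _ _ => c).
Proof. apply near_by_refl, moderate_const. Qed.

Lemma near_by_plus (f h f0 h0 : R -> R -> R) : near_by f f0 -> near_by h h0 ->
  near_by (fun T a => f T a + h T a) (fun T a => f0 T a + h0 T a).
Proof.
  intros [Mf [u [Mu Hu]]] [Mh [v [Mv Hv]]]. split; [apply moderate_plus; assumption|].
  exists (fun T a => u T a + v T a). split; [apply moderate_plus; assumption|].
  generalize (filter_and _ _ Hu Hv). apply filter_imp. intros T [H1 H2] a Ha.
  rewrite (H1 a Ha), (H2 a Ha). ring.
Qed.

(** The quadratic error is eps times eps u v, so boundedness of [eps] lets it be absorbed into the
    moderate factor. *)
Lemma near_by_mult (f h f0 h0 : R -> R -> R) : near_by f f0 -> near_by h h0 ->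
  near_by (fun T a => f T a * h T a) (fun T a => f0 T a * h0 T a).
Proof.
  intros [Mf [u [Mu Hu]]] [Mh [v [Mv Hv]]]. split; [apply moderate_mult; assumption|].
  exists (fun T a => f0 T a * v T a + u T a * h0 T a + eps T * (u T a * v T a)). split.
  - apply moderate_plus; [apply moderate_plus; apply moderate_mult; assumption|].
    apply (moderate_mult (fun T _ => eps T)); [apply moderate_eps|].
    apply moderate_mult; assumption.
  - generalize (filter_and _ _ Hu Hv). apply filter_imp. intros T [H1 H2] a Ha.
    rewrite (H1 a Ha), (H2 a Ha). ring.
Qed.

Lemma near_by_opp (f f0 : R -> R -> R) : near_by f f0 ->
  near_by (fun T a => - f T a) (fun T a => - f0 T a).
Proof.
  intros [Mf [u [Mu Hu]]]. split; [apply moderate_opp; assumption|].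
  exists (fun T a => - u T a). split; [apply moderate_opp; assumption|].
  revert Hu. apply filter_imp. intros T H1 a Ha. rewrite (H1 a Ha). ring.
Qed.

Lemma near_by_minus (f h f0 h0 : R -> R -> R) : near_by f f0 -> near_by h h0 ->
  near_by (fun T a => f T a - h T a) (fun T a => f0 T a - h0 T a).
Proof. intros Hf Hh. exact (near_by_plus _ _ _ _ Hf (near_by_opp _ _ Hh)). Qed.

Lemma near_by_pow (f f0 : R -> R -> R) (k : nat) : near_by f f0 ->
  near_by (fun T a => f T a ^ k) (fun T a => f0 T a ^ k).
Proof.
  intros Hf. induction k as [|k IH]; [exact (near_by_const 1)|].
  exact (near_by_mult _ _ _ _ Hf IH).
Qed.

End Moderate.

Ltac near_arith :=
  repeat lazymatch goal with
  | H : near_by _ _ ?f ?f0 |- near_by _ _ ?f ?f0 => exact H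
  | |- near_by _ _ (fun T a => @?f T a + @?h T a) (fun T a => @?f0 T a + @?h0 T a) =>
      apply (near_by_plus _ _ f h f0 h0)
  | |- near_by _ _ (fun T a => @?f T a - @?h T a) (fun T a => @?f0 T a - @?h0 T a) =>
      apply (near_by_minus _ _ f h f0 h0)
  | |- near_by _ _ (fun T a => @?f T a * @?h T a) (fun T a => @?f0 T a * @?h0 T a) =>
      apply (near_by_mult _ _ ltac:(eassumption) f h f0 h0)
  | |- near_by _ _ (fun T a => - @?f T a) (fun T a => - @?f0 T a) =>
      apply (near_by_opp _ _ f f0)
  | |- near_by _ _ (fun T a => @?f T a ^ ?k) (fun T a => @?f0 T a ^ ?k) =>
      apply (near_by_pow _ _ ltac:(eassumption) f f0 k)
  | |- near_by _ _ (fun _ _ => ?c) (fun _ _ => ?c) => apply near_by_const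
  end.

Section NearState.

Context (dl : R) (eps : R -> R) (Heps : exists c, at_right 0 (fun T => 0 < eps T <= c)).

Notation near_by := (near_by dl eps).

Definition near_state (X X0 : R -> R -> state) : Prop :=
  near_by (fun T a => x_n (X T a)) (fun T a => x_n (X0 T a)) /\
  near_by (fun T a => x_q (X T a)) (fun T a => x_q (X0 T a)) /\
  near_by (fun T a => x_a (X T a)) (fun T a => x_a (X0 T a)) /\
  near_by (fun T a => x_b (X T a)) (fun T a => x_b (X0 T a)) /\
  near_by (fun T a => x_al (X T a)) (fun T a => x_al (X0 T a)) /\
  near_by (fun T a => x_A (X T a)) (fun T a => x_A (X0 T a)) /\
  near_by (fun T a => x_B (X T a)) (fun T a => x_B (X0 T a)) /\
  near_by (fun T a => x_J (X T a)) (fun T a => x_J (X0 T a)) /\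
  near_by (fun T a => x_d (X T a)) (fun T a => x_d (X0 T a)) /\
  near_by (fun T a => x_ph (X T a)) (fun T a => x_ph (X0 T a)).

Ltac split_near H :=
  destruct H as (?Nn & ?Nq & ?Na & ?Nb & ?Nal & ?NA & ?NB & ?NJ & ?Nd & ?Nph).

Lemma near_state_velocity (X X0 : R -> R -> state) (t t0 y y0 : R -> R -> R) :
  near_state X X0 -> near_by t t0 -> near_by y y0 ->
  near_state (fun T a => velocity (X T a) (t T a) (y T a))
    (fun T a => velocity (X0 T a) (t0 T a) (y0 T a)).
Proof.
  intros HX Ht Hy. split_near HX.
  unfold near_state, velocity; cbn [x_n x_q x_a x_b x_al x_A x_B x_J x_d x_ph].
  split_all; near_arith.
Qed.

(** [Ff] is polynomial in the state and its isentropic velocity, so closure under arithmetic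
    suffices and nothing is expanded. *)
Lemma near_by_Ff (X X0 : R -> R -> state) :
  near_state X X0 -> near_by (fun T a => Ff (X T a)) (fun T a => Ff (X0 T a)).
Proof.
  intros HX.
  assert (HP : near_by (fun T a => Pf (X T a)) (fun T a => Pf (X0 T a))).
  { split_near HX. unfold Pf. near_arith. }
  assert (HN : near_by (fun T a => Nf (X T a)) (fun T a => Nf (X0 T a))).
  { split_near HX. unfold Nf. near_arith. }
  assert (HY : near_by (fun T a => Yf (X T a)) (fun T a => Yf (X0 T a))).
  { split_near HX. unfold Yf. near_arith. }
  assert (HZ : near_by (fun T a => Zf (X T a)) (fun T a => Zf (X0 T a))).
  { split_near HX. unfold Zf, Ef. near_arith. }
  pose proof (near_state_velocity X X0 _ _ _ _ HX HP HN) as HV.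
  assert (HdY : near_by (fun T a => dYf (X T a) (isentropic (X T a)))
    (fun T a => dYf (X0 T a) (isentropic (X0 T a)))).
  { split_near HX. split_near HV. unfold dYf, isentropic. near_arith. }
  assert (HdZ : near_by (fun T a => dZf (X T a) (isentropic (X T a)))
    (fun T a => dZf (X0 T a) (isentropic (X0 T a)))).
  { split_near HX. split_near HV. unfold dZf, isentropic, Ef, Ef'. near_arith. }
  unfold Ff. near_arith.
Qed.

End NearState.

Lemma at_right_scale (P : R -> Prop) (c : R) :
  0 < c -> at_right 0 P -> at_right 0 (fun T => P (T / c)).
Proof.
  intros Hc [d Hd].
  assert (H : 0 < d * c) by (apply Rmult_lt_0_compat; [apply cond_pos|exact Hc]).
  exists (mkposreal _ H). intros y Hy Hy0. apply Hd.
  - unfold ball in *; simpl in *; unfold AbsRing_ball, abs, minus, plus, opp in *; simpl in *.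
    rewrite Ropp_0, Rplus_0_r in *. rewrite Rabs_right in Hy by lra.
    rewrite Rabs_right by (apply Rle_ge; left; apply Rdiv_lt_0_compat; lra).
    apply Rlt_div_l; lra.
  - apply Rdiv_lt_0_compat; lra.
Qed.

(** Allows the scale (T/TA)^(3/2) to be treated as k^3 with k = sqrt (T/TA), so that limits reduce
    to rational functions at 0. *)
Lemma at_right_sqrt (P : R -> Prop) : at_right 0 P -> at_right 0 (fun T => P (sqrt T)).
Proof.
  intros [d Hd].
  assert (H : 0 < d * d) by (apply Rmult_lt_0_compat; apply cond_pos).
  exists (mkposreal _ H). intros y Hy Hy0. apply Hd.
  - unfold ball in *; simpl in *; unfold AbsRing_ball, abs, minus, plus, opp in *; simpl in *.
    rewrite Ropp_0, Rplus_0_r in *. rewrite Rabs_right in Hy by lra.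
    rewrite Rabs_right by (apply Rle_ge, sqrt_pos).
    rewrite <- (sqrt_square d) by (left; apply cond_pos). apply sqrt_lt_1; lra.
  - apply sqrt_lt_R0, Hy0.
Qed.

Lemma at_right_positive (f : R -> R) :
  ex_derive f 0 -> 0 < f 0 -> at_right 0 (fun h => 0 < f h).
Proof.
  intros Hf H0. apply filter_le_within.
  apply (ex_derive_continuous f 0 Hf (fun y => 0 < y)). apply (open_gt 0). exact H0.
Qed.

(** * Exponential smallness of [degB] *)

Definition saha_ratio (g : gas) (T : R) : R :=
  muA g / muB g * exp (- (TB g - TA g) / T).

Lemma saha_ratio_pos (g : gas) (T : R) : positive_gas g -> 0 < saha_ratio g T.
Proof.
  intros (_ & _ & HA & HB & _). unfold saha_ratio.
  apply Rmult_lt_0_compat; [apply Rdiv_lt_0_compat; lra|apply exp_pos].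
Qed.

(** From exp x >= x one gets exp ((TB - TA)/T) >= (c/T)^(k + 2). Of the two surplus powers of 1/T,
    one yields the T on the right and the other absorbs the constants. *)
Lemma saha_ratio_small (g : gas) (k : nat) :
  positive_gas g -> at_right 0 (fun T => saha_ratio g T * (/ T) ^ k <= T).
Proof.
  intros (_ & _ & HA & HB & _ & HTA & HTB).
  set (c := (TB g - TA g) / (INR k + 2)).
  pose proof (pos_INR k) as Hk.
  assert (Hc : 0 < c) by (apply Rdiv_lt_0_compat; lra).
  set (m := muA g / muB g). assert (Hm : 0 < m) by (apply Rdiv_lt_0_compat; lra).
  assert (Hck : 0 < c ^ (k + 2)) by (apply pow_lt, Hc).
  assert (Hb : 0 < c ^ (k + 2) / m) by (apply Rdiv_lt_0_compat; lra).
  generalize (at_right_lt 0 _ Hb). apply filter_imp. intros T HT.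
  assert (HiT : 0 < / T) by (apply Rinv_0_lt_compat; lra).
  assert (E : exp ((TB g - TA g) / T) = exp (c * / T) ^ (k + 2)).
  { rewrite <- Rpower_pow by apply exp_pos. unfold Rpower. rewrite ln_exp. f_equal.
    rewrite plus_INR. simpl. unfold c. field. lra. }
  assert (Hx : 0 < c * / T) by (apply Rmult_lt_0_compat; lra).
  assert (L : (c * / T) ^ (k + 2) <= exp ((TB g - TA g) / T)).
  { rewrite E. apply pow_incr. pose proof (exp_ineq1 (c * / T) ltac:(lra)). lra. }
  unfold saha_ratio. fold m.
  replace (- (TB g - TA g) / T) with (- ((TB g - TA g) / T)) by (field; lra).
  rewrite exp_Ropp. pose proof (exp_pos ((TB g - TA g) / T)) as He.
  apply (Rmult_le_reg_r (exp ((TB g - TA g) / T))); [exact He|].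
  replace (m * / exp ((TB g - TA g) / T) * (/ T) ^ k * exp ((TB g - TA g) / T))
    with (m * (/ T) ^ k) by (field; lra).
  apply Rle_trans with (T * (c * / T) ^ (k + 2)); [|apply Rmult_le_compat_l; lra].
  rewrite Rpow_mult_distr. replace ((/ T) ^ (k + 2)) with ((/ T) ^ k * (/ T * / T))
    by (rewrite pow_add; ring).
  replace (T * (c ^ (k + 2) * ((/ T) ^ k * (/ T * / T)))) with (c ^ (k + 2) * / T * (/ T) ^ k)
    by (field; lra).
  apply Rmult_le_compat_r; [apply pow_le; lra|].
  apply (Rmult_le_reg_r (T / m)); [apply Rdiv_lt_0_compat; lra|].
  replace (m * (T / m)) with T by (field; lra).
  replace (c ^ (k + 2) * / T * (T / m)) with (c ^ (k + 2) / m) by (field; lra). lra.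
Qed.

Lemma saha_ratio_bounded (g : gas) :
  positive_gas g -> exists c, at_right 0 (fun T => 0 < saha_ratio g T <= c).
Proof.
  intros Hg. exists 1.
  generalize (filter_and _ _ (saha_ratio_small g 0 Hg) (at_right_lt 0 1 ltac:(lra))).
  apply filter_imp. intros T [H HT]. pose proof (saha_ratio_pos g T Hg). simpl in H. lra.
Qed.

Definition degB_factor (g : gas) (T a : R) : R := / (1 - a + saha_ratio g T * a).

Lemma degB_saha (g : gas) (T a : R) :
  positive_gas g -> 0 < a < 1 -> degB g T a = saha_ratio g T * (a * degB_factor g T a).
Proof.
  intros Hg Ha. pose proof (saha_ratio_pos g T Hg).
  destruct Hg as (_ & _ & HA & HB & _).
  unfold degB, degB_factor, saha_ratio in *.
  set (e := exp (- (TB g - TA g) / T)) in *. assert (He : 0 < e) by apply exp_pos.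
  assert (H1 : 0 < muA g * a * e) by (repeat apply Rmult_lt_0_compat; lra).
  assert (H2 : 0 < muB g * (1 - a)) by (apply Rmult_lt_0_compat; lra).
  field. repeat split; try lra.
Qed.

(* [state_at] with the exponentially small [degB] replaced by [0]. *)
Definition pure_state (g : gas) (T a : R) : state :=
  St (TA g / T) ((TB g - TA g) / T) a 0 (beta g * a) (varA g a) 0 0 (1 - a)
     (/ (1 + beta g * a)).

Section Approximation.

Context (g : gas) (Hg : positive_gas g) (dl : R) (Hdl : 0 < dl < 1).

Notation eps := (saha_ratio g).
Notation moderate := (moderate dl).
Notation near_by := (near_by dl eps).

Let r := degB_factor g.
(** This is a/deg. Since deg vanishes with a, the quotients by deg in the state are not inverses of
    functions bounded below; after extracting a, the remaining factor is at least beta. *)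
Let rho (T a : R) : R := / (beta g + (1 - beta g) * (eps T * r T a)).

Lemma moderate_eps' : moderate (fun T _ => eps T).
Proof. exact (moderate_eps dl eps (saha_ratio_bounded g Hg)). Qed.

Ltac moderate_arith :=
  repeat lazymatch goal with
  | |- moderate (fun T a => eps T) => apply moderate_eps'
  | |- moderate (fun T a => a) => apply (moderate_a dl); lra
  | |- moderate (fun T a => @?f T a + @?h T a) => apply (moderate_plus dl f h)
  | |- moderate (fun T a => @?f T a - @?h T a) => apply (moderate_minus dl f h)
  | |- moderate (fun T a => @?f T a * @?h T a) => apply (moderate_mult dl f h)
  | |- moderate (fun T a => - @?f T a) => apply (moderate_opp dl f)
  | H : moderate ?f |- moderate ?f => exact H
  | |- moderate (fun _ _ => ?c) => apply (moderate_const dl c)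
  end.

Lemma r_pos T a : 0 < a < dl -> 0 < r T a.
Proof.
  intros Ha. pose proof (saha_ratio_pos g T Hg). unfold r, degB_factor.
  apply Rinv_0_lt_compat. assert (0 < eps T * a) by (apply Rmult_lt_0_compat; lra). lra.
Qed.

Lemma sigma_low T a : 0 < a < dl -> beta g <= beta g + (1 - beta g) * (eps T * r T a).
Proof.
  intros Ha. pose proof (saha_ratio_pos g T Hg). pose proof (r_pos T a Ha).
  destruct Hg as (_ & _ & _ & _ & Hb & _).
  assert (0 < (1 - beta g) * (eps T * r T a)) by (positivity). lra.
Qed.

Lemma moderate_r : moderate (fun T a => r T a).
Proof.
  apply (moderate_inv dl (fun T a => 1 - a + eps T * a) (1 - dl)); [lra| |moderate_arith].
  apply filter_forall. intros T a Ha. pose proof (saha_ratio_pos g T Hg).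
  assert (0 < eps T * a) by (apply Rmult_lt_0_compat; lra). lra.
Qed.

Lemma moderate_rho : moderate (fun T a => rho T a).
Proof.
  pose proof moderate_r as Hr.
  apply (moderate_inv dl (fun T a => beta g + (1 - beta g) * (eps T * r T a)) (beta g)).
  - destruct Hg as (_ & _ & _ & _ & Hb & _). lra.
  - apply filter_forall. intros T a Ha. apply sigma_low, Ha.
  - moderate_arith.
Qed.

Lemma near_state_pure : near_state dl eps (state_at g) (pure_state g).
Proof.
  pose proof moderate_r as Hr. pose proof moderate_rho as Hrho.
  pose proof Hg as (_ & _ & _ & _ & Hb & _).
  assert (Nb : near_by (fun T a => degB g T a) (fun _ _ => 0)).
  { split; [apply moderate_const|]. exists (fun T a => a * r T a). split; [moderate_arith|].
    apply filter_forall. intros T a Ha. rewrite degB_saha by (assumption || lra).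
    unfold r. ring. }
  assert (Nid : near_by (fun _ a => a) (fun _ a => a)).
  { apply near_by_refl; moderate_arith. }
  assert (He := saha_ratio_bounded g Hg).
  assert (Hsig : forall T a, 0 < a < dl -> deg g T a = a * (beta g + (1 - beta g) * (eps T * r T a))
    /\ 0 < a * (beta g + (1 - beta g) * (eps T * r T a))
    /\ 0 < beta g + (1 - beta g) * (eps T * r T a)).
  { intros T a Ha. pose proof (sigma_low T a Ha). split; [|split].
    - unfold deg. rewrite degB_saha by (assumption || lra). unfold r. ring.
    - apply Rmult_lt_0_compat; lra.
    - lra. }
  assert (Hb1 : forall T a, 0 < a < dl -> 1 - degB g T a = (1 - a) * r T a).
  { intros T a Ha. rewrite degB_saha by (assumption || lra).
    pose proof (saha_ratio_pos g T Hg).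
    assert (0 < eps T * a) by (apply Rmult_lt_0_compat; lra).
    unfold r, degB_factor. field. lra. }
  assert (Hpsi : moderate (fun T a => / (1 + beta g * a))).
  { apply (moderate_inv dl (fun T a => 1 + beta g * a) 1); [lra| |moderate_arith].
    apply filter_forall. intros T a Ha. nra. }
  assert (Hphi : moderate (fun T a => / (1 + a * (beta g + (1 - beta g) * (eps T * r T a))))).
  { apply (moderate_inv dl (fun T a => 1 + a * (beta g + (1 - beta g) * (eps T * r T a))) 1);
      [lra| |moderate_arith].
    apply filter_forall. intros T a Ha. destruct (Hsig T a Ha) as (_ & H & _). lra. }
  unfold near_state, state_at, pure_state; cbn [x_n x_q x_a x_b x_al x_A x_B x_J x_d x_ph].
  split_all.
  - apply near_by_refl. apply moderate_div_T.
  - apply near_by_refl. apply moderate_div_T.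
  - exact Nid.
  - exact Nb.
  - apply (near_by_ext dl eps _ (fun T a => beta g * a + (1 - beta g) * 0)); [intros; ring|].
    unfold deg. near_arith.
  - apply near_by_refl. unfold varA. moderate_arith.
  - apply (near_by_ext dl eps _ (fun T a => (1 - beta g) * (0 * (1 - 0)))); [intros; ring|].
    unfold varB. near_arith.
  (* [varB] and [deg] both contain the factor a; it cancels and leaves eps times a moderate
     function. *)
  - split; [apply moderate_const|].
    exists (fun T a => (1 - beta g) * (r T a * r T a * (1 - a) * rho T a)).
    split; [moderate_arith|]. apply filter_forall. intros T a Ha.
    destruct (Hsig T a Ha) as (H1 & H2 & H3). unfold varB. rewrite (Hb1 T a Ha), H1.
    rewrite degB_saha by (assumption || lra). fold r. unfold rho. field. split; lra.
  (* The limit 1 - a is varA / (beta a); the two terms of [h] come from [varB] and from the eps in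
     deg. *)
  - split; [moderate_arith|].
    exists (fun T a => (1 - beta g) * (r T a * r T a * (1 - a) * rho T a)
       - (1 - beta g) * (r T a * rho T a * (1 - a))).
    split; [moderate_arith|]. apply filter_forall. intros T a Ha.
    destruct (Hsig T a Ha) as (H1 & H2 & H3). unfold varA, varB. rewrite (Hb1 T a Ha), H1.
    rewrite degB_saha by (assumption || lra). fold r. unfold rho. field. split; lra.
  - split; [exact Hpsi|].
    exists (fun T a => - ((1 - beta g) * (a * r T a
      * / (1 + a * (beta g + (1 - beta g) * (eps T * r T a))) * / (1 + beta g * a)))).
    split; [moderate_arith|]. apply filter_forall. intros T a Ha.
    destruct (Hsig T a Ha) as (H1 & H2 & H3). rewrite H1. field. split; nra.
Qed.

End Approximation.

(** * The inflection equation without ionization of B *)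

Section PureInflection.

Context (b n : R).

(** The quantities of a [pure_state] as functions of a; suffixes 1 and 2 denote a-derivatives, and
    [ka] is 1 + al + d. *)
Let A (a : R) : R := b * (a * (1 - a)).
Let A1 (a : R) : R := b * (1 - 2 * a).
Let A2 : R := - 2 * b.
Let ka (a : R) : R := 2 - (1 - b) * a.
Let P (a : R) : R := ka a + (n + 5 / 2) * A a.
Let P1 (a : R) : R := - (1 - b) + (n + 5 / 2) * A1 a.
Let P2 : R := (n + 5 / 2) * A2.
Let Y (a : R) : R := 5 / 2 * ka a + (n + 5 / 2) ^ 2 * A a.
Let Y1 (a : R) : R := - (5 / 2) * (1 - b) + (n + 5 / 2) ^ 2 * A1 a.
Let Y2 : R := (n + 5 / 2) ^ 2 * A2.
Let Z (a : R) : R := 3 / 2 * ka a + Ef n * A a.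
Let Z1 (a : R) : R := - (3 / 2) * (1 - b) + Ef n * A1 a.
Let Z2 : R := Ef n * A2.
Let B (a : R) : R := 2 - 4 * a + (1 - b) * a ^ 2.
Let B1 (a : R) : R := - 4 + 2 * (1 - b) * a.
Let B2 : R := 2 * (1 - b).

Definition pure_F (a : R) : R :=
  - 2 * n ^ 2 * (A a * P a ^ 2) + n ^ 3 * (A a * (1 + b * a) * B a)
  - Y a * Z a * (Y a + Z a).

Definition pure_F1 (a : R) : R :=
  - 2 * n ^ 2 * (A1 a * P a ^ 2 + 2 * A a * P a * P1 a)
  + n ^ 3 * (A1 a * (1 + b * a) * B a + A a * b * B a + A a * (1 + b * a) * B1 a)
  - (Y1 a * Z a * (Y a + Z a) + Y a * Z1 a * (Y a + Z a) + Y a * Z a * (Y1 a + Z1 a)).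

Definition pure_F2 (a : R) : R :=
  - 2 * n ^ 2 * (A2 * P a ^ 2 + 4 * A1 a * P a * P1 a + 2 * A a * (P1 a ^ 2 + P a * P2))
  + n ^ 3 * (A2 * (1 + b * a) * B a + A a * (1 + b * a) * B2
       + 2 * (A1 a * b * B a + A1 a * (1 + b * a) * B1 a + A a * b * B1 a))
  - (Y2 * Z a * (Y a + Z a) + Y a * Z2 * (Y a + Z a) + Y a * Z a * (Y2 + Z2)
     + 2 * (Y1 a * Z1 a * (Y a + Z a) + Y1 a * Z a * (Y1 a + Z1 a)
            + Y a * Z1 a * (Y1 a + Z1 a))).

Lemma is_derive_pure_F (a : R) : is_derive pure_F a (pure_F1 a).
Proof.
  unfold pure_F, pure_F1, Y, Y1, Z, Z1, P, P1, ka, B, B1, A, A1, Ef.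
  auto_derive; [trivial|ring].
Qed.

Lemma is_derive_pure_F1 (a : R) : is_derive pure_F1 a (pure_F2 a).
Proof.
  unfold pure_F1, pure_F2, Y, Y1, Y2, Z, Z1, Z2, P, P1, P2, ka, B, B1, B2, A, A1, A2, Ef.
  auto_derive; [trivial|ring].
Qed.

(** On (0, 1/10) the slopes of Y and Z stay above 0.7 s with s = b n^2, while Y and Z stay below
    0.12 s. Hence in the second derivative of Y Z (Y + Z) the products of slopes beat the negative
    Y'' and Z'', leaving at least 0.7 s^2 (Y + Z), which dominates the other two terms of
    [pure_F2]. *)
Lemma pure_F2_negative (a : R) :
  0 < b < 1 -> 100 <= n -> 1000 <= b * n -> 0 < a < 1 / 10 -> pure_F2 a <= - 1.
Proof.
  intros Hb Hn Hbn Ha.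
  set (s := b * n ^ 2).
  assert (Hs : 1000 * n <= s) by (unfold s; nra).
  assert (Hs2 : 100000 <= s) by nra.
  assert (HA1 : 8 / 10 * b <= A1 a <= b) by (unfold A1; nra).
  assert (Hba : 0 < b * a) by (apply Rmult_lt_0_compat; lra).
  assert (HA : 9 / 10 * (b * a) <= A a <= b * a).
  { unfold A. assert (0 <= b * a * a) by (apply Rmult_le_pos; lra).
    assert (b * a * a <= b * a * (1 / 10)) by (apply Rmult_le_compat_l; lra). lra. }
  assert (Hba2 : b * a <= 1 / 10) by nra.
  assert (Hm2 : n ^ 2 <= (n + 5 / 2) ^ 2 <= 11 / 10 * n ^ 2) by nra.
  assert (He : n ^ 2 <= Ef n <= 11 / 10 * n ^ 2) by (unfold Ef; nra).
  assert (Hka : 19 / 10 <= ka a <= 2) by (unfold ka; nra).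
  assert (Hn2 : 0 < n ^ 2) by nra.
  assert (HsA : forall u v, n ^ 2 <= u <= 11 / 10 * n ^ 2 -> 0 <= v -> u * (b * v) <= 11 / 10 * (s * v)
    /\ s * v <= u * (b * v)).
  { intros u v Hu Hv. unfold s. assert (0 <= b * v) by nra. nra. }
  assert (HY1 : 7 / 10 * s <= Y1 a).
  { unfold Y1. assert (n ^ 2 * (8 / 10 * b) <= (n + 5 / 2) ^ 2 * A1 a)
      by (apply Rmult_le_compat; nra).
    unfold s in *. lra. }
  assert (HZ1 : 7 / 10 * s <= Z1 a).
  { unfold Z1. assert (n ^ 2 * (8 / 10 * b) <= Ef n * A1 a) by (apply Rmult_le_compat; nra).
    unfold s in *. lra. }
  assert (HY2 : - (22 / 10) * s <= Y2 <= 0) by (unfold Y2, A2, s; nra).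
  assert (HZ2 : - (22 / 10) * s <= Z2 <= 0) by (unfold Z2, A2, s; nra).
  assert (HY : 0 < Y a <= 12 / 100 * s /\ 4 + 9 / 10 * (s * a) <= Y a).
  { destruct (HsA ((n + 5 / 2) ^ 2) a Hm2 ltac:(lra)) as [U1 U2].
    assert ((n + 5 / 2) ^ 2 * A a <= (n + 5 / 2) ^ 2 * (b * a)) by (apply Rmult_le_compat_l; lra).
    assert ((n + 5 / 2) ^ 2 * (9 / 10 * (b * a)) <= (n + 5 / 2) ^ 2 * A a) by (apply Rmult_le_compat_l; lra).
    assert (s * a <= s * (1 / 10)) by (apply Rmult_le_compat_l; lra).
    assert (0 < s * a) by (apply Rmult_lt_0_compat; lra).
    unfold Y. repeat split; lra. }
  assert (HZ : 0 < Z a <= 12 / 100 * s /\ 2 + 9 / 10 * (s * a) <= Z a).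
  { destruct (HsA (Ef n) a He ltac:(lra)) as [U1 U2].
    assert (Ef n * A a <= Ef n * (b * a)) by (apply Rmult_le_compat_l; lra).
    assert (Ef n * (9 / 10 * (b * a)) <= Ef n * A a) by (apply Rmult_le_compat_l; lra).
    assert (s * a <= s * (1 / 10)) by (apply Rmult_le_compat_l; lra).
    assert (0 < s * a) by (apply Rmult_lt_0_compat; lra).
    unfold Z. repeat split; lra. }
  assert (HP1 : 0 <= P1 a).
  { unfold P1. assert (n * (8 / 10 * b) <= (n + 5 / 2) * A1 a) by (apply Rmult_le_compat; nra). nra. }
  assert (HmA : 0 <= (n + 5 / 2) * A a <= 11 / 10 * (n * (b * a))).
  { split; [apply Rmult_le_pos; lra|]. replace (11 / 10 * (n * (b * a))) with (11 / 10 * n * (b * a)) by ring.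
    apply Rmult_le_compat; lra. }
  (* (n b a)^2 = (b a) (s a) with b a <= 1/10, so P^2 grows only like s a, at the same rate as Y +
     Z. *)
  assert (HP : 0 < P a /\ P a ^ 2 <= 8 + 3 / 10 * (s * a)).
  { assert (Hnb : 0 <= n * (b * a)) by (apply Rmult_le_pos; lra).
    assert (0 < P a <= 2 + 11 / 10 * (n * (b * a))) by (unfold P; lra).
    split; [lra|]. apply Rle_trans with ((2 + 11 / 10 * (n * (b * a))) ^ 2); [nra|].
    assert ((n * (b * a)) ^ 2 <= 1 / 10 * (s * a)).
    { unfold s. replace ((n * (b * a)) ^ 2) with ((b * a) * (b * n ^ 2 * a)) by ring.
      apply Rmult_le_compat_r; [|lra]. assert (0 < b * n ^ 2) by (apply Rmult_lt_0_compat; lra).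
      apply Rmult_le_pos; lra. }
    pose proof (pow2_ge_0 (2 - 11 / 10 * (n * (b * a)))). pose proof (pow2_ge_0 (n * (b * a))). lra. }
  assert (T1 : - 2 * n ^ 2 * (A2 * P a ^ 2 + 4 * A1 a * P a * P1 a + 2 * A a * (P1 a ^ 2 + P a * P2))
    <= 12 * s * P a ^ 2).
  { assert (0 <= A1 a * P a * P1 a) by (repeat apply Rmult_le_pos; lra).
    assert (0 <= A a * P1 a ^ 2) by (apply Rmult_le_pos; [lra|apply pow2_ge_0]).
    assert (E : - (2 * A a * (P a * P2)) <= 4 * b * P a ^ 2).
    { unfold P2, A2. replace (- (2 * A a * (P a * ((n + 5 / 2) * (-2 * b)))))
        with (4 * b * P a * ((n + 5 / 2) * A a)) by ring.
      replace (4 * b * P a ^ 2) with (4 * b * P a * P a) by ring.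
      apply Rmult_le_compat_l; [nra|]. unfold P. lra. }
    replace (12 * s * P a ^ 2) with (2 * n ^ 2 * (6 * b * P a ^ 2)) by (unfold s; ring).
    replace (- 2 * n ^ 2 * (A2 * P a ^ 2 + 4 * A1 a * P a * P1 a + 2 * A a * (P1 a ^ 2 + P a * P2)))
      with (2 * n ^ 2 * (2 * b * P a ^ 2 - 4 * (A1 a * P a * P1 a) - 2 * (A a * P1 a ^ 2)
        + - (2 * A a * (P a * P2)))) by (unfold A2; ring).
    apply Rmult_le_compat_l; lra. }
  assert (T2 : n ^ 3 * (A2 * (1 + b * a) * B a + A a * (1 + b * a) * B2
       + 2 * (A1 a * b * B a + A1 a * (1 + b * a) * B1 a + A a * b * B1 a)) <= 10 * (s * n)).
  { replace (10 * (s * n)) with (n ^ 3 * (10 * b)) by (unfold s; ring).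
    apply Rmult_le_compat_l; [apply pow_le; lra|].
    assert (HB : 0 <= B a <= 2).
    { unfold B. assert (0 <= (1 - b) * a ^ 2) by (apply Rmult_le_pos; [lra|apply pow2_ge_0]).
      assert (a ^ 2 <= 1 * a) by (simpl; rewrite Rmult_1_r; apply Rmult_le_compat_r; lra).
      assert ((1 - b) * a ^ 2 <= 1 * a)
        by (apply Rmult_le_compat; [lra|apply pow2_ge_0|lra|lra]).
      lra. }
    assert (HB1 : B1 a <= 0) by (unfold B1; nra).
    assert (HB2 : 0 <= B2 <= 2) by (unfold B2; lra).
    assert (0 <= b * (1 + b * a) * B a) by (repeat apply Rmult_le_pos; lra).
    assert (A a * (1 + b * a) * B2 <= b * a * 2 * 2)
      by (apply Rmult_le_compat; [apply Rmult_le_pos; lra|lra|apply Rmult_le_compat; lra|lra]).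
    assert (A1 a * b * B a <= b * 1 * 2)
      by (apply Rmult_le_compat; [apply Rmult_le_pos; lra|lra|apply Rmult_le_compat; lra|lra]).
    assert (0 <= A1 a * (1 + b * a) * - B1 a) by (repeat apply Rmult_le_pos; lra).
    assert (0 <= A a * b * - B1 a) by (repeat apply Rmult_le_pos; lra).
    assert (b * a <= b * 1) by (apply Rmult_le_compat_l; lra).
    unfold A2. lra. }
  (* 0.7 is what remains of 2 * 0.7^2 = 0.98 after the loss 2.2 * 0.12 = 0.264 from [Y2 * Z a]; the
     other two groups are nonnegative. *)
  assert (T3 : 7 / 10 * s ^ 2 * (Y a + Z a) <=
    Y2 * Z a * (Y a + Z a) + Y a * Z2 * (Y a + Z a) + Y a * Z a * (Y2 + Z2)
     + 2 * (Y1 a * Z1 a * (Y a + Z a) + Y1 a * Z a * (Y1 a + Z1 a)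
            + Y a * Z1 a * (Y1 a + Z1 a))).
  { assert (HYZ : 0 <= Y a + Z a) by lra.
    assert (HM : forall u v x y, 0 <= x -> 0 <= y -> x * s <= u -> y * s <= v ->
      x * y * s ^ 2 <= u * v).
    { intros u v x y Hx Hy Hu Hv. replace (x * y * s ^ 2) with (x * s * (y * s)) by ring.
      apply Rmult_le_compat; [apply Rmult_le_pos; lra|apply Rmult_le_pos; lra|exact Hu|exact Hv]. }
    assert (HM' : forall u v x y, 0 <= v -> u <= 0 -> - (x * s) <= u -> v <= y * s ->
      - (x * y * s ^ 2) <= u * v).
    { intros u v x y Hv Hu Hu' Hv'.
      assert (- u * v <= x * s * (y * s)) by (apply Rmult_le_compat; lra). lra. }
    pose proof (HM (Y1 a) (Z1 a) (7 / 10) (7 / 10) ltac:(lra) ltac:(lra) HY1 HZ1) as Q1.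
    pose proof (HM (Y1 a) (Y1 a + Z1 a) (7 / 10) (14 / 10) ltac:(lra) ltac:(lra) HY1 ltac:(lra)) as Q2.
    pose proof (HM (Z1 a) (Y1 a + Z1 a) (7 / 10) (14 / 10) ltac:(lra) ltac:(lra) HZ1 ltac:(lra)) as Q3.
    pose proof (HM' Y2 (Z a) (22 / 10) (12 / 100) ltac:(lra) ltac:(lra) ltac:(lra) ltac:(lra)) as R1.
    pose proof (HM' Z2 (Y a + Z a) (22 / 10) (24 / 100) ltac:(lra) ltac:(lra) ltac:(lra) ltac:(lra)) as R2.
    pose proof (HM' (Y2 + Z2) (Y a) (44 / 10) (12 / 100) ltac:(lra) ltac:(lra) ltac:(lra) ltac:(lra)) as R3.
    assert (Hss : 0 <= s ^ 2) by apply pow2_ge_0.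
    assert (S1 : 0 <= (Y2 * Z a + 2 * (Y1 a * Z1 a) - 7 / 10 * s ^ 2) * (Y a + Z a))
      by (apply Rmult_le_pos; lra).
    assert (S2 : 0 <= (Z2 * (Y a + Z a) + 2 * (Z1 a * (Y1 a + Z1 a))) * Y a)
      by (apply Rmult_le_pos; lra).
    assert (S3 : 0 <= ((Y2 + Z2) * Y a + 2 * (Y1 a * (Y1 a + Z1 a))) * Z a)
      by (apply Rmult_le_pos; lra).
    lra. }
  assert (Hsa : 0 < s * a) by (apply Rmult_lt_0_compat; lra).
  assert (T4 : 12 * s * P a ^ 2 <= 96 * s + 36 / 10 * (s * (s * a))).
  { replace (96 * s + 36 / 10 * (s * (s * a))) with (12 * s * (8 + 3 / 10 * (s * a))) by field.
    apply Rmult_le_compat_l; lra. }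
  assert (T5 : s ^ 2 * (6 + 18 / 10 * (s * a)) <= s ^ 2 * (Y a + Z a))
    by (apply Rmult_le_compat_l; [apply pow2_ge_0|lra]).
  unfold pure_F2.
  (* Since s >= 1000 n and s >= 100000, the negative terms in s^2 and s^3 a outweigh each positive
     one. *)
  apply Rle_trans with (96 * s + 36 / 10 * (s * (s * a)) + 10 * (s * n)
    - 7 / 10 * (s ^ 2 * (6 + 18 / 10 * (s * a)))); [lra|].
  assert (s * n <= s * (s / 1000)) by (apply Rmult_le_compat_l; lra).
  assert (100000 * (s * (s * a)) <= s * (s * (s * a)))
    by (apply Rmult_le_compat_r; [apply Rmult_le_pos; lra|lra]).
  assert (100000 * s <= s * s) by (apply Rmult_le_compat_r; lra).
  assert (0 < s * (s * a)) by (apply Rmult_lt_0_compat; lra).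
  lra.
Qed.

(** Y and Z are at least n^2 A, so Y Z (Y + Z) >= 2 n^6 A^3 = 2 (n^3 A) (n^3 A^2) >= 4 n^3 A, twice
    the only positive term's bound 2 n^3 A. *)
Lemma pure_F_tail (a0 a : R) :
  0 < b < 1 -> 0 < n -> 0 < a < 1 -> 0 < a0 <= A a -> 2 <= n ^ 3 * a0 ^ 2 -> 1 <= n ^ 3 * a0 ->
  pure_F a <= - 1.
Proof.
  intros Hb Hn Ha Ha0 H1 H2. unfold pure_F.
  assert (Hn3 : 0 < n ^ 3) by (apply pow_lt; lra).
  assert (Hn2 : 0 < n ^ 2) by (apply pow_lt; lra).
  assert (HB : (1 + b * a) * B a <= 2).
  { unfold B. assert (0 < a * a) by nra. assert (0 < b * a) by nra.
    assert (a * a < a) by nra. assert (b * a < a) by nra.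
    assert ((1 - b) * (a * a) <= a * a) by nra.
    assert (b * a * (1 - b) * (a * a) <= b * a * (a * a)) by (assert (0 < b * a * (a * a)) by nra; nra).
    assert (0 <= b * a * (a - a * a)) by (apply Rmult_le_pos; lra).
    nra. }
  assert (Hka : 1 <= ka a) by (unfold ka; nra).
  assert (HY : n ^ 2 * A a <= Y a).
  { unfold Y. assert (n ^ 2 * A a <= (n + 5 / 2) ^ 2 * A a) by (apply Rmult_le_compat_r; nra). lra. }
  assert (HZ : n ^ 2 * A a <= Z a).
  { unfold Z. assert (n ^ 2 * A a <= Ef n * A a) by (apply Rmult_le_compat_r; unfold Ef; nra). lra. }
  assert (Hw : 0 < n ^ 2 * A a) by (apply Rmult_lt_0_compat; lra).
  assert (HYZ : (n ^ 2 * A a) * (n ^ 2 * A a) * (n ^ 2 * A a + n ^ 2 * A a) <= Y a * Z a * (Y a + Z a)).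
  { apply Rmult_le_compat; try apply Rmult_le_compat; nra. }
  assert (H0 : 0 <= n ^ 2 * (A a * P a ^ 2)).
  { apply Rmult_le_pos; [lra|]. apply Rmult_le_pos; [lra|apply pow2_ge_0]. }
  assert (H3 : n ^ 3 * (A a * (1 + b * a) * B a) <= n ^ 3 * A a * 2).
  { replace (n ^ 3 * (A a * (1 + b * a) * B a)) with (n ^ 3 * A a * ((1 + b * a) * B a)) by ring.
    apply Rmult_le_compat_l; [apply Rmult_le_pos; lra|exact HB]. }
  assert (H4 : n ^ 3 * a0 ^ 2 <= n ^ 3 * A a ^ 2) by (apply Rmult_le_compat_l; [lra|apply pow_incr; lra]).
  assert (H5 : n ^ 3 * a0 <= n ^ 3 * A a) by (apply Rmult_le_compat_l; lra).
  replace ((n ^ 2 * A a) * (n ^ 2 * A a) * (n ^ 2 * A a + n ^ 2 * A a))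
    with (2 * (n ^ 3 * A a) * (n ^ 3 * A a ^ 2)) in HYZ by ring.
  nra.
Qed.

End PureInflection.

Lemma Ff_pure_state (g : gas) (T a : R) :
  Ff (pure_state g T a) = pure_F (beta g) (TA g / T) a.
Proof.
  unfold pure_F, Ff, isentropic, dYf, dZf, velocity, Pf, Nf, Yf, Zf, Ef', Ef, pure_state, varA.
  cbn [x_n x_q x_a x_b x_al x_A x_B x_J x_d x_ph]. cbv zeta.
  (* [x_q] and [x_ph] enter only in terms that vanish with [x_b], [x_B] and [x_J], so the identity
     holds for arbitrary values of them. *)
  generalize (/ (1 + beta g * a)) (TA g / T) ((TB g - TA g) / T). intros. field.
Qed.

Definition inflection_F (g : gas) (T a : R) : R := Ff (state_at g T a).

(** Values transfer signs from [pure_F]; second derivatives transfer concavity. The error T comes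
    from the exponential beating whatever power of 1/T the moderate factor carries. *)
Lemma inflection_F_approx (g : gas) (dl : R) :
  positive_gas g -> 0 < dl < 1 ->
  exists F1 F2 : R -> R -> R, at_right 0 (fun T => forall a, 0 < a < dl ->
    Rabs (inflection_F g T a - pure_F (beta g) (TA g / T) a) <= T /\
    is_derive (inflection_F g T) a (F1 T a) /\ is_derive (F1 T) a (F2 T a) /\
    Rabs (F2 T a - pure_F2 (beta g) (TA g / T) a) <= T).
Proof.
  intros Hg Hdl.
  destruct (near_by_Ff dl (saha_ratio g) (saha_ratio_bounded g Hg) _ _
    (near_state_pure g Hg dl Hdl)) as [_ [h [[h1 [h2 [k Hh]]] HF]]].
  exists (fun T a => pure_F1 (beta g) (TA g / T) a + saha_ratio g T * h1 T a),
    (fun T a => pure_F2 (beta g) (TA g / T) a + saha_ratio g T * h2 T a).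
  generalize (filter_and _ _ (filter_and _ _ Hh HF) (saha_ratio_small g k Hg)).
  apply filter_imp. intros T [[H1 H2] H3] a Ha.
  pose proof (saha_ratio_pos g T Hg) as He.
  destruct (H1 a Ha) as (D1 & D2 & B0 & _ & B2).
  assert (Hsmall : forall u, Rabs u <= (/ T) ^ k -> Rabs (saha_ratio g T * u) <= T).
  { intros u Hu. rewrite Rabs_mult, (Rabs_right (saha_ratio g T)) by lra.
    apply Rle_trans with (saha_ratio g T * (/ T) ^ k); [|exact H3].
    apply Rmult_le_compat_l; lra. }
  split_all.
  - unfold inflection_F. rewrite (H2 a Ha), Ff_pure_state.
    match goal with |- Rabs ?u <= _ => replace u with (saha_ratio g T * h T a) by ring end.
    apply Hsmall, B0.
  - apply (is_derive_ext_loc (fun a => pure_F (beta g) (TA g / T) a + saha_ratio g T * h T a)).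
    + assert (L : locally a (fun x => 0 < x < dl)).
      { apply (open_and (fun x => 0 < x) (fun x => x < dl) (open_gt 0) (open_lt dl)). exact Ha. }
      revert L. apply filter_imp. intros x Hx. unfold inflection_F.
      rewrite (H2 x Hx), Ff_pure_state. reflexivity.
    + apply (is_derive_plus (pure_F (beta g) (TA g / T)) (fun a => saha_ratio g T * h T a)).
      * apply is_derive_pure_F.
      * exact (is_derive_scal _ _ _ _ D1).
  - apply (is_derive_plus (pure_F1 (beta g) (TA g / T)) (fun a => saha_ratio g T * h1 T a)).
    + apply is_derive_pure_F1.
    + exact (is_derive_scal _ _ _ _ D2).
  - match goal with |- Rabs ?u <= _ => replace u with (saha_ratio g T * h2 T a) by ring end.
    apply Hsmall, B2.
Qed.

(* [pure_F] at [a = c h^3/beta], [n = 1/h]: tends to [2 c - 120]. *)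
Definition scaled_cube (b c h : R) : R :=
  let a := c * h ^ 3 / b in
  let ka := 2 - (1 - b) * a in
  let P := ka + (1 + 5 / 2 * h) * c * h ^ 2 * (1 - a) in
  let Y := 5 / 2 * ka + (1 + 5 / 2 * h) ^ 2 * c * h * (1 - a) in
  let Z := 3 / 2 * ka + (1 + 3 * h + 15 / 4 * h ^ 2) * c * h * (1 - a) in
  - 2 * c * h * (1 - a) * P ^ 2 + c * (1 - a) * (1 + b * a) * (2 - 4 * a + (1 - b) * a ^ 2)
  - Y * Z * (Y + Z).

(* [h pure_F] at [a = h^2/beta], [n = 1/h]: tends to [2]. *)
Definition scaled_square (b h : R) : R :=
  let a := h ^ 2 / b in
  let ka := 2 - (1 - b) * a in
  let P := ka + (1 + 5 / 2 * h) * h * (1 - a) in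
  let Y := 5 / 2 * ka + (1 + 5 / 2 * h) ^ 2 * (1 - a) in
  let Z := 3 / 2 * ka + (1 + 3 * h + 15 / 4 * h ^ 2) * (1 - a) in
  - 2 * h * (1 - a) * P ^ 2 + (1 - a) * (1 + b * a) * (2 - 4 * a + (1 - b) * a ^ 2)
  - h * (Y * Z * (Y + Z)).

(* [k^3 pure_F] at [a = c k^3/beta], [n = 1/k^2]: tends to [2 c - 2 c^3]. *)
Definition scaled_threehalves (b c k : R) : R :=
  let a := c * k ^ 3 / b in
  let ka := 2 - (1 - b) * a in
  let P := ka + (1 + 5 / 2 * k ^ 2) * c * k * (1 - a) in
  let Y := 5 / 2 * ka * k + (1 + 5 / 2 * k ^ 2) ^ 2 * c * (1 - a) in
  let Z := 3 / 2 * ka * k + (1 + 3 * k ^ 2 + 15 / 4 * k ^ 4) * c * (1 - a) in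
  - 2 * c * k ^ 2 * (1 - a) * P ^ 2 + c * (1 - a) * (1 + b * a) * (2 - 4 * a + (1 - b) * a ^ 2)
  - Y * Z * (Y + Z).

Lemma pure_F_scaled_cube (b c h : R) : b <> 0 -> h <> 0 ->
  pure_F b (/ h) (c * h ^ 3 / b) = scaled_cube b c h.
Proof. intros Hb Hh. unfold pure_F, scaled_cube, Ef. cbv zeta. field. split; assumption. Qed.

Lemma pure_F_scaled_square (b h : R) : b <> 0 -> h <> 0 ->
  h * pure_F b (/ h) (h ^ 2 / b) = scaled_square b h.
Proof. intros Hb Hh. unfold pure_F, scaled_square, Ef. cbv zeta. field. split; assumption. Qed.

Lemma pure_F_scaled_threehalves (b c k : R) : b <> 0 -> k <> 0 ->
  k ^ 3 * pure_F b (/ k ^ 2) (c * k ^ 3 / b) = scaled_threehalves b c k.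
Proof. intros Hb Hh. unfold pure_F, scaled_threehalves, Ef. cbv zeta. field. split; assumption. Qed.

(** The signs - + - give a root on each side of [x1]; strict concavity makes f positive strictly
    between any two points where it is nonnegative, which fixes the sign everywhere else. *)
Lemma concave_two_roots (f f1 f2 : R -> R) (L x0 x1 x2 : R) :
  (forall a, 0 < a < L -> is_derive f a (f1 a) /\ is_derive f1 a (f2 a) /\ f2 a < 0) ->
  0 < x0 -> x0 < x1 -> x1 < x2 -> x2 < L ->
  f x0 < 0 -> 0 < f x1 -> f x2 < 0 ->
  exists r1 r2, x0 < r1 < x1 /\ x1 < r2 < x2 /\ f r1 = 0 /\ f r2 = 0 /\
    (forall a, 0 < a < r1 -> f a < 0) /\ (forall a, r1 < a < r2 -> 0 < f a) /\
    (forall a, r2 < a < L -> f a < 0).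
Proof.
  intros H H0 H01 H12 H2 F0 F1 F2.
  assert (Hc : forall x, 0 < x < L -> continuity_pt f x).
  { intros x Hx. apply continuity_pt_filterlim. apply (ex_derive_continuous f).
    exists (f1 x). apply H, Hx. }
  assert (Hconc : forall x y z, 0 < x -> x < y -> y < z -> z < L ->
     0 <= f x -> 0 <= f z -> 0 < f y).
  { intros x y z Hx Hxy Hyz Hz Fx Fz. destruct (Rlt_le_dec 0 (f y)) as [|Fy]; [assumption|].
    destruct (MVT_gen f x y f1) as [c1 [Hc1 E1]].
    { rewrite Rmin_left, Rmax_right by lra. intros u Hu. apply H. lra. }
    { rewrite Rmin_left, Rmax_right by lra. intros u Hu. apply Hc. lra. }
    destruct (MVT_gen f y z f1) as [c2 [Hc2 E2]].
    { rewrite Rmin_left, Rmax_right by lra. intros u Hu. apply H. lra. }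
    { rewrite Rmin_left, Rmax_right by lra. intros u Hu. apply Hc. lra. }
    rewrite Rmin_left, Rmax_right in Hc1, Hc2 by lra.
    assert (D : forall u v, 0 < u -> u < v -> v < L -> f1 v < f1 u).
    { apply (strictly_decreasing f1 f2 0 L); intros; apply H; assumption. }
    assert (S1 : f1 c1 <= 0) by nra.
    assert (S2 : 0 <= f1 c2) by nra.
    destruct (Rlt_le_dec c1 c2) as [Hlt|Hle].
    - specialize (D c1 c2 ltac:(lra) Hlt ltac:(lra)). lra.
    (* The mean value points may be endpoints. In this degenerate case f vanishes at x and y with
       zero slope at y; splitting [x, y] at its midpoint gives the contradiction. *)
    - assert (c1 = y) by lra. assert (c2 = y) by lra. subst c1 c2.
      assert (f1 y = 0) by lra. assert (f x = 0) by nra. assert (f y = 0) by nra.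
      destruct (MVT_gen f x ((x + y) / 2) f1) as [c3 [Hc3 E3]].
      { rewrite Rmin_left, Rmax_right by lra. intros u Hu. apply H. lra. }
      { rewrite Rmin_left, Rmax_right by lra. intros u Hu. apply Hc. lra. }
      destruct (MVT_gen f ((x + y) / 2) y f1) as [c4 [Hc4 E4]].
      { rewrite Rmin_left, Rmax_right by lra. intros u Hu. apply H. lra. }
      { rewrite Rmin_left, Rmax_right by lra. intros u Hu. apply Hc. lra. }
      rewrite Rmin_left, Rmax_right in Hc3, Hc4 by lra.
      pose proof (D c3 y ltac:(lra) ltac:(lra) ltac:(lra)) as D3.
      destruct (Rlt_le_dec c4 y) as [Hc4'|Hc4'].
      + pose proof (D c4 y ltac:(lra) ltac:(lra) ltac:(lra)) as D4. nra.
      + assert (c4 = y) by lra. subst c4. nra. }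
  destruct (Ranalysis5.IVT_interv f x0 x1) as [r1 [Hr1 E1]]; [|lra|lra|lra|].
  { intros; apply Hc; lra. }
  destruct (Ranalysis5.IVT_interv (fun x => - f x) x1 x2) as [r2 [Hr2 E2]]; [|lra|lra|lra|].
  { intros; apply continuity_pt_opp, Hc; lra. }
  assert (E2' : f r2 = 0) by lra.
  assert (r1 <> x0) by (intros ->; lra). assert (r1 <> x1) by (intros ->; lra).
  assert (r2 <> x1) by (intros ->; lra). assert (r2 <> x2) by (intros ->; lra).
  exists r1, r2. repeat split; try lra.
  - intros a Ha. destruct (Rlt_le_dec (f a) 0) as [|Fa]; [assumption|].
    pose proof (Hconc a r1 r2). lra.
  - intros a Ha. apply (Hconc r1 a r2); lra.
  - intros a Ha. destruct (Rlt_le_dec (f a) 0) as [|Fa]; [assumption|].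
    pose proof (Hconc r1 r2 a). lra.
Qed.

(** * The two branches *)

(** The tolerance |c - 60| is half of the limit's modulus, so it fixes the sign and leaves a margin
    of the same size. *)
Lemma scaled_cube_limit (b c : R) : 0 < b ->
  at_right 0 (fun h => Rabs (scaled_cube b c h - (2 * c - 120)) < Rabs (c - 60) \/ c = 60).
Proof.
  intros Hb. destruct (Req_dec c 60) as [->|Hc].
  { apply filter_forall. intros; right; reflexivity. }
  assert (Hd : ex_derive (scaled_cube b c) 0) by (unfold scaled_cube; auto_derive; lra).
  assert (H0 : scaled_cube b c 0 = 2 * c - 120) by (unfold scaled_cube; field; lra).
  assert (Hpos : 0 < Rabs (c - 60)) by (apply Rabs_pos_lt; lra).
  apply filter_le_within.
  generalize (proj1 (filterlim_locally _ _) (ex_derive_continuous _ _ Hd) (mkposreal _ Hpos)).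
  apply filter_imp. intros h Hh. left. rewrite <- H0. exact Hh.
Qed.

Section Branches.

Context (g : gas) (Hg : positive_gas g).

Notation F := (inflection_F g).
Let b := beta g.
Let Hb : 0 < b < 1.
Proof. destruct Hg as (_ & _ & _ & _ & H & _). exact H. Qed.
Let HTA : 0 < TA g.
Proof. destruct Hg as (_ & _ & _ & _ & _ & H & _). exact H. Qed.

(** A margin [m] independent of T survives the approximation error, which is at most T. The boolean
    selects the sign. *)
Lemma inflection_F_sign (x : R -> R) (m : R) (s : bool) :
  0 < m ->
  at_right 0 (fun T => 0 < x T < 1 / 2 /\
    (if s then m <= pure_F b (TA g / T) (x T) else pure_F b (TA g / T) (x T) <= - m)) ->
  at_right 0 (fun T => if s then 0 < F T (x T) else F T (x T) < 0).
Proof.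
  intros Hm Hx. destruct (inflection_F_approx g (1 / 2) Hg ltac:(lra)) as [F1 [F2 H]].
  generalize (filter_and _ _ (filter_and _ _ H Hx) (at_right_lt 0 m Hm)).
  apply filter_imp. intros T [[H1 [H2 H3]] HT].
  destruct (H1 _ H2) as [H4 _]. fold b in H4. apply Rabs_le_between in H4.
  destruct s; lra.
Qed.

Lemma at_right_continuous_small (u : R -> R) (c e : R) :
  0 < c -> 0 < e -> ex_derive u 0 -> u 0 = 0 -> at_right 0 (fun T => u (T / c) < e).
Proof.
  intros Hc He Hu H0. apply (at_right_scale (fun h => u h < e) c Hc).
  apply filter_le_within. apply (ex_derive_continuous u 0 Hu (fun y => y < e)).
  apply (open_lt e). lra.
Qed.

(** Test points: the first and third families bracket the branches as c passes 60 and 1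
    respectively, and [pt_square] lies between the two scales, where F > 0. *)
Let pt_cube (c T : R) : R := c * (T / TA g) ^ 3 / b.
Let pt_square (T : R) : R := (T / TA g) ^ 2 / b.
Let pt_threehalves (c T : R) : R := c * sqrt (T / TA g) ^ 3 / b.

Lemma pt_cube_range (c e : R) : 0 < c -> 0 < e -> at_right 0 (fun T => 0 < pt_cube c T < e).
Proof.
  intros Hc He.
  assert (L : at_right 0 (fun T => (fun h => c * h ^ 3 / b) (T / TA g) < e)).
  { apply (at_right_continuous_small (fun h => c * h ^ 3 / b) (TA g) e); try assumption; [auto_derive; trivial|simpl; field; lra]. }
  generalize (filter_and _ _ L (at_right_lt 0 1 Rlt_0_1)).
  apply filter_imp. intros T [H HT]. split; [|exact H]. unfold pt_cube.
  assert (0 < T / TA g) by (apply Rdiv_lt_0_compat; lra). positivity.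
Qed.

Lemma pt_square_range (e : R) : 0 < e -> at_right 0 (fun T => 0 < pt_square T < e).
Proof.
  intros He.
  assert (L : at_right 0 (fun T => (fun h => h ^ 2 / b) (T / TA g) < e)).
  { apply (at_right_continuous_small (fun h => h ^ 2 / b) (TA g) e); try assumption; [auto_derive; trivial|simpl; field; lra]. }
  generalize (filter_and _ _ L (at_right_lt 0 1 Rlt_0_1)).
  apply filter_imp. intros T [H HT]. split; [|exact H]. unfold pt_square.
  assert (0 < T / TA g) by (apply Rdiv_lt_0_compat; lra). positivity.
Qed.

Lemma pt_threehalves_range (c e : R) : 0 < c -> 0 < e -> at_right 0 (fun T => 0 < pt_threehalves c T < e).
Proof.
  intros Hc He.
  assert (L : at_right 0 (fun k => 0 < c * k ^ 3 / b < e)).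
  { assert (L : at_right 0 (fun k => (fun h => c * h ^ 3 / b) (k / 1) < e)).
    { apply (at_right_continuous_small (fun h => c * h ^ 3 / b) 1 e); try lra; auto_derive; trivial. }
    generalize (filter_and _ _ L (at_right_lt 0 1 Rlt_0_1)).
    apply filter_imp. intros k [H Hk]. rewrite Rdiv_1_r in H. split; [|exact H]. positivity. }
  exact (at_right_scale _ _ HTA (at_right_sqrt _ L)).
Qed.

Lemma pure_F_pt_cube (c : R) : 0 < c -> c <> 60 ->
  at_right 0 (fun T => Rabs (pure_F b (TA g / T) (pt_cube c T) - (2 * c - 120)) < Rabs (c - 60)).
Proof.
  intros Hc Hc60.
  generalize (filter_and _ _ (at_right_scale _ _ HTA (scaled_cube_limit b c (proj1 Hb)))
    (at_right_lt 0 1 Rlt_0_1)).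
  apply filter_imp. intros T [[H|H] HT]; [|contradiction].
  assert (0 < T / TA g) by (apply Rdiv_lt_0_compat; lra).
  rewrite <- pure_F_scaled_cube in H by lra.
  replace (/ (T / TA g)) with (TA g / T) in H by (field; lra). exact H.
Qed.

Lemma F_pt_cube_neg (c : R) : 0 < c < 60 -> at_right 0 (fun T => F T (pt_cube c T) < 0).
Proof.
  intros Hc. apply (inflection_F_sign (pt_cube c) (60 - c) false); [lra|].
  assert (R1 : at_right 0 (fun T => 0 < pt_cube c T < 1 / 2)) by (apply pt_cube_range; lra).
  assert (R2 := pure_F_pt_cube c ltac:(lra) ltac:(lra)).
  generalize (filter_and _ _ R1 R2).
  apply filter_imp. intros T [H1 H2]. split; [exact H1|].
  rewrite (Rabs_left (c - 60)) in H2 by lra. apply Rabs_def2 in H2. lra.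
Qed.

Lemma F_pt_cube_pos (c : R) : 60 < c -> at_right 0 (fun T => 0 < F T (pt_cube c T)).
Proof.
  intros Hc. apply (inflection_F_sign (pt_cube c) (c - 60) true); [lra|].
  assert (R1 : at_right 0 (fun T => 0 < pt_cube c T < 1 / 2)) by (apply pt_cube_range; lra).
  assert (R2 := pure_F_pt_cube c ltac:(lra) ltac:(lra)).
  generalize (filter_and _ _ R1 R2).
  apply filter_imp. intros T [H1 H2]. split; [exact H1|].
  rewrite (Rabs_right (c - 60)) in H2 by lra. apply Rabs_def2 in H2. lra.
Qed.

Lemma F_pt_square_pos : at_right 0 (fun T => 0 < F T (pt_square T)).
Proof.
  apply (inflection_F_sign pt_square 1 true); [lra|].
  assert (L : at_right 0 (fun h => 0 < scaled_square b h - 1)).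
  { apply at_right_positive.
    - unfold scaled_square. auto_derive. lra.
    - replace (scaled_square b 0) with 2 by (unfold scaled_square; field; lra). lra. }
  assert (R1 : at_right 0 (fun T => 0 < pt_square T < 1 / 2)) by (apply pt_square_range; lra).
  generalize (filter_and _ _ R1 (filter_and _ _ (at_right_scale _ _ HTA L) (at_right_lt 0 (TA g) HTA))).
  apply filter_imp. intros T (H1 & H2 & HT). split; [exact H1|].
  assert (Hh : 0 < T / TA g) by (apply Rdiv_lt_0_compat; lra).
  assert (Hh1 : T / TA g < 1) by (apply Rlt_div_l; lra).
  rewrite <- pure_F_scaled_square in H2 by lra.
  replace (/ (T / TA g)) with (TA g / T) in H2 by (field; lra).
  fold (pt_square T) in H2. nra.
Qed.

Lemma pure_F_pt_threehalves (c : R) (s : bool) : 0 < c ->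
  (if s then c < 1 else 1 < c) ->
  let m := Rabs (c - c ^ 3) in
  at_right 0 (fun T => if s then m <= pure_F b (TA g / T) (pt_threehalves c T)
                       else pure_F b (TA g / T) (pt_threehalves c T) <= - m).
Proof.
  intros Hc Hs m.
  assert (Hm : if s then m = c - c ^ 3 /\ 0 < m else m = c ^ 3 - c /\ 0 < m).
  { unfold m. destruct s.
    - assert (0 < c - c ^ 3) by nra. rewrite Rabs_right by lra. lra.
    - assert (c - c ^ 3 < 0) by nra. rewrite Rabs_left by lra. lra. }
  assert (H0 : scaled_threehalves b c 0 = 2 * c - 2 * c ^ 3) by (unfold scaled_threehalves; field; lra).
  (* [m] is half of the limit's modulus; since k^3 < 1, a bound m on k^3 F passes to F itself. *)
  assert (L : at_right 0 (fun k => if s then 0 < scaled_threehalves b c k - m else 0 < - m - scaled_threehalves b c k)).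
  { destruct s.
    - apply (at_right_positive (fun k => scaled_threehalves b c k - m)); [|rewrite H0; lra].
      unfold scaled_threehalves; auto_derive; lra.
    - apply (at_right_positive (fun k => - m - scaled_threehalves b c k)); [|rewrite H0; lra].
      unfold scaled_threehalves; auto_derive; lra. }
  generalize (filter_and _ _ (at_right_scale _ _ HTA (at_right_sqrt _ L)) (at_right_lt 0 (TA g) HTA)).
  apply filter_imp. intros T [H2 HT].
  assert (Hh : 0 < T / TA g) by (apply Rdiv_lt_0_compat; lra).
  assert (Hh1 : T / TA g < 1) by (apply Rlt_div_l; lra).
  pose proof (sqrt_lt_R0 _ Hh) as Hk.
  assert (Hk1 : sqrt (T / TA g) < 1) by (rewrite <- sqrt_1; apply sqrt_lt_1; lra).
  rewrite <- pure_F_scaled_threehalves in H2 by lra.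
  rewrite pow2_sqrt in H2 by lra.
  replace (/ (T / TA g)) with (TA g / T) in H2 by (field; lra).
  fold (pt_threehalves c T) in H2.
  assert (Hk3 : 0 < sqrt (T / TA g) ^ 3 < 1).
  { split; [apply pow_lt, Hk|]. simpl. set (k := sqrt (T / TA g)) in *. nra. }
  set (k3 := sqrt (T / TA g) ^ 3) in *. set (G := pure_F b (TA g / T) (pt_threehalves c T)) in *.
  destruct s; destruct Hm as [_ Hm].
  - assert (0 < G) by nra. nra.
  - assert (G < 0) by nra. nra.
Qed.

Lemma F_pt_threehalves_pos (c : R) : 0 < c < 1 -> at_right 0 (fun T => 0 < F T (pt_threehalves c T)).
Proof.
  intros Hc. apply (inflection_F_sign (pt_threehalves c) (Rabs (c - c ^ 3)) true).
  { apply Rabs_pos_lt. nra. }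
  assert (R1 : at_right 0 (fun T => 0 < pt_threehalves c T < 1 / 2)) by (apply pt_threehalves_range; lra).
  exact (filter_and _ _ R1 (pure_F_pt_threehalves c true ltac:(lra) ltac:(lra))).
Qed.

Lemma F_pt_threehalves_neg (c : R) : 1 < c -> at_right 0 (fun T => F T (pt_threehalves c T) < 0).
Proof.
  intros Hc. apply (inflection_F_sign (pt_threehalves c) (Rabs (c - c ^ 3)) false).
  { apply Rabs_pos_lt. nra. }
  assert (R1 : at_right 0 (fun T => 0 < pt_threehalves c T < 1 / 2)) by (apply pt_threehalves_range; lra).
  exact (filter_and _ _ R1 (pure_F_pt_threehalves c false ltac:(lra) ltac:(lra))).
Qed.

(** With h = T/TA the successive ratios are c h and sqrt h / c', both tending to 0. *)
Lemma points_ordered (c c' : R) : 0 < c -> 0 < c' ->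
  at_right 0 (fun T => pt_cube c T < pt_square T < pt_threehalves c' T).
Proof.
  intros Hc Hc'.
  assert (Hic : 0 < / (c + 1)) by (apply Rinv_0_lt_compat; lra).
  assert (L1 : at_right 0 (fun T => T / TA g < / (c + 1))).
  { apply (at_right_continuous_small (fun h => h)); try assumption; [|reflexivity].
    apply ex_derive_id. }
  assert (L2 : at_right 0 (fun T => sqrt (T / TA g) < c')).
  { apply (at_right_scale (fun h => sqrt h < c') _ HTA).
    apply (at_right_sqrt (fun k => k < c')). generalize (at_right_lt 0 c' Hc').
    apply filter_imp. intros; lra. }
  generalize (filter_and _ _ (filter_and _ _ L1 L2) (at_right_lt 0 1 Rlt_0_1)).
  apply filter_imp. intros T [[H1 H2] HT].
  assert (Hh : 0 < T / TA g) by (apply Rdiv_lt_0_compat; lra).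
  pose proof (sqrt_lt_R0 _ Hh) as Hk. pose proof (pow2_sqrt _ (Rlt_le _ _ Hh)) as Hk2.
  assert (Hch : c * (T / TA g) < 1).
  { apply (Rmult_lt_compat_l (c + 1)) in H1; [|lra]. rewrite Rinv_r in H1 by lra. lra. }
  unfold pt_cube, pt_square, pt_threehalves.
  assert (Hib : 0 < / b) by (apply Rinv_0_lt_compat; lra).
  set (k := sqrt (T / TA g)) in *. clearbody k. rewrite <- Hk2 in *.
  split; apply Rmult_lt_compat_r; try exact Hib.
  - replace (c * (k ^ 2) ^ 3) with (c * k ^ 2 * (k ^ 2) ^ 2) by ring.
    assert (0 < (k ^ 2) ^ 2) by (positivity). nra.
  - replace ((k ^ 2) ^ 2) with (k * k ^ 3) by ring. apply Rmult_lt_compat_r; [positivity|exact H2].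
Qed.

Lemma F_concave :
  exists F1 F2 : R -> R -> R, at_right 0 (fun T => forall a, 0 < a < 1 / 10 ->
    is_derive (F T) a (F1 T a) /\ is_derive (F1 T) a (F2 T a) /\ F2 T a < 0).
Proof.
  destruct (inflection_F_approx g (1 / 10) Hg ltac:(lra)) as [F1 [F2 H]].
  exists F1, F2.
  (* The last two entries give n >= 100 and b n >= 1000; the first keeps the error below the margin
     1 in [pure_F2 <= - 1]. *)
  assert (Hsmall : 0 < Rmin (1 / 2) (Rmin (TA g / 100) (b * TA g / 1000))).
  { repeat apply Rmin_pos; try lra. apply Rdiv_lt_0_compat; [|lra]. apply Rmult_lt_0_compat; lra. }
  generalize (filter_and _ _ H (at_right_lt 0 _ Hsmall)).
  apply filter_imp. intros T [H1 HT] a Ha. destruct (H1 a Ha) as (_ & D1 & D2 & B2).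
  split; [exact D1|split; [exact D2|]].
  pose proof (Rmin_l (1 / 2) (Rmin (TA g / 100) (b * TA g / 1000))).
  pose proof (Rmin_r (1 / 2) (Rmin (TA g / 100) (b * TA g / 1000))).
  pose proof (Rmin_l (TA g / 100) (b * TA g / 1000)).
  pose proof (Rmin_r (TA g / 100) (b * TA g / 1000)).
  assert (pure_F2 b (TA g / T) a <= - 1).
  { apply pure_F2_negative; try assumption.
    - apply -> Rle_div_r; lra.
    - replace (b * (TA g / T)) with (b * TA g / T) by (field; lra).
      apply -> Rle_div_r; lra. }
  apply Rabs_le_between in B2. fold b in B2. lra.
Qed.

Lemma F_tail (dl : R) : 1 / 20 < dl < 1 ->
  at_right 0 (fun T => forall a, 1 / 20 <= a < dl -> F T a < 0).
Proof.
  intros Hdl. destruct (inflection_F_approx g dl Hg ltac:(lra)) as [F1 [F2 H]].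
  (* A lower bound for b a (1 - a) on [1/20, dl), obtained factor by factor. *)
  remember (b * (1 / 20 * (1 - dl))) as a0 eqn:Ea0.
  assert (Ha0 : 0 < a0) by (rewrite Ea0; positivity).
  assert (Ha02 : 0 < a0 ^ 2) by (apply pow_lt, Ha0).
  assert (Ha03 : 0 < a0 ^ 2 / 2) by lra.
  assert (L : forall m, 0 < m -> at_right 0 (fun T => (T / TA g) ^ 3 < m)).
  { intros m Hm. apply (at_right_continuous_small (fun h => h ^ 3)); try assumption.
    - auto_derive; trivial.
    - simpl; ring. }
  generalize (filter_and _ _ (filter_and _ _ H (at_right_lt 0 1 Rlt_0_1))
    (filter_and _ _ (L a0 Ha0) (L (a0 ^ 2 / 2) Ha03))).
  apply filter_imp. intros T [[H1 HT] [L1 L2]] a Ha.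
  destruct (H1 a ltac:(lra)) as [B0 _]. apply Rabs_le_between in B0. fold b in B0.
  assert (Hh : 0 < T / TA g) by (apply Rdiv_lt_0_compat; lra).
  assert (Hn : TA g / T = / (T / TA g)) by (field; lra).
  assert (Hh3 : 0 < (T / TA g) ^ 3) by (apply pow_lt, Hh).
  assert (pure_F b (TA g / T) a <= - 1).
  { apply (pure_F_tail b (TA g / T) a0 a); try lra.
    - rewrite Hn. apply Rinv_0_lt_compat, Hh.
    - split; [exact Ha0|]. rewrite Ea0. apply Rmult_le_compat_l; [lra|].
      apply Rmult_le_compat; lra.
    - rewrite Hn, pow_inv.
      apply (Rmult_le_reg_l ((T / TA g) ^ 3)); [exact Hh3|].
      rewrite <- Rmult_assoc, Rinv_r by lra. lra.
    - rewrite Hn, pow_inv.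
      apply (Rmult_le_reg_l ((T / TA g) ^ 3)); [exact Hh3|].
      rewrite <- Rmult_assoc, Rinv_r by lra. lra. }
  lra.
Qed.

(** [pt_square] serves as the separator that tells the two roots apart. For T where no such root
    exists the value is arbitrary; only small T matters. *)
Definition branch1 (T : R) : R :=
  epsilon (inhabits 0) (fun r => 0 < r < pt_square T /\ F T r = 0).

Definition branch2 (T : R) : R :=
  epsilon (inhabits 0) (fun r => pt_square T < r < 1 / 10 /\ F T r = 0).

Definition two_branches (T : R) : Prop :=
  0 < branch1 T /\ branch1 T < branch2 T /\ branch2 T < 1 / 10 /\
  branch1 T < pt_square T < branch2 T /\ F T (branch1 T) = 0 /\ F T (branch2 T) = 0 /\
  (forall a, 0 < a < branch1 T -> F T a < 0) /\
  (forall a, branch1 T < a < branch2 T -> 0 < F T a) /\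
  (forall a, branch2 T < a < 1 / 10 -> F T a < 0).

(** The constants 30 < 60 and 2 > 1 only provide negative values on either side of [pt_square]. The
    sign pattern then identifies the chosen roots with those of [concave_two_roots]. *)
Lemma two_branches_eventually : at_right 0 two_branches.
Proof.
  destruct F_concave as [F1 [F2 HF]].
  assert (N0 : at_right 0 (fun T => F T (pt_cube 30 T) < 0)) by (apply F_pt_cube_neg; lra).
  assert (N2 : at_right 0 (fun T => F T (pt_threehalves 2 T) < 0)) by (apply F_pt_threehalves_neg; lra).
  assert (R0 : at_right 0 (fun T => 0 < pt_cube 30 T < 1)) by (apply pt_cube_range; lra).
  assert (R2 : at_right 0 (fun T => 0 < pt_threehalves 2 T < 1 / 10)) by (apply pt_threehalves_range; lra).
  assert (O : at_right 0 (fun T => pt_cube 30 T < pt_square T < pt_threehalves 2 T)) by (apply points_ordered; lra).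
  generalize (filter_and _ _ HF (filter_and _ _ (filter_and _ _ N0 (filter_and _ _ F_pt_square_pos N2))
    (filter_and _ _ O (filter_and _ _ R0 R2)))).
  apply filter_imp. intros T (H & (G0 & G1 & G2) & (O1 & O2) & (P0 & _) & (_ & P2)).
  destruct (concave_two_roots (F T) (F1 T) (F2 T) (1 / 10) (pt_cube 30 T) (pt_square T) (pt_threehalves 2 T) H P0 O1 O2 P2
    G0 G1 G2) as (r1 & r2 & Hr1 & Hr2 & E1 & E2 & S1 & S2 & S3).
  assert (B1 : branch1 T = r1).
  { assert (Hex : exists r, 0 < r < pt_square T /\ F T r = 0) by (exists r1; lra).
    pose proof (epsilon_spec (inhabits 0) _ Hex) as [Hx Ex]. fold (branch1 T) in Hx, Ex.
    destruct (Rtotal_order (branch1 T) r1) as [Hlt|[Heq|Hgt]]; [|exact Heq|].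
    - specialize (S1 (branch1 T) ltac:(lra)). lra.
    - specialize (S2 (branch1 T) ltac:(lra)). lra. }
  assert (B2 : branch2 T = r2).
  { assert (Hex : exists r, pt_square T < r < 1 / 10 /\ F T r = 0) by (exists r2; lra).
    pose proof (epsilon_spec (inhabits 0) _ Hex) as [Hx Ex]. fold (branch2 T) in Hx, Ex.
    destruct (Rtotal_order (branch2 T) r2) as [Hlt|[Heq|Hgt]]; [|exact Heq|].
    - specialize (S2 (branch2 T) ltac:(lra)). lra.
    - specialize (S3 (branch2 T) ltac:(lra)). lra. }
  unfold two_branches. rewrite B1, B2.
  repeat split; try assumption; lra.
Qed.

(** A point below [branch2] where F < 0 lies left of [branch1]; a point of (0, 1/10) where F > 0
    lies right of it. *)
Lemma branch1_bounds (c c' : R) : 0 < c < 60 -> 60 < c' ->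
  at_right 0 (fun T => pt_cube c T < branch1 T < pt_cube c' T).
Proof.
  intros Hc Hc'.
  assert (N : at_right 0 (fun T => F T (pt_cube c T) < 0)) by (apply F_pt_cube_neg; lra).
  assert (P : at_right 0 (fun T => 0 < F T (pt_cube c' T))) by (apply F_pt_cube_pos; lra).
  assert (O : at_right 0 (fun T => pt_cube c T < pt_square T < pt_threehalves 1 T)) by (apply points_ordered; lra).
  assert (R0 : at_right 0 (fun T => 0 < pt_cube c' T < 1 / 10)) by (apply pt_cube_range; lra).
  generalize (filter_and _ _ two_branches_eventually
    (filter_and _ _ (filter_and _ _ N P) (filter_and _ _ O R0))).
  apply filter_imp.
  intros T ((B0 & B1 & B2 & (Bm1 & Bm2) & E1 & E2 & S1 & S2 & S3) & (GN & GP) & (O1 & _) & HR).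
  split.
  - destruct (Rtotal_order (pt_cube c T) (branch1 T)) as [Hlt|[Heq|Hgt]]; [exact Hlt| |].
    + rewrite Heq in GN. lra.
    + specialize (S2 (pt_cube c T) ltac:(lra)). lra.
  - destruct (Rtotal_order (branch1 T) (pt_cube c' T)) as [Hlt|[Heq|Hgt]]; [exact Hlt| |].
    + rewrite <- Heq in GP. lra.
    + specialize (S1 (pt_cube c' T) ltac:(lra)). lra.
Qed.

Lemma branch2_bounds (c c' : R) : 0 < c < 1 -> 1 < c' ->
  at_right 0 (fun T => pt_threehalves c T < branch2 T < pt_threehalves c' T).
Proof.
  intros Hc Hc'.
  assert (P : at_right 0 (fun T => 0 < F T (pt_threehalves c T))) by (apply F_pt_threehalves_pos; lra).
  assert (N : at_right 0 (fun T => F T (pt_threehalves c' T) < 0)) by (apply F_pt_threehalves_neg; lra).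
  assert (O : at_right 0 (fun T => pt_cube 1 T < pt_square T < pt_threehalves c' T)) by (apply points_ordered; lra).
  assert (R0 : at_right 0 (fun T => 0 < pt_threehalves c T < 1 / 10)) by (apply pt_threehalves_range; lra).
  assert (R1 : at_right 0 (fun T => 0 < pt_threehalves c' T < 1 / 10)) by (apply pt_threehalves_range; lra).
  generalize (filter_and _ _ two_branches_eventually
    (filter_and _ _ (filter_and _ _ N P) (filter_and _ _ O (filter_and _ _ R0 R1)))).
  apply filter_imp.
  intros T ((B0 & B1 & B2 & (Bm1 & Bm2) & E1 & E2 & S1 & S2 & S3) & (GN & GP) & (_ & O1) & HR & HR').
  split.
  - destruct (Rtotal_order (pt_threehalves c T) (branch2 T)) as [Hlt|[Heq|Hgt]]; [exact Hlt| |].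
    + rewrite Heq in GP. lra.
    + specialize (S3 (pt_threehalves c T) ltac:(lra)). lra.
  - destruct (Rtotal_order (branch2 T) (pt_threehalves c' T)) as [Hlt|[Heq|Hgt]]; [exact Hlt| |].
    + rewrite <- Heq in GN. lra.
    + specialize (S2 (pt_threehalves c' T) ltac:(lra)). lra.
Qed.

(** Opposite signs of F just left and right of a branch persist for nearby T at fixed a, and the
    sign pattern forces the branch to stay between them. *)
Lemma continuous_branches (T0 T : R) :
  (forall T, 0 < T < T0 -> two_branches T) ->
  (forall T a, 0 < T -> 0 < a < 1 -> continuous (fun s => F s a) T) ->
  0 < T < T0 -> continuous branch1 T /\ continuous branch2 T.
Proof.
  intros HG HC HT.
  destruct (HG T HT) as (B0 & B1 & B2 & _ & E1 & E2 & S1 & S2 & S3).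
  assert (LT : locally T (fun s => 0 < s < T0)).
  { apply (open_and (fun x => 0 < x) (fun x => x < T0) (open_gt 0) (open_lt T0)). exact HT. }
  assert (Lneg : forall a, 0 < a < 1 -> F T a < 0 -> locally T (fun s => F s a < 0)).
  { intros a Ha Fa. apply (HC T a (proj1 HT) Ha (fun y => y < 0)). apply (open_lt 0). exact Fa. }
  assert (Lpos : forall a, 0 < a < 1 -> 0 < F T a -> locally T (fun s => 0 < F s a)).
  { intros a Ha Fa. apply (HC T a (proj1 HT) Ha (fun y => 0 < y)). apply (open_gt 0). exact Fa. }
  split; apply filterlim_locally; intros eps; pose proof (cond_pos eps) as He.
  (* Half the distances to 0 and to the other branch, so that [branch1 T - e] and [branch1 T + e]
     stay where the sign of F is known. *)
  - set (e := Rmin (eps / 2) (Rmin (branch1 T / 2) ((branch2 T - branch1 T) / 2))).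
    pose proof (Rmin_l (eps / 2) (Rmin (branch1 T / 2) ((branch2 T - branch1 T) / 2))) as M1.
    pose proof (Rmin_r (eps / 2) (Rmin (branch1 T / 2) ((branch2 T - branch1 T) / 2))) as M2.
    pose proof (Rmin_l (branch1 T / 2) ((branch2 T - branch1 T) / 2)) as M3.
    pose proof (Rmin_r (branch1 T / 2) ((branch2 T - branch1 T) / 2)) as M4.
    assert (Hpe : 0 < e) by (unfold e; repeat apply Rmin_pos; lra).
    fold e in M1, M2.
    assert (Ln := Lneg (branch1 T - e) ltac:(lra) (S1 (branch1 T - e) ltac:(lra))).
    assert (Lp := Lpos (branch1 T + e) ltac:(lra) (S2 (branch1 T + e) ltac:(lra))).
    generalize (filter_and _ _ LT (filter_and _ _ Ln Lp)). apply filter_imp.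
    intros s (Hs & Fn & Fp). destruct (HG s Hs) as (C0 & C1 & C2 & _ & D1 & D2 & U1 & U2 & U3).
    (* Needed before the lower bound: a negative value alone could also mean a point beyond
       [branch2 s]. *)
    assert (V1 : branch1 s < branch1 T + e < branch2 s).
    { split.
      - destruct (Rlt_le_dec (branch1 s) (branch1 T + e)) as [|[Hl|Hl]]; [assumption| |].
        + specialize (U1 (branch1 T + e) ltac:(lra)). lra.
        + rewrite Hl in Fp. lra.
      - destruct (Rlt_le_dec (branch1 T + e) (branch2 s)) as [|[Hl|Hl]]; [assumption| |].
        + specialize (U3 (branch1 T + e) ltac:(lra)). lra.
        + rewrite <- Hl in Fp. lra. }
    assert (V2 : branch1 T - e < branch1 s).
    { destruct (Rlt_le_dec (branch1 T - e) (branch1 s)) as [|[Hl|Hl]]; [assumption| |].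
      - specialize (U2 (branch1 T - e) ltac:(lra)). lra.
      - rewrite <- Hl in Fn. lra. }
    unfold ball; simpl; unfold AbsRing_ball, abs, minus, plus, opp; simpl.
    apply Rabs_def1; lra.
  - set (e := Rmin (eps / 2) (Rmin ((1 / 10 - branch2 T) / 2) ((branch2 T - branch1 T) / 2))).
    pose proof (Rmin_l (eps / 2) (Rmin ((1 / 10 - branch2 T) / 2) ((branch2 T - branch1 T) / 2))) as M1.
    pose proof (Rmin_r (eps / 2) (Rmin ((1 / 10 - branch2 T) / 2) ((branch2 T - branch1 T) / 2))) as M2.
    pose proof (Rmin_l ((1 / 10 - branch2 T) / 2) ((branch2 T - branch1 T) / 2)) as M3.
    pose proof (Rmin_r ((1 / 10 - branch2 T) / 2) ((branch2 T - branch1 T) / 2)) as M4.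
    assert (Hpe : 0 < e) by (unfold e; repeat apply Rmin_pos; lra).
    fold e in M1, M2.
    assert (Lp := Lpos (branch2 T - e) ltac:(lra) (S2 (branch2 T - e) ltac:(lra))).
    assert (Ln := Lneg (branch2 T + e) ltac:(lra) (S3 (branch2 T + e) ltac:(lra))).
    generalize (filter_and _ _ LT (filter_and _ _ Ln Lp)). apply filter_imp.
    intros s (Hs & Fn & Fp). destruct (HG s Hs) as (C0 & C1 & C2 & _ & D1 & D2 & U1 & U2 & U3).
    assert (V1 : branch1 s < branch2 T - e < branch2 s).
    { split.
      - destruct (Rlt_le_dec (branch1 s) (branch2 T - e)) as [|[Hl|Hl]]; [assumption| |].
        + specialize (U1 (branch2 T - e) ltac:(lra)). lra.
        + rewrite Hl in Fp. lra.
      - destruct (Rlt_le_dec (branch2 T - e) (branch2 s)) as [|[Hl|Hl]]; [assumption| |].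
        + specialize (U3 (branch2 T - e) ltac:(lra)). lra.
        + rewrite <- Hl in Fp. lra. }
    assert (V2 : branch2 s < branch2 T + e).
    { destruct (Rlt_le_dec (branch2 s) (branch2 T + e)) as [|[Hl|Hl]]; [assumption| |].
      - specialize (U2 (branch2 T + e) ltac:(lra)). lra.
      - rewrite Hl in Fn. lra. }
    unfold ball; simpl; unfold AbsRing_ball, abs, minus, plus, opp; simpl.
    apply Rabs_def1; lra.
Qed.

(** * Asymptotic equivalents of the branches *)

Definition sandwiched (f t : R -> R) : Prop :=
  forall e, 0 < e < 1 -> at_right 0 (fun T => 0 < t T /\ (1 - e) * t T <= f T <= (1 + e) * t T).

Lemma is_equiv_sandwiched (f t : R -> R) :
  sandwiched f t -> is_equiv (at_right 0) f t.
Proof.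
  intros H eps. pose proof (cond_pos eps) as He.
  assert (He' : 0 < Rmin eps (1 / 2) < 1).
  { split; [apply Rmin_pos; lra|]. pose proof (Rmin_r eps (1 / 2)). lra. }
  generalize (H _ He'). apply filter_imp. intros T [Ht HT].
  pose proof (Rmin_l eps (1 / 2)).
  unfold norm; simpl; unfold abs, minus, plus, opp; simpl.
  rewrite (Rabs_right (t T)) by lra. apply Rabs_le. nra.
Qed.

Lemma sandwiched_branch1 :
  sandwiched branch1 (fun T => 60 / beta g * (T / TA g) ^ 3).
Proof.
  intros e He.
  assert (L : at_right 0 (fun T => pt_cube (60 * (1 - e)) T < branch1 T < pt_cube (60 * (1 + e)) T))
    by (apply branch1_bounds; lra).
  generalize (filter_and _ _ L (at_right_lt 0 1 Rlt_0_1)).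
  apply filter_imp. intros T [H HT]. unfold pt_cube in H. fold b.
  assert (0 < T / TA g) by (apply Rdiv_lt_0_compat; lra).
  split; [positivity|].
  replace (60 * (1 - e) * (T / TA g) ^ 3 / b) with ((1 - e) * (60 / b * (T / TA g) ^ 3)) in H
    by (field; lra).
  replace (60 * (1 + e) * (T / TA g) ^ 3 / b) with ((1 + e) * (60 / b * (T / TA g) ^ 3)) in H
    by (field; lra). lra.
Qed.

Lemma sqrt_pow3 (x : R) : 0 < x -> sqrt x ^ 3 = Rpower x (3 / 2).
Proof.
  intros Hx. rewrite <- Rpower_sqrt by exact Hx. rewrite <- Rpower_pow by apply exp_pos.
  rewrite Rpower_mult. f_equal. simpl. field.
Qed.

Lemma sandwiched_branch2 :
  sandwiched branch2 (fun T => 1 / beta g * Rpower (T / TA g) (3 / 2)).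
Proof.
  intros e He.
  assert (L : at_right 0 (fun T => pt_threehalves (1 - e) T < branch2 T < pt_threehalves (1 + e) T))
    by (apply branch2_bounds; lra).
  generalize (filter_and _ _ L (at_right_lt 0 1 Rlt_0_1)).
  apply filter_imp. intros T [H HT]. unfold pt_threehalves in H. fold b.
  assert (Hh : 0 < T / TA g) by (apply Rdiv_lt_0_compat; lra).
  rewrite sqrt_pow3 in H by exact Hh.
  assert (Hp : 0 < Rpower (T / TA g) (3 / 2)) by apply exp_pos.
  set (w := Rpower (T / TA g) (3 / 2)) in *.
  split; [positivity|].
  replace ((1 - e) * w / b) with ((1 - e) * (1 / b * w)) in H by (field; lra).
  replace ((1 + e) * w / b) with ((1 + e) * (1 / b * w)) in H by (field; lra). lra.
Qed.

(** degB is exactly the Saha ratio times a times [degB_factor], and this factor tends to 1 with a.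
    The tolerances e/4 and e/2 are chosen so that (1 + e/4) (1 + e/2) <= 1 + e. *)
Lemma sandwiched_degB (f t : R -> R) :
  sandwiched f t -> (forall e, 0 < e -> at_right 0 (fun T => 0 < f T < e)) ->
  sandwiched (fun T => degB g T (f T)) (fun T => saha_ratio g T * t T).
Proof.
  intros Hf Hsmall e He.
  assert (L1 := Hf (e / 4) ltac:(lra)). assert (L2 := Hsmall (e / 4) ltac:(lra)).
  generalize (filter_and _ _ (filter_and _ _ L1 L2)
    (filter_and _ _ (saha_ratio_small g 0 Hg) (at_right_lt 0 1 Rlt_0_1))).
  apply filter_imp. intros T [[[Ht [H1 H2]] Hf2] [He1 HT]].
  simpl in He1. rewrite Rmult_1_r in He1.
  pose proof (saha_ratio_pos g T Hg) as Hpos.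
  split; [apply Rmult_lt_0_compat; assumption|].
  rewrite degB_saha by (assumption || lra).
  assert (Hr : 1 <= degB_factor g T (f T) <= 1 + e / 2).
  { unfold degB_factor. assert (0 < saha_ratio g T * f T) by (apply Rmult_lt_0_compat; lra).
    assert (saha_ratio g T * f T <= 1 * f T) by (apply Rmult_le_compat_r; lra).
    split.
    - rewrite <- Rinv_1 at 1. apply Rinv_le_contravar; lra.
    - apply (Rmult_le_reg_l (1 - f T + saha_ratio g T * f T)); [lra|].
      rewrite Rinv_r by lra. nra. }
  set (r := degB_factor g T (f T)) in *.
  assert (f T * 1 <= f T * r) by (apply Rmult_le_compat_l; lra).
  assert (f T * r <= (1 + e / 4) * t T * (1 + e / 2)) by (apply Rmult_le_compat; lra).
  assert ((1 + e / 4) * t T * (1 + e / 2) <= (1 + e) * t T).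
  { replace ((1 + e / 4) * t T * (1 + e / 2)) with ((1 + e / 4) * (1 + e / 2) * t T) by ring.
    apply Rmult_le_compat_r; nra. }
  assert ((1 - e) * t T <= (1 - e / 4) * t T) by (apply Rmult_le_compat_r; lra).
  split.
  - replace ((1 - e) * (saha_ratio g T * t T)) with (saha_ratio g T * ((1 - e) * t T)) by ring.
    apply Rmult_le_compat_l; lra.
  - replace ((1 + e) * (saha_ratio g T * t T)) with (saha_ratio g T * ((1 + e) * t T)) by ring.
    apply Rmult_le_compat_l; lra.
Qed.

Lemma branches_small (e : R) : 0 < e -> at_right 0 (fun T => 0 < branch1 T < branch2 T /\ branch2 T < e).
Proof.
  intros He.
  assert (L1 : at_right 0 (fun T => pt_threehalves (1 / 2) T < branch2 T < pt_threehalves 2 T)) by (apply branch2_bounds; lra).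
  assert (L2 : at_right 0 (fun T => 0 < pt_threehalves 2 T < e)) by (apply pt_threehalves_range; lra).
  generalize (filter_and _ _ two_branches_eventually (filter_and _ _ L1 L2)).
  apply filter_imp. intros T ((B0 & B1 & _) & H1 & H2). lra.
Qed.

End Branches.

(** * Continuity of F in T, and the conclusion *)

Definition state_continuous (X : R -> state) (s : R) : Prop :=
  continuous (fun r => x_n (X r)) s /\ continuous (fun r => x_q (X r)) s /\
  continuous (fun r => x_a (X r)) s /\ continuous (fun r => x_b (X r)) s /\
  continuous (fun r => x_al (X r)) s /\ continuous (fun r => x_A (X r)) s /\
  continuous (fun r => x_B (X r)) s /\ continuous (fun r => x_J (X r)) s /\
  continuous (fun r => x_d (X r)) s /\ continuous (fun r => x_ph (X r)) s.

Ltac split_continuous H :=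
  destruct H as (?Cn & ?Cq & ?Ca & ?Cb & ?Cal & ?CA & ?CB & ?CJ & ?Cd & ?Cph).

Lemma continuous_Ff (X : R -> state) (s : R) :
  state_continuous X s -> continuous (fun r => Ff (X r)) s.
Proof.
  intros HX.
  assert (CP : continuous (fun r => Pf (X r)) s).
  { split_continuous HX. unfold Pf. continuity_side. }
  assert (CN : continuous (fun r => Nf (X r)) s).
  { split_continuous HX. unfold Nf. continuity_side. }
  assert (CY : continuous (fun r => Yf (X r)) s).
  { split_continuous HX. unfold Yf. continuity_side. }
  assert (CZ : continuous (fun r => Zf (X r)) s).
  { split_continuous HX. unfold Zf, Ef. continuity_side. }
  assert (CV : state_continuous (fun r => isentropic (X r)) s).
  { split_continuous HX. unfold state_continuous, isentropic, velocity.
    cbn [x_n x_q x_a x_b x_al x_A x_B x_J x_d x_ph].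
    split_all; continuity_side. }
  assert (CdY : continuous (fun r => dYf (X r) (isentropic (X r))) s).
  { split_continuous HX. split_continuous CV. unfold dYf. continuity_side. }
  assert (CdZ : continuous (fun r => dZf (X r) (isentropic (X r))) s).
  { split_continuous HX. split_continuous CV. unfold dZf, Ef, Ef'. continuity_side. }
  unfold Ff. continuity_side.
Qed.

(** Holding a fixed is the curve with [y = 0] and d ln T = 1, so continuity of all coordinates is
    inherited from [state_derive_curve]. *)
Lemma continuous_inflection_F (g : gas) (T a : R) :
  positive_gas g -> 0 < T -> 0 < a < 1 -> continuous (fun s => inflection_F g s a) T.
Proof.
  intros Hg HT Ha. unfold inflection_F. apply continuous_Ff.
  assert (Dc : is_derive (fun _ : R => a) T (a * (1 - a) * 0)).
  { rewrite Rmult_0_r. apply (is_derive_const a T). }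
  pose proof (state_derive_curve g Hg (fun r => r) (fun _ => a) T (/ T) 0 HT Ha
    (is_derive_ln_id T HT) Dc) as D.
  assert (C : forall (f : R -> R) (l : R), is_derive f T l -> continuous f T).
  { intros f l H. apply (ex_derive_continuous f). exists l. exact H. }
  destruct D as (D1 & D2 & D3 & D4 & D5 & D6 & D7 & D8 & D9 & D10).
  unfold state_continuous. split_all; eapply C; eassumption.
Qed.

Theorem theorem3
  (g : gas) (S : R -> R -> R)
  (hR : 0 < Rgas g) (hM : 0 < Mgas g)
  (hmuA : 0 < muA g) (hmuB : 0 < muB g)
  (hbeta : 0 < beta g < 1)
  (hTA : 0 < TA g) (hTAB : TA g < TB g) (hTB : TB g <= 2 * TA g)
  (hS : is_entropy g S) :
  (exists a1 a2 : R -> R,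
     (* The locus at small T consists of exactly the two branches, away from aA = 1. *)
     (forall delta : R, 0 < delta < 1 ->
      exists T0 : R, 0 < T0 /\
      forall T : R, 0 < T < T0 ->
        0 < a1 T < delta /\ 0 < a2 T < delta /\ a1 T <> a2 T /\
        continuous a1 T /\ continuous a2 T /\
        forall (k : char_family) (aA : R), 0 < aA < delta ->
          (inflection_locus g S k T aA <-> aA = a1 T \/ aA = a2 T)) /\
     is_equiv (at_right 0) a1
       (fun T => 60 / beta g * (T / TA g) ^ 3) /\
     is_equiv (at_right 0) (fun T => degB g T (a1 T))
       (fun T => 60 * muA g / (beta g * muB g) * (T / TA g) ^ 3
                 * exp (- (TB g - TA g) / T)) /\
     is_equiv (at_right 0) a2
       (fun T => 1 / beta g * Rpower (T / TA g) (3 / 2)) /\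
     is_equiv (at_right 0) (fun T => degB g T (a2 T))
       (fun T => muA g / (beta g * muB g) * Rpower (T / TA g) (3 / 2)
                 * exp (- (TB g - TA g) / T))) /\
  (forall (k : char_family) (U : R * R -> Prop), locally (0, 0) U ->
     ~ genuinely_nonlinear_on g S k U /\
     exists T aA : R, U (T, aA) /\ inflection_locus g S k T aA).
Proof.
  assert (Hg : positive_gas g) by (unfold positive_gas; tauto).
  assert (Hsmall : forall e, 0 < e -> at_right 0 (fun T => 0 < branch1 g T < e)).
  { intros e He. generalize (branches_small g Hg e He). apply filter_imp. intros; lra. }
  assert (Hsmall2 : forall e, 0 < e -> at_right 0 (fun T => 0 < branch2 g T < e)).
  { intros e He. generalize (branches_small g Hg e He). apply filter_imp. intros; lra. }
  assert (Hmain : forall delta : R, 0 < delta < 1 ->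
      exists T0 : R, 0 < T0 /\
      forall T : R, 0 < T < T0 ->
        0 < branch1 g T < delta /\ 0 < branch2 g T < delta /\ branch1 g T <> branch2 g T /\
        continuous (branch1 g) T /\ continuous (branch2 g) T /\
        forall (k : char_family) (aA : R), 0 < aA < delta ->
          (inflection_locus g S k T aA <-> aA = branch1 g T \/ aA = branch2 g T)).
  { intros delta Hd.
    (* [F_tail] needs an endpoint above 1/20, which [delta] may not be. From 1/20 on, the tail bound
       takes over from the concavity interval (0, 1/10), so all of (0, delta) is covered. *)
    assert (Hmax : 1 / 20 < Rmax delta (1 / 2) < 1).
    { split; [pose proof (Rmax_r delta (1 / 2)); lra|apply Rmax_lub_lt; lra]. }
    destruct (filter_and _ _ (two_branches_eventually g Hg)
      (filter_and _ _ (branches_small g Hg delta (proj1 Hd)) (F_tail g Hg _ Hmax))) as [T0 HT0].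
    assert (HT0' : forall T, 0 < T < T0 -> two_branches g T /\
      (0 < branch1 g T < branch2 g T /\ branch2 g T < delta) /\
      (forall a, 1 / 20 <= a < Rmax delta (1 / 2) -> inflection_F g T a < 0)).
    { intros T HT. apply HT0; [|lra].
      unfold ball; simpl; unfold AbsRing_ball, abs, minus, plus, opp; simpl.
      rewrite Ropp_0, Rplus_0_r, Rabs_right; lra. }
    exists T0. split; [apply cond_pos|]. intros T HT.
    destruct (HT0' T HT) as (HB & Hlt & Htail).
    destruct (continuous_branches g T0 T (fun s Hs => proj1 (HT0' s Hs))
      (fun s a Hs Ha => continuous_inflection_F g s a Hg Hs Ha) HT) as [C1 C2].
    split_all; try lra; try assumption.
    intros k aA HaA.
    rewrite (inflection_locus_iff g S k T aA Hg hS) by lra. split.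
    - destruct HB as (_ & _ & _ & _ & E1 & E2 & S1 & S2 & S3).
      fold (inflection_F g T aA). intros HF.
      destruct (Rtotal_order aA (branch1 g T)) as [H1|[H1|H1]]; [|left; exact H1|].
      + specialize (S1 aA ltac:(lra)). lra.
      + destruct (Rtotal_order aA (branch2 g T)) as [H2|[H2|H2]]; [|right; exact H2|].
        * specialize (S2 aA ltac:(lra)). lra.
        * pose proof (Rmax_l delta (1 / 2)).
          destruct (Rlt_le_dec aA (1 / 20)) as [H3|H3].
          -- specialize (S3 aA ltac:(lra)). lra.
          -- specialize (Htail aA ltac:(lra)). lra.
    - destruct HB as (_ & _ & _ & _ & E1 & E2 & _).
      intros [-> | ->]; assumption. }
  split.
  - exists (branch1 g), (branch2 g).
    pose proof (sandwiched_branch1 g Hg) as W1. pose proof (sandwiched_branch2 g Hg) as W2.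
    split; [exact Hmain|]. split; [|split; [|split]].
    + apply is_equiv_sandwiched, W1.
    + pose proof (is_equiv_sandwiched _ _ (sandwiched_degB g Hg _ _ W1 Hsmall)) as E.
      intros eps. generalize (E eps). apply filter_imp. intros T.
      replace (saha_ratio g T * (60 / beta g * (T / TA g) ^ 3)) with
        (60 * muA g / (beta g * muB g) * (T / TA g) ^ 3 * exp (- (TB g - TA g) / T));
        [exact (fun H => H)|].
      unfold saha_ratio. set (w := exp (- (TB g - TA g) / T)). set (h := T / TA g). field. lra.
    + apply is_equiv_sandwiched, W2.
    + pose proof (is_equiv_sandwiched _ _ (sandwiched_degB g Hg _ _ W2 Hsmall2)) as E.
      intros eps. generalize (E eps). apply filter_imp. intros T.
      replace (saha_ratio g T * (1 / beta g * Rpower (T / TA g) (3 / 2))) with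
        (muA g / (beta g * muB g) * Rpower (T / TA g) (3 / 2) * exp (- (TB g - TA g) / T));
        [exact (fun H => H)|].
      unfold saha_ratio. set (w := exp (- (TB g - TA g) / T)).
      set (h := Rpower (T / TA g) (3 / 2)). field. lra.
  - intros k U [eps HU].
    assert (Hex : exists T aA : R, U (T, aA) /\ inflection_locus g S k T aA).
    { pose proof (cond_pos eps) as He.
      (* With this delta and T <= eps/2 the point (T, [branch1 g T]) lies in the box of radius [eps]
         around the origin. *)
      assert (Hd : 0 < Rmin eps (1 / 2) < 1).
      { split; [apply Rmin_pos; lra|]. pose proof (Rmin_r eps (1 / 2)). lra. }
      destruct (Hmain _ Hd) as [T0 [HT0 H]].
      set (T := Rmin (T0 / 2) (eps / 2)).
      assert (HT : 0 < T) by (apply Rmin_pos; lra).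
      pose proof (Rmin_l (T0 / 2) (eps / 2)) as M1. pose proof (Rmin_r (T0 / 2) (eps / 2)) as M2.
      fold T in M1, M2.
      destruct (H T ltac:(lra)) as (R1 & _ & _ & _ & _ & HI).
      pose proof (Rmin_l eps (1 / 2)) as M3.
      exists T, (branch1 g T). split.
      - apply HU. split; unfold ball; simpl; unfold AbsRing_ball, abs, minus, plus, opp; simpl;
          rewrite Ropp_0, Rplus_0_r, Rabs_right; lra.
      - apply HI; [exact R1|left; reflexivity]. }
    split; [|exact Hex].
    intros Hn. destruct Hex as (T & aA & HUT & HT & Ha & Hz).
    exact (Hn T aA 0 HUT HT Ha (Hz 0)).
Qed.
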